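(* Let $M$ be a connected oriented $n$-dimensional Riemannian manifold with a $Spin^r(n)$ structure ($r\ge 2$), with auxiliary rank $r$ oriented Riemannian bundle $F$ endowed with a metric connection $\nabla^F$, and let $m\in\mathbb N$ be such that $S=S(TM)\otimes S(F)^{\otimes m}$ is globally defined. Let $\phi\in\Gamma(S)$ be a non-zero real Killing spinor, i.e. $\nabla^\theta_X\phi=\mu X\cdot\phi$ for all $X\in\Gamma(TM)$, for a constant $\mu\in\mathbb R$. Then: 1. The Ricci endomorphism decomposes as $$\mathrm{Ric}=4(n-1)\mu^2\,\mathrm{Id}_{TM}+\frac1{|\phi|^2}\sum_{k<l}\hat\Theta_{kl}\circ\hat\eta^\phi_{kl}.$$ 2. The scalar curvature is $$\mathrm R=4n(n-1)\mu^2+\frac1{|\phi|^2}\sum_{k<l}\mathrm{tr}(\hat\Theta_{kl}\circ\hat\eta^\phi_{kl}).$$ 3. If the connection on $F$ is flat, then $M$ is Einstein. 4. If $\eta^\phi_{kl}=0$ for all $1\le k<l\le r$, then $M$ is Einstein.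
   Context: Clifford algebra: $Cl_n$ is generated by an orthonormal basis $e_1,\dots,e_n$ of $\mathbb R^n$ with $e_ie_j+e_je_i=-2\delta_{ij}$; $\Delta_n=\mathbb C^{2^{[n/2]}}$ is the complex spinor space, on which $Cl_n$ acts via $\kappa$ (the isomorphism $Cl_n\otimes\mathbb C\cong\mathrm{End}(\Delta_n)$ for $n$ even; for $n$ odd the isomorphism with $\mathrm{End}(\Delta_n)\oplus\mathrm{End}(\Delta_n)$ followed by the projection to the first summand), with Hermitian product for which Clifford multiplication $x\cdot\phi=\kappa(x)\phi$ by vectors is skew; $X\wedge Y$ acts as $X\cdot Y+\langle X,Y\rangle$. $Spin(n)\subset Cl_n$ has Lie algebra spanned by $e_ie_j$, $i<j$; $\lambda_n:Spin(n)\to SO(n)$ is the double cover, with $\lambda_{n*}(e_ie_j)=2E_{ij}$, $E_{ij}:e_i\mapsto e_j,\ e_j\mapsto -e_i$. $\kappa^m_r$ is the representation of $Spin(r)$ on $\Delta_r^{\otimes m}$, and $\kappa^m_{r*}(f_kf_l)$ is the sum over $a=1,\dots,m$ of Clifford multiplication by $f_kf_l$ in the $a$-th factor. On $\Delta_n\otimes\Delta_r^{\otimes m}$, vectors and forms of $\mathbb R^n$ act on $\Delta_n$ and $\kappa^m_{r*}(f_kf_l)$ acts on $\Delta_r^{\otimes m}$. $Spin^r(n)=(Spin(n)\times Spin(r))/\{\pm(1,1)\}$. A $Spin^r(n)$ structure on $M$ is a principal $SO(r)$-bundle $P_{SO(r)}$ and a principal $Spin^r(n)$-bundle $P$ with a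 2:1 covering $P\to P_{SO(M)}\tilde\times P_{SO(r)}$ (fibered product) equivariant with respect to $\lambda_n\times\lambda_r$. $F$ is the rank $r$ vector bundle associated to $P_{SO(r)}$, and $S=S(TM)\otimes S(F)^{\otimes m}$ is the bundle with fiber $\Delta_n\otimes\Delta_r^{\otimes m}$ associated to $\kappa_n\otimes\kappa_r^m$; it is globally defined if $m$ is odd (structure group $Spin^r(n)$), or if $M$ and $F$ are both Spin (group $Spin(n)\times Spin(r)$, any $m$), or if $M$ is Spin and $m$ is even (group $Spin(n)\times SO(r)$). $\nabla^\theta$ is the covariant derivative on $S$ induced by the Levi-Civita connection and $\nabla^F$. For local orthonormal frames $(e_i)$ of $TM$ and $(f_k)$ of $F$: $\Theta_{kl}(X,Y)=\langle R^F(X,Y)f_k,f_l\rangle$, where $R^F(X,Y)=[\nabla^F_X,\nabla^F_Y]-\nabla^F_{[X,Y]}$; for $k\neq l$, $\eta^\phi_{kl}(X,Y)=\mathrm{Re}\langle X\wedge Y\cdot\kappa^m_{r*}(f_kf_l)\cdot\phi,\phi\rangle$, a local real 2-form. For a 2-form $\xi$, $\hat\xi$ is the skew endomorphism $\hat\xi(X)=(X\lrcorner\xi)^\sharp$, i.e. $\langle\hat\xi(X),Y\rangle=\xi(X,Y)$. $\mathrm{Ric}$ is the Ricci endomorphism (positive on round spheres) and $\mathrm R$ its trace. *)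

(* Defs.v *)
From HB Require Import structures.
From mathcomp Require Import all_boot all_order all_algebra.
From mathcomp Require Import all_classical all_reals all_analysis.
From mathcomp Require Import complex.

Set Implicit Arguments.
Unset Strict Implicit.
Unset Printing Implicit Defensive.

Import Order.TTheory GRing.Theory Num.Theory.
Import numFieldNormedType.Exports.
Local Open Scope classical_set_scope.
Local Open Scope ring_scope.
Local Open Scope complex_scope.

Section Euclidean.
Context {R : realType} {n : nat}.

(* [O] is meant to be open: [f] is k times continuously differentiable on [O],
   in terms of iterated partial derivatives. *)
Fixpoint Ck (k : nat) (f : 'rV[R]_n -> R) (O : set 'rV[R]_n) : Prop :=
  (forall x, O x -> {for x, continuous f}) /\
  if k is k'.+1 then
    forall i : 'I_n,
      (forall x, O x -> derivable f x (delta_mx 0 i)) /\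
      Ck k' (fun x => 'D_(delta_mx 0 i) f x) O
  else True.

Definition Cinfty (f : 'rV[R]_n -> R) (O : set 'rV[R]_n) : Prop :=
  forall k, Ck k f O.

End Euclidean.

(* A distinguished chart [chart_at p] around every point p is part of the
   data. It identifies T_pM with R^n (row vectors), so that a tangent vector at
   p is the list of its coordinates in [chart_at p]. *)
Record manifold (R : realType) (n : nat) := Manifold {
  mspace :> topologicalType;
  chart : Type;
  cdom : chart -> set mspace;
  cmap : chart -> mspace -> 'rV[R]_n;
  cinv : chart -> 'rV[R]_n -> mspace;
  chart_at : mspace -> chart;
  m_hausdorff : hausdorff_space mspace;
  m_countable : @second_countable mspace;
  cdom_open : forall c, open (cdom c);
  cimg_open : forall c, open (cmap c @` cdom c);
  cmapK : forall c p, cdom c p -> cinv c (cmap c p) = p;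
  cmap_cont : forall c p, cdom c p -> {for p, continuous (cmap c)};
  cinv_cont : forall c x, (cmap c @` cdom c) x -> {for x, continuous (cinv c)};
  chart_atP : forall p, cdom (chart_at p) p;
  c_smooth : forall c d (i : 'I_n),
    Cinfty (fun x => cmap d (cinv c x) 0 i) (cmap c @` (cdom c `&` cdom d))
}.
Arguments chart {R n} M : rename.
Arguments cdom {R n M} c : rename.
Arguments cmap {R n M} c : rename.
Arguments cinv {R n M} c : rename.
Arguments chart_at {R n M} p : rename.

Section Manifold.
Context {R : realType} {n : nat} {M : manifold R n}.

Definition smooth_on (U : set M) (f : M -> R) : Prop :=
  forall c : chart M,
    Cinfty (fun x => f (cinv c x)) (cmap c @` (U `&` cdom c)).

(* v(f) for v in T_pM *)
Definition dderiv (p : M) (v : 'rV[R]_n) (f : M -> R) : R :=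
  'D_v (fun x => f (cinv (chart_at p) x)) (cmap (chart_at p) p).

(* The vector field on [cdom c] with constant coordinates v in the chart c:
   its value at q is expressed, like every tangent vector at q, in the
   coordinates of [chart_at q]. *)
Definition coord_field (c : chart M) (v : 'rV[R]_n) (q : M) : 'rV[R]_n :=
  \row_i 'D_v (fun x => cmap (chart_at q) (cinv c x) 0 i) (cmap c q).

Definition coord_frame (c : chart M) (q : M) : 'M[R]_n :=
  \matrix_(i < n) coord_field c (delta_mx 0 i) q.

(* [X,Y] at p, from [X,Y]f = X(Yf) - Y(Xf) applied to the coordinate functions
   of [chart_at p]. *)
Definition bracket (X Y : M -> 'rV[R]_n) (p : M) : 'rV[R]_n :=
  \row_i let ci := fun q => cmap (chart_at p) q 0 i in
    dderiv p (X p) (fun q => dderiv q (Y q) ci) -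
    dderiv p (Y p) (fun q => dderiv q (X q) ci).

(* Every fibre of a bundle of rank d is identified with R^d (row vectors) by an
   arbitrary linear isomorphism, with no regularity in the base point; the
   smooth structure is carried by an atlas of local frames (U, b), the rows of
   [b p] being the frame at p. *)
Definition vbundle (d : nat) := set (set M * (M -> 'M[R]_d)).

Definition is_vbundle d (E : vbundle d) : Prop :=
  [/\ forall p : M, exists2 Ub, E Ub & Ub.1 p,
      forall Ub, E Ub -> open Ub.1,
      forall Ub p, E Ub -> Ub.1 p -> Ub.2 p \in unitmx &
      forall Ub Vc (i j : 'I_d), E Ub -> E Vc ->
        smooth_on (Ub.1 `&` Vc.1)
          (fun p => (Ub.2 p *m invmx (Vc.2 p)) i j)].

Definition TM : vbundle n :=
  [set Ub | exists c : chart M, Ub = (cdom c, coord_frame c)].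

Definition smooth_section d (E : vbundle d) (U : set M) (s : M -> 'rV[R]_d) :=
  forall Vb (j : 'I_d), E Vb ->
    smooth_on (U `&` Vb.1) (fun p => (s p *m invmx (Vb.2 p)) 0 j).

Definition smooth_frame d (E : vbundle d) (U : set M) (b : M -> 'M[R]_d) :=
  forall i : 'I_d, smooth_section E U (fun p => row i (b p)).

Definition ip d (G : M -> 'M[R]_d) (p : M) (u v : 'rV[R]_d) : R :=
  (u *m G p *m v^T) 0 0.

Definition is_metric d (E : vbundle d) (G : M -> 'M[R]_d) : Prop :=
  [/\ forall p, (G p)^T = G p,
      forall p u, u != 0 -> 0 < ip G p u u &
      forall (U : set M) s t, open U ->
        smooth_section E U s -> smooth_section E U t ->
        smooth_on U (fun p => ip G p (s p) (t p))].

(* [o p] tells whether the identification of the fibre at p with R^d reverses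
   the orientation. *)
Definition pos_frame d (o : M -> bool) (p : M) (A : 'M[R]_d) : Prop :=
  0 < (-1) ^+ o p * \det A.

Definition is_orientation d (E : vbundle d) (o : M -> bool) : Prop :=
  forall p, exists (U : set M) (b : M -> 'M[R]_d),
    [/\ open U, U p, smooth_frame E U b & forall q, U q -> pos_frame o q (b q)].

Definition orthonormal d (G : M -> 'M[R]_d) (p : M) (A : 'M[R]_d) : Prop :=
  A *m G p *m A^T = 1%:M.

Definition orthonormal_frame d (E : vbundle d) (G : M -> 'M[R]_d)
    (U : set M) (b : M -> 'M[R]_d) : Prop :=
  [/\ open U, smooth_frame E U b & forall p, U p -> orthonormal G p (b p)].

(* [nabla p v s] is the derivative at p of the section s, smooth near p, in the
   direction v in T_pM. *)
Definition connection d := M -> 'rV[R]_n -> (M -> 'rV[R]_d) -> 'rV[R]_d.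

Definition is_connection d (E : vbundle d) (nabla : connection d) : Prop :=
  forall U : set M, open U ->
  [/\ forall s, smooth_section E U s -> forall p, U p -> forall a v w,
        nabla p (a *: v + w) s = a *: nabla p v s + nabla p w s,
      forall s t, smooth_section E U s -> smooth_section E U t ->
        forall p, U p -> forall v,
        nabla p v (fun q => s q + t q) = nabla p v s + nabla p v t,
      forall f s, smooth_on U f -> smooth_section E U s ->
        forall p, U p -> forall v,
        nabla p v (fun q => f q *: s q) =
          dderiv p v f *: s p + f p *: nabla p v s,
      forall s t, smooth_section E U s -> smooth_section E U t ->
        (forall q, U q -> s q = t q) ->
        forall p, U p -> forall v, nabla p v s = nabla p v t &
      forall X s, smooth_section TM U X -> smooth_section E U s ->
        smooth_section E U (fun p => nabla p (X p) s)].

Definition is_metric_connection d (E : vbundle d) (G : M -> 'M[R]_d)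
    (nabla : connection d) : Prop :=
  is_connection E nabla /\
  forall (U : set M) s t, open U ->
    smooth_section E U s -> smooth_section E U t ->
    forall p, U p -> forall v,
      dderiv p v (fun q => ip G q (s q) (t q)) =
        ip G p (nabla p v s) (t p) + ip G p (s p) (nabla p v t).

Definition is_levi_civita (g : M -> 'M[R]_n) (nabla : connection n) : Prop :=
  is_metric_connection TM g nabla /\
  forall (U : set M) X Y, open U ->
    smooth_section TM U X -> smooth_section TM U Y ->
    forall p, U p -> nabla p (X p) Y - nabla p (Y p) X = bracket X Y p.

Definition curvature d (nabla : connection d) (X Y : M -> 'rV[R]_n)
    (s : M -> 'rV[R]_d) (p : M) : 'rV[R]_d :=
  nabla p (X p) (fun q => nabla q (Y q) s) -
  nabla p (Y p) (fun q => nabla q (X q) s) -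
  nabla p (bracket X Y p) s.

Definition is_flat d (E : vbundle d) (nabla : connection d) : Prop :=
  forall (U : set M) X Y s, open U ->
    smooth_section TM U X -> smooth_section TM U Y -> smooth_section E U s ->
    forall p, U p -> curvature nabla X Y s p = 0.

(* Tensors at p are given by their components in the coordinate basis of
   [chart_at p], extended by the coordinate fields when they must be
   differentiated. *)
Definition del (p : M) (i : 'I_n) : M -> 'rV[R]_n :=
  coord_field (chart_at p) (delta_mx 0 i).

(* An endomorphism of T_pM is a matrix acting on the right of row vectors, so
   that composition is the reversed product of matrices. *)
Definition endo_comp (A B : 'M[R]_n) : 'M[R]_n := B *m A.

(* The endomorphism A with g(A(v), w) = xi(v, w). *)
Definition sharp (g : M -> 'M[R]_n) (p : M) (xi : 'M[R]_n) : 'M[R]_n :=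
  xi *m invmx (g p).

(* ric(v, w) = tr (u |-> R(u, v) w), positive on round spheres *)
Definition ricci_form (nabla : connection n) (p : M) : 'M[R]_n :=
  \matrix_(i, j) \sum_(k < n)
    (curvature nabla (del p k) (del p i) (del p j) p) 0 k.

Definition Ric (g : M -> 'M[R]_n) (nabla : connection n) (p : M) : 'M[R]_n :=
  sharp g p (ricci_form nabla p).

Definition scalar_curvature (g : M -> 'M[R]_n) (nabla : connection n) (p : M) :=
  \tr (Ric g nabla p).

Definition is_einstein (g : M -> 'M[R]_n) (nabla : connection n) : Prop :=
  exists lam : R, forall p, Ric g nabla p = lam%:M.

End Manifold.
Arguments vbundle {R n} M d.
Arguments connection {R n} M d.
Arguments TM {R n} M.

Section Clifford.
Context {R : realType}.

(* Cl_n in the basis (e_A), where e_A is the increasing product of the e_i for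
   i in A. *)
Definition Cl (n : nat) := {ffun {set 'I_n} -> R}.

Definition cl1 {n} : Cl n := [ffun A => (A == finset.set0)%:R].

Definition clvec {n} (x : 'rV[R]_n) : Cl n :=
  [ffun A : {set 'I_n} => \sum_(i | A == [set i]%SET) x 0 i].

(* e_A e_B = +/- e_C where C is the symmetric difference: one sign for every
   transposition e_i e_j = - e_j e_i with i in A, j in B, i > j, and one for
   every e_i e_i = -1 with i in both. *)
Definition clmul {n} (a b : Cl n) : Cl n :=
  [ffun C => \sum_(A : {set 'I_n}) \sum_(B : {set 'I_n} |
      C == ((A :\: B) :|: (B :\: A))%SET)
    (-1) ^+ #|[set ij : 'I_n * 'I_n |
        [&& ij.1 \in A, ij.2 \in B & (ij.2 <= ij.1)%N]]%SET| * (a A * b B)].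

(* the anti-automorphism fixing vectors *)
Definition clrev {n} (a : Cl n) : Cl n :=
  [ffun A : {set 'I_n} => (-1) ^+ 'C(#|A|, 2) * a A].

Definition Spin (n : nat) : set (Cl n) :=
  [set g | exists vs : seq 'rV[R]_n,
    [/\ ~~ odd (size vs),
        all (fun v : 'rV[R]_n => \sum_i (v 0 i) ^+ 2 == 1) vs &
        g = foldr (fun v => clmul (clvec v)) cl1 vs]].

(* The matrix of lambda_n(g) : x |-> g x g^-1 on column vectors, where
   g^-1 = rev g for g in Spin(n). *)
Definition spin_cover {n} (g : Cl n) : 'M[R]_n :=
  \matrix_(j, i) clmul (clmul g (clvec (delta_mx 0 i))) (clrev g) [set j]%SET.

(* Clifford multiplications [k i] by the e_i on Delta_n *)
Definition spin_rep (n : nat) := 'I_n -> 'M[R[i]]_(2 ^ n./2).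

Definition kappa_vec {n} (k : spin_rep n) (x : 'rV[R]_n) : 'M[R[i]]_(2 ^ n./2) :=
  \sum_(i < n) (x 0 i)%:C *: k i.

Definition kappa_basis {n} (k : spin_rep n) (A : {set 'I_n}) :
    'M[R[i]]_(2 ^ n./2) :=
  \big[mulmx/1%:M]_(i <- enum A) k i.

Definition kappa {n} (k : spin_rep n) (g : Cl n) : 'M[R[i]]_(2 ^ n./2) :=
  \sum_(A : {set 'I_n}) (g A)%:C *: kappa_basis k A.

(* kappa : Cl_n (x) C -> End(Delta_n) is a homomorphism of algebras onto
   End(Delta_n), skew on vectors for the standard Hermitian product. By
   dimension it is an isomorphism for n even; for n odd it is one of the two
   components of an isomorphism onto End(Delta_n) (+) End(Delta_n), the other
   one being given on vectors by -kappa. *)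
Definition is_spin_rep n (k : spin_rep n) : Prop :=
  [/\ forall i j, k i *m k j + k j *m k i = ((i == j)%:R *- 2)%:M,
      forall i, (map_mx conjc (k i))^T = - k i &
      forall T : 'M[R[i]]_(2 ^ n./2), exists a : {set 'I_n} -> R[i],
        T = \sum_(A : {set 'I_n}) a A *: kappa_basis k A].

Section Tensor.
Context {n r m : nat} (kn : spin_rep n) (kr : spin_rep r).

(* Delta_n (x) Delta_r^(x)m, in the tensor product of the standard bases *)
Definition spinor_index : finType :=
  ('I_(2 ^ n./2) * {ffun 'I_m -> 'I_(2 ^ r./2)})%type.

Definition spinor := {ffun spinor_index -> R[i]}.

Definition herm (psi chi : spinor) : R[i] := \sum_x psi x * conjc (chi x).

Definition act_left (A : 'M[R[i]]_(2 ^ n./2)) (psi : spinor) : spinor :=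
  [ffun x : spinor_index => \sum_i A x.1 i * psi (i, x.2)].

Definition act_factor (a : 'I_m) (B : 'M[R[i]]_(2 ^ r./2)) (psi : spinor) :
    spinor :=
  [ffun x : spinor_index => \sum_j B (x.2 a) j *
    psi (x.1, [ffun b => if b == a then j else x.2 b])].

(* kappa_n(g) (x) kappa_r(h) (x) ... (x) kappa_r(h) *)
Definition spin_act (g : Cl n) (h : Cl r) (psi : spinor) : spinor :=
  [ffun x : spinor_index => \sum_(y : spinor_index) kappa kn g x.1 y.1 *
    (\prod_(a < m) kappa kr h (x.2 a) (y.2 a)) * psi y].

(* kappa^m_{r*}(u w) for orthogonal vectors u, w *)
Definition kappa_star (u w : 'rV[R]_r) (psi : spinor) : spinor :=
  \sum_(a < m) act_factor a (kappa_vec kr u *m kappa_vec kr w) psi.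

End Tensor.
End Clifford.
Arguments Cl R n : clear implicits.
Arguments Spin R n : clear implicits.
Arguments spin_rep R n : clear implicits.
Arguments spinor R n r m : clear implicits.

(* SpinR    : Spin^r(n)          = (Spin(n) x Spin(r)) / {(1,1), (-1,-1)}
   SpinSpin : Spin(n) x Spin(r)
   SpinSO   : Spin(n) x SO(r)    = (Spin(n) x Spin(r)) / {(1,1), (1,-1)} *)
Inductive spin_group := SpinR | SpinSpin | SpinSO.

Definition spin_kernel {R : realType} {n r} (k : spin_group)
    (g : Cl R n) (h : Cl R r) : Prop :=
  match k with
  | SpinR => (g = cl1 /\ h = cl1) \/ (g = - cl1 /\ h = - cl1)
  | SpinSpin => g = cl1 /\ h = cl1
  | SpinSO => g = cl1 /\ (h = cl1 \/ h = - cl1)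
  end.

(* when kappa_n (x) kappa_r^m is trivial on the kernel *)
Definition globally_defined (k : spin_group) (m : nat) : bool :=
  match k with SpinR => odd m | SpinSpin => true | SpinSO => ~~ odd m end.

Section Structures.
Context {R : realType} {n : nat} {M : manifold R n} {r : nat}.

(* A principal bundle of one of the three groups above, over the fibred product
   of the bundles of oriented orthonormal frames of TM and F. The group acts
   through Spin(n) x Spin(r), and [pfrT q], [pfrF q] have as rows the two frames
   below q. The smooth structure is given by an atlas of local sections. *)
Record spin_bundle := SpinBundle {
  ptotal :> Type;
  pbase : ptotal -> M;
  pact : ptotal -> Cl R n -> Cl R r -> ptotal;
  pfrT : ptotal -> 'M[R]_n;
  pfrF : ptotal -> 'M[R]_r;
  patlas : set (set M * (M -> ptotal))
}.
Arguments patlas s : clear implicits.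

(* t = s.(g, h) on U `&` V for locally defined smooth g, h *)
Definition smooth_transition (P : spin_bundle) (Us Vt : set M * (M -> P)) :=
  forall p, (Us.1 `&` Vt.1) p ->
  exists (W : set M) (g : M -> Cl R n) (h : M -> Cl R r),
  [/\ [/\ open W, W p & W `<=` Us.1 `&` Vt.1],
      forall A, smooth_on W (fun q => g q A),
      forall B, smooth_on W (fun q => h q B) &
      forall q, W q ->
        [/\ Spin R n (g q), Spin R r (h q) &
            Vt.2 q = pact (Us.2 q) (g q) (h q)]].

(* The map (pfrT, pfrF) to the fibred product of frame bundles is equivariant
   with respect to lambda_n x lambda_r; its fibres are therefore the orbits of
   {+/-1} x {+/-1} modulo the kernel (two points for SpinR). A frame A, seen as
   the isometry x |-> sum_i x_i e_i, is composed with a rotation L by taking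
   the rows of L^T A. *)
Definition is_spin_bundle (k : spin_group)
    (g : M -> 'M[R]_n) (oM : M -> bool)
    (F : vbundle M r) (gF : M -> 'M[R]_r) (oF : M -> bool)
    (P : spin_bundle) : Prop :=
  [/\ [/\ forall q : P, pact q cl1 cl1 = q,
          forall (q : P) a b a' b',
            Spin R n a -> Spin R r b -> Spin R n a' -> Spin R r b' ->
            pact (pact q a b) a' b' = pact q (clmul a a') (clmul b b'),
          forall (q : P) a b, Spin R n a -> Spin R r b ->
            (pact q a b = q <-> spin_kernel k a b) &
          forall q q' : P, pbase q = pbase q' <->
            exists a b, [/\ Spin R n a, Spin R r b & q' = pact q a b]],
      forall q : P,
        [/\ orthonormal g (pbase q) (pfrT q), pos_frame oM (pbase q) (pfrT q),
            orthonormal gF (pbase q) (pfrF q) & pos_frame oF (pbase q) (pfrF q)],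
      forall (q : P) a b, Spin R n a -> Spin R r b ->
        pfrT (pact q a b) = (spin_cover a)^T *m pfrT q /\
        pfrF (pact q a b) = (spin_cover b)^T *m pfrF q &
      [/\ forall p : M, exists2 Us, patlas P Us & Us.1 p,
          forall Us, patlas P Us -> open Us.1 /\
            (forall p, Us.1 p -> pbase (Us.2 p) = p),
          forall Us, patlas P Us ->
            smooth_frame (TM M) Us.1 (fun p => pfrT (Us.2 p)) /\
            smooth_frame F Us.1 (fun p => pfrF (Us.2 p)) &
          forall Us Vt, patlas P Us -> patlas P Vt -> smooth_transition Us Vt]].

Section Spinors.
Context {m : nat} (kn : spin_rep R n) (kr : spin_rep R r) {P : spin_bundle}.

(* Sections of the bundle associated with P and kappa_n (x) kappa_r^m, as
   equivariant functions phi(q.(a, b)) = (a, b)^-1 phi(q) *)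
Definition spinor_section (phi : P -> spinor R n r m) : Prop :=
  (forall (q : P) a b, Spin R n a -> Spin R r b ->
     spin_act kn kr a b (phi (pact q a b)) = phi q) /\
  (forall Us, patlas P Us -> forall x,
     smooth_on Us.1 (fun p => complex.Re (phi (Us.2 p) x)) /\
     smooth_on Us.1 (fun p => complex.Im (phi (Us.2 p) x))).

(* Clifford multiplication by v in T_pM in the trivialization given by q over
   p, and similarly for vectors of F *)
Definition cliffT (q : P) (v : 'rV[R]_n) : 'M[R[i]]_(2 ^ n./2) :=
  kappa_vec kn (v *m invmx (pfrT q)).

Definition star_F (q : P) (u w : 'rV[R]_r) :
    spinor R n r m -> spinor R n r m :=
  kappa_star kr (u *m invmx (pfrF q)) (w *m invmx (pfrF q)).

(* The derivative of phi induced by the two connections, in the trivialization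
   given by the local section s: a connection form sum_(i<j) w_ij E_ij lifts to
   1/2 sum_(i<j) w_ij e_i e_j as lambda_*(e_i e_j) = 2 E_ij. *)
Definition spinor_nabla (g : M -> 'M[R]_n) (nablaM : connection M n)
    (gF : M -> 'M[R]_r) (nablaF : connection M r)
    (phi : P -> spinor R n r m) (s : M -> P) (p : M) (v : 'rV[R]_n) :
    spinor R n r m :=
  let e i q := row i (pfrT (s q)) in
  let f k q := row k (pfrF (s q)) in
  [ffun x => dderiv p v (fun q => complex.Re (phi (s q) x)) +i*
             dderiv p v (fun q => complex.Im (phi (s q) x))]
  + (2^-1)%:C *: (\sum_(i < n) \sum_(j < n | (i < j)%N)
      (ip g p (nablaM p v (e i)) (e j p))%:C *:
        act_left (kn i *m kn j) (phi (s p)))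
  + (2^-1)%:C *: (\sum_(k < r) \sum_(l < r | (k < l)%N)
      (ip gF p (nablaF p v (f k)) (f l p))%:C *:
        star_F (s p) (f k p) (f l p) (phi (s p))).

Definition is_killing (g : M -> 'M[R]_n) (nablaM : connection M n)
    (gF : M -> 'M[R]_r) (nablaF : connection M r) (mu : R)
    (phi : P -> spinor R n r m) : Prop :=
  forall Us, patlas P Us -> forall p, Us.1 p -> forall v : 'rV[R]_n,
    spinor_nabla g nablaM gF nablaF phi Us.2 p v =
      mu%:C *: act_left (cliffT (Us.2 p) v) (phi (Us.2 p)).

Definition norm2 (phi : P -> spinor R n r m) (q : P) : R :=
  complex.Re (herm (phi q) (phi q)).

(* The components of eta_kl^phi at [pbase q], for vectors fk, fl of the fibre
   of F; v /\ w acts as v.w + <v, w>. *)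
Definition eta_form (g : M -> 'M[R]_n) (phi : P -> spinor R n r m) (q : P)
    (fk fl : 'rV[R]_r) : 'M[R]_n :=
  \matrix_(i, j)
    let v : 'rV[R]_n := delta_mx 0 i in
    let w : 'rV[R]_n := delta_mx 0 j in
    let vw := cliffT q v *m cliffT q w + ((ip g (pbase q) v w)%:C)%:M in
    complex.Re (herm (act_left vw (star_F q fk fl (phi q))) (phi q)).

End Spinors.

Definition Theta_form (gF : M -> 'M[R]_r) (nablaF : connection M r)
    (p : M) (fk fl : M -> 'rV[R]_r) : 'M[R]_n :=
  \matrix_(i, j) ip gF p (curvature nablaF (del p i) (del p j) fk p) (fl p).

End Structures.
Arguments spin_bundle {R n} M r.
Arguments patlas {R n M r} s.

(* Main.v *)
Require Import Defs.
From HB Require Import structures.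
From mathcomp Require Import all_boot all_order all_algebra.
From mathcomp Require Import all_classical all_reals all_analysis.
From mathcomp Require Import complex ring lra.

Set Implicit Arguments.
Unset Strict Implicit.
Unset Printing Implicit Defensive.

Import Order.TTheory GRing.Theory Num.Theory.
Import numFieldNormedType.Exports.
Local Open Scope classical_set_scope.
Local Open Scope ring_scope.
Local Open Scope complex_scope.

(* In a local orthonormal frame, differentiating the Killing equation twice and
   antisymmetrizing gives
     R^M(X, Y) . phi + kappa_*(R^F(X, Y)) . phi = mu^2 (Y X - X Y) . phi,
   where the derivatives of the coframe cancel because the Levi-Civita
   connection has no torsion. Multiply by Y = e_y and sum over y: the first
   Bianchi identity turns the first term into - Ric(X) . phi / 2. The real part
   of the Hermitian product with e_b . phi is then |phi|^2 Ric up to the pairing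
   of Theta with eta, the symmetric part of e_b e_y being killed by the skewness
   of kappa_*. The function |phi|^2 is locally constant since the Killing
   equation only involves skew endomorphisms, hence nowhere zero as M is
   connected. All terms are independent of the lift q of p because Spin acts
   unitarily and intertwines Clifford multiplications through lambda_n. *)

(** * Partial derivatives in R^n *)

(** Derivatives exist only in charts, and the spin bundle is seen through local sections, so the
    computation takes place where a section of the atlas and a chart [c] are both defined.
    Coordinate fields serve for differentiation because they commute: curvature is then a plain
    commutator of covariant derivatives. The orthonormal frame below the section enters through its
    connection form and its dual coframe. The identity obtained for pairs of coordinate directions
    is contracted at the point with the frame ([in_frame]); the rest is linear algebra in Clifford
    generators. The frame of F in the conclusion is arbitrary, while the computation uses the one
    below the section. At a point they differ by an orthogonal matrix, and the sum over k < l of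
    products of entries of two antisymmetric matrices is half a trace, hence unchanged. Constants:
    the lift so(n) -> spin(n) is 1/4 of a sum over ordered pairs, and the sum over Y of Y(YX - XY)
    is -2(n - 1)X. Clearing the factor 1/2 in front of Ric gives 4(n - 1) mu^2, and coefficient 1
    for the sum over k < l. *)

Section EuclideanCalculus.
Context {R : realType} {n : nat}.
Implicit Types (f g : 'rV[R]_n -> R) (O : set 'rV[R]_n) (x y v h : 'rV[R]_n).

Lemma derivable_line_at f x v (t : R) : derivable f (x + t *: v) v ->
  is_derive t (1 : R) (fun s : R => f (x + s *: v)) ('D_v f (x + t *: v)).
Proof.
move=> fx.
have E : (fun h0 : R => h0^-1 *: (f (x + (h0 *: (1:R) + t) *: v) - f (x + t *: v)))
  = (fun h0 : R => h0^-1 *: (f (h0 *: v + (x + t *: v)) - f (x + t *: v))).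
  by apply/funext => h0; rewrite [_ *: (1 : R)]mulr1 scalerDl addrCA.
split; first by rewrite /derivable /= E.
by rewrite /derive /= E.
Qed.

(** The bound by absolute values makes the sign of t irrelevant to the callers, who move along
    coordinates of arbitrary sign. *)
Lemma line_MVT f x v (t : R) :
  (forall s, `|s| <= `|t| -> derivable f (x + s *: v) v) ->
  exists2 s, `|s| <= `|t| & f (x + t *: v) - f x = t * 'D_v f (x + s *: v).
Proof.
move=> fd.
pose F s := f (x + s *: v).
have dF s : `|s| <= `|t| -> is_derive s (1:R) F ('D_v f (x + s *: v)).
  by move=> st; apply: derivable_line_at; apply: fd.
have cF s : `|s| <= `|t| -> {for s, continuous F}.
  move=> st; apply: differentiable_continuous; apply/derivable1_diffP.
  by have := dF _ st; case.
have F0 : F 0 = f x by rewrite /F scale0r addr0.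
have [t0|t0|t0] := ltgtP t 0.
- have [||c /itvP ct H] := @MVT R F (fun s => 'D_v f (x + s *: v)) t 0 t0.
  + move=> s /itvP st; apply: dF.
    by rewrite (ltr0_norm t0) ler0_norm ?lerN2 ?st// ltW// st.
  + apply: continuous_in_subspaceT => s; rewrite inE /= => /itvP st; apply: cF.
    by rewrite (ltr0_norm t0) ler0_norm ?lerN2 ?st.
  exists c; first by rewrite (ltr0_norm t0) ler0_norm ?lerN2 ?ct// ltW// ct.
  by rewrite -opprB -[f x]F0 -[f (x + _)]/(F t) H sub0r mulrN opprK mulrC.
- have [||c /itvP ct H] := @MVT R F (fun s => 'D_v f (x + s *: v)) 0 t t0.
  + move=> s /itvP st; apply: dF.
    by rewrite (gtr0_norm t0) ger0_norm ?ltW ?st.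
  + apply: continuous_in_subspaceT => s; rewrite inE /= => /itvP st; apply: cF.
    by rewrite (gtr0_norm t0) ger0_norm ?st.
  exists c; first by rewrite (gtr0_norm t0) ger0_norm ?ltW ?ct.
  by rewrite -[f x]F0 -[f (x + _)]/(F t) H subr0 mulrC.
- exists 0; first by rewrite normr0.
  by rewrite t0 scale0r addr0 subrr mul0r.
Qed.

Lemma rV_norm_coord x i : `|x 0 i| <= `|x|.
Proof.
rewrite [leRHS]/Num.Def.normr /= mx_normrE.
exact: (le_bigmax _ (fun k : 'I_1 * 'I_n => `|x k.1 k.2|) (0, i)).
Qed.

Lemma rV_norm_le x (c : R) : 0 <= c -> (forall i, `|x 0 i| <= c) -> `|x| <= c.
Proof.
move=> c0 xc; rewrite [leLHS]/Num.Def.normr /= mx_normrE; apply: bigmax_le => // -[i j] _.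
by rewrite ord1.
Qed.

(** Walk from x to x + h one coordinate at a time and apply the mean value theorem on each leg. In
    the sup norm the intermediate points are no farther from x than x + h is, so the bounds on the
    partial derivatives apply to all of them. *)
Lemma partials_approx f x (d e : R) (a : 'I_n -> R) :
  (forall y, `|y - x| < d -> forall i,
     derivable f y (delta_mx 0 i) /\ `|'D_(delta_mx 0 i) f y - a i| <= e) ->
  forall h, `|h| < d ->
  `|f (x + h) - f x - \sum_i a i * h 0 i| <= e * \sum_i `|h 0 i|.
Proof.
move=> fa h hd.
(* The vertices of the path: h with all coordinates from the k-th on set to 0. *)
pose tr k : 'rV[R]_n := \row_i (if (i < k)%N then h 0 i else 0).
suff H k : (k <= n)%N -> `|f (x + tr k) - f x - \sum_(i < n | (i < k)%N) a i * h 0 i|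
    <= e * \sum_(i < n | (i < k)%N) `|h 0 i|.
  have := H n (leqnn n); rewrite (_ : tr n = h); last first.
    by apply/rowP => i; rewrite mxE ltn_ord.
  have E (G : 'I_n -> R) : \sum_(i < n | (i < n)%N) G i = \sum_i G i.
    by apply: eq_bigl => i; rewrite ltn_ord.
  by rewrite !E.
elim: k => [_|k IH kn].
  rewrite (_ : tr 0%N = 0) ?addr0 ?subrr; last by apply/rowP => i; rewrite !mxE.
  by rewrite !big_pred0 // subrr normr0 mulr0.
pose K := Ordinal kn.
have E (G : 'I_n -> R) :
    \sum_(i < n | (i < k.+1)%N) G i = G K + \sum_(i < n | (i < k)%N) G i.
  rewrite (bigD1 K) //=; congr (_ + _); apply: eq_bigl => i.
  by rewrite ltnS -val_eqE /= ltn_neqAle andbC.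
have trS : tr k.+1 = tr k + h 0 K *: delta_mx 0 K.
  apply/rowP => i; rewrite !mxE eqxx /= -val_eqE /= ltnS.
  have [ik|ik|ik] := ltngtP i k; rewrite ?mulr0 ?addr0 ?mulr1 ?add0r //.
  by congr (h 0 _); apply: val_inj.
have [|s sk Hs] := @line_MVT f (x + tr k) (delta_mx 0 K) (h 0 K).
  move=> s sk; apply: (proj1 (fa _ _ K)); apply: le_lt_trans hd.
  rewrite -(addrA x (tr k)) [x + _]addrC addrK.
  apply: rV_norm_le => // i; rewrite !mxE eqxx /= -val_eqE /=.
  have [ik|ik|ik] := ltngtP i k; rewrite ?mulr0 ?addr0 ?mulr1 ?add0r ?normr0 //.
    exact: rV_norm_coord.
  by apply: le_trans sk _; apply: rV_norm_coord.
rewrite !E trS addrA.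
rewrite (_ : _ - _ - _ = (f (x + tr k + h 0 K *: delta_mx 0 K) - f (x + tr k)
  - a K * h 0 K) + (f (x + tr k) - f x - \sum_(i < n | (i < k)%N) a i * h 0 i));
  last by ring.
apply: le_trans (ler_normD _ _) _; rewrite mulrDr; apply: lerD; last first.
  by apply: IH; apply: ltnW.
rewrite Hs [a K * _]mulrC -mulrBr normrM mulrC ler_wpM2r //.
apply: (proj2 (fa _ _ K)); apply: le_lt_trans hd.
rewrite -(addrA x (tr k)) [x + _]addrC addrK.
apply: rV_norm_le => // i; rewrite !mxE eqxx /= -val_eqE /=.
have [ik|ik|ik] := ltngtP i k; rewrite ?mulr0 ?addr0 ?mulr1 ?add0r ?normr0 //.
  exact: rV_norm_coord.
by apply: le_trans sk _; apply: rV_norm_coord.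
Qed.


Lemma partials_linear_lin (a : 'I_n -> R) : linear (fun h : 'rV[R]_n => \sum_i a i * h 0 i : R).
Proof.
move=> k u v; transitivity (k * (\sum_i a i * u 0 i) + \sum_i a i * v 0 i) => //.
rewrite mulr_sumr -big_split /=; apply: eq_bigr => i _.
by rewrite !mxE mulrDr mulrCA.
Qed.

Lemma differentiable_of_partials f x :
  (\forall y \near x, forall i, derivable f y (delta_mx 0 i)) ->
  (forall i, {for x, continuous (fun y => 'D_(delta_mx 0 i) f y)}) ->
  differentiable f x /\ forall v, 'D_v f x = \sum_i 'D_(delta_mx 0 i) f x * v 0 i.
Proof.
move=> fd fc.
pose a i := 'D_(delta_mx 0 i) f x.
pose M := GRing.isLinear.Build _ _ _ _ _ (partials_linear_lin a).
pose L : {linear 'rV[R]_n -> R} := HB.pack (fun h : 'rV[R]_n => \sum_i a i * h 0 i : R) M.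
have cL : continuous L.
  move=> y; rewrite /L /=.
  rewrite (_ : (fun h : 'rV[R]_n => _) = \sum_i (fun h : 'rV[R]_n => a i * h 0 i : R)); last first.
    by apply/funext => h; rewrite fct_sumE.
  apply: (@differentiable_continuous R 'rV[R]_n R); apply: differentiable_sum => i.
  by apply: (@differentiableZ _ _ _ (fun h : 'rV[R]_n => h 0 i : R)); apply: differentiable_coord.
have E : (f \o shift x : 'rV[R]_n -> R) = cst (f x) + L +o_ (0 : 'rV[R]_n) (@id 'rV[R]_n).
  apply/eqaddoP => _/posnumP[e].
  (* The sum of the coordinates of h is at most n |h|, so e / n would do; adding 1 keeps the
     denominator positive when n = 0. *)
  have e0 : 0 < e%:num / (n%:R + 1) by rewrite divr_gt0 // ltr_wpDl // ler0n.
  have H : \forall y \near x, forall i, derivable f y (delta_mx 0 i) /\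
      `|'D_(delta_mx 0 i) f y - a i| <= e%:num / (n%:R + 1).
    have H1 : \forall y \near x, forall i : 'I_n, `|'D_(delta_mx 0 i) f y - a i| <= e%:num / (n%:R + 1).
      apply: (@filter_forall _ _ (fun i y => `|'D_(delta_mx 0 i) f y - a i| <= e%:num / (n%:R + 1)) (nbhs x) (nbhs_filter x)) => i.
      move/cvgrPdist_le : (fc i) => /(_ _ e0); apply: filterS => y.
      by rewrite distrC.
    by near=> y => i; split; [apply: (near fd y) | apply: (near H1 y)].
  have /nbhs_ballP[d /= d0 Hd] := H.
  have Hd' y : `|y - x| < d -> forall i, derivable f y (delta_mx 0 i) /\
      `|'D_(delta_mx 0 i) f y - a i| <= e%:num / (n%:R + 1).
    by move=> yd; apply: Hd; rewrite -ball_normE /= distrC.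
  apply/nbhs_ballP; exists d => // h; rewrite -ball_normE /= sub0r normrN => hd.
  have := partials_approx Hd' hd.
  rewrite (_ : _ - _ = ((f \o shift x) - (cst (f x) + L)) h); last first.
    transitivity (f (h + x) - (f x + \sum_i a i * h 0 i)) => //.
    by rewrite [h + x]addrC opprD addrA.
  move=> /le_trans; apply.
  rewrite -mulrA ler_wpM2l // mulrC ler_pdivrMr; last by rewrite ltr_wpDl // ler0n.
  apply: (@le_trans _ _ (\sum_(i < n) `|h|)).
    by apply: ler_sum => i _; exact: rV_norm_coord.
  by rewrite sumr_const card_ord mulrDr mulr1 mulr_natr lerDl.
have D := diff_unique cL E.
have df : differentiable f x by apply/diff_locallyP; rewrite D.
split=> // v; rewrite deriveE // D /L /=.
Unshelve. all: by end_near. Qed.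


Lemma is_derive_shift_rV f x (c : 'rV[R]_n) v : derivable f (x + c) v ->
  is_derive x v (fun y => f (y + c)) ('D_v f (x + c)).
Proof.
move=> fx.
have E : (fun h0 : R => h0^-1 *: (f (h0 *: v + x + c) - f (x + c)))
  = (fun h0 : R => h0^-1 *: (f (h0 *: v + (x + c)) - f (x + c))).
  by apply/funext => h0; rewrite addrA.
split; first by rewrite /derivable /= E.
by rewrite /derive /= E.
Qed.

Lemma norm_delta_rV (s : R) (i : 'I_n) : `|s *: delta_mx 0 i : 'rV[R]_n| <= `|s|.
Proof.
apply: rV_norm_le => // j; rewrite !mxE normrM ler_piMr //.
by case: (_ && _); rewrite ?normr1 ?normr0.
Qed.

(** The mean value theorem is used twice: along i for the increment of f in direction j, then along
    j for the i-th partial derivative. The left side is symmetric in i and j, which gives the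
    equality of mixed partial derivatives. *)
Lemma second_difference f x (i j : 'I_n) (t : R) :
  (forall y, `|y - x| <= 2 * `|t| -> derivable f y (delta_mx 0 i) /\
     derivable (fun z => 'D_(delta_mx 0 i) f z) y (delta_mx 0 j)) ->
  exists2 y, `|y - x| <= 2 * `|t| &
    f (x + t *: delta_mx 0 i + t *: delta_mx 0 j) - f (x + t *: delta_mx 0 i)
     - f (x + t *: delta_mx 0 j) + f x =
    t * t * 'D_(delta_mx 0 j) (fun z => 'D_(delta_mx 0 i) f z) y.
Proof.
move=> fd; pose F y := f (y + t *: delta_mx 0 j) - f y.
have two : 2 * `|t| = `|t| + `|t| by rewrite mulrDl mul1r.
have dF s : `|s| <= `|t| -> is_derive (x + s *: delta_mx 0 i) (delta_mx 0 i : 'rV[R]_n) F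
    ('D_(delta_mx 0 i) f (x + s *: delta_mx 0 i + t *: delta_mx 0 j)
     - 'D_(delta_mx 0 i) f (x + s *: delta_mx 0 i)).
  move=> st; apply: is_deriveB; last first.
    apply: derivableP; apply: (proj1 (fd _ _)).
    rewrite addrAC subrr add0r two (le_trans (norm_delta_rV _ _)) //.
    by rewrite (le_trans st) // lerDl.
  apply: is_derive_shift_rV; apply: (proj1 (fd _ _)).
  rewrite -(addrA x) [x + _]addrC addrK two (le_trans (ler_normD _ _)) //.
  by rewrite lerD // (le_trans (norm_delta_rV _ _)).
have [|s st Hs] := @line_MVT F x (delta_mx 0 i) t.
  by move=> s /dF [].
have [|u ut Hu] := @line_MVT (fun z => 'D_(delta_mx 0 i) f z) (x + s *: delta_mx 0 i) (delta_mx 0 j) t.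
  move=> u ut; apply: (proj2 (fd _ _)).
  rewrite -(addrA x) [x + _]addrC addrK two (le_trans (ler_normD _ _)) //.
  by rewrite lerD // (le_trans (norm_delta_rV _ _)).
exists (x + s *: delta_mx 0 i + u *: delta_mx 0 j).
  rewrite -(addrA x) [x + _]addrC addrK two (le_trans (ler_normD _ _)) //.
  by rewrite lerD // (le_trans (norm_delta_rV _ _)).
have [_ E] := dF s st; move: Hs; rewrite E Hu mulrA => <-.
by rewrite /F; ring.
Qed.

Lemma continuous_eq_approx (p q : 'rV[R]_n -> R) x :
  {for x, continuous p} -> {for x, continuous q} ->
  (forall d, 0 < d -> exists y z, [/\ `|y - x| < d, `|z - x| < d & p y = q z]) ->
  p x = q x.
Proof.
move=> cp cq H; apply/eqP; rewrite -subr_eq0 -normr_le0; apply/ler_addgt0Pr => e e0.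
rewrite add0r; have e2 : 0 < e / 2 by rewrite divr_gt0.
move/cvgrPdist_le : cp => /(_ _ e2) /nbhs_ballP[d1 /= d10 H1].
move/cvgrPdist_le : cq => /(_ _ e2) /nbhs_ballP[d2 /= d20 H2].
have [|y [z [yd zd E]]] := H (Num.min d1 d2); first by rewrite lt_min d10.
have A : `|p x - p y| <= e / 2.
  by apply: H1; rewrite -ball_normE /= distrC (lt_le_trans yd) // ge_min lexx.
have B : `|q x - q z| <= e / 2.
  by apply: H2; rewrite -ball_normE /= distrC (lt_le_trans zd) // ge_min lexx orbT.
rewrite (splitr e) (le_trans (ler_distD (p y) _ _) (lerD A _)) //.
by rewrite E distrC.
Qed.

Lemma mixed_partials f O x (i j : 'I_n) : open O -> O x ->
  (forall y, O y -> derivable f y (delta_mx 0 i) /\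
     derivable (fun z => 'D_(delta_mx 0 i) f z) y (delta_mx 0 j)) ->
  (forall y, O y -> derivable f y (delta_mx 0 j) /\
     derivable (fun z => 'D_(delta_mx 0 j) f z) y (delta_mx 0 i)) ->
  {for x, continuous (fun y => 'D_(delta_mx 0 j) (fun z => 'D_(delta_mx 0 i) f z) y)} ->
  {for x, continuous (fun y => 'D_(delta_mx 0 i) (fun z => 'D_(delta_mx 0 j) f z) y)} ->
  'D_(delta_mx 0 j) (fun z => 'D_(delta_mx 0 i) f z) x =
  'D_(delta_mx 0 i) (fun z => 'D_(delta_mx 0 j) f z) x.
Proof.
move=> oO Ox fi fj ci cj; apply: (continuous_eq_approx ci cj) => e e0.
have HO : \forall y \near x, O y by exact: open_nbhs_nbhs.
have /nbhs_ballP[d' /= d'0 Hd'] := HO.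
pose d := Num.min d' e; have d0 : 0 < d by rewrite lt_min d'0.
(* The second difference of step t involves points up to distance 2t; the step d / 3 keeps them in
   the ball of radius d. *)
have d2 : 2 * `|d / 3| < d.
  rewrite ger0_norm ?divr_ge0 ?ltW //.
  by rewrite mulrA ltr_pdivrMr // mulrC ltr_pM2l // ltr_nat.
have Hd y : `|y - x| <= 2 * `|d / 3| -> O y.
  move=> yd; apply: Hd'; rewrite -ball_normE /= distrC (le_lt_trans yd) //.
  by rewrite (lt_le_trans d2) // ge_min lexx.
have [y yd Hy] := @second_difference f x i j (d / 3) (fun y yd => fi y (Hd y yd)).
have [z zd Hz] := @second_difference f x j i (d / 3) (fun y yd => fj y (Hd y yd)).
have de : d <= e by rewrite ge_min lexx orbT.
exists y, z; split.
- by rewrite (le_lt_trans yd) // (lt_le_trans d2).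
- by rewrite (le_lt_trans zd) // (lt_le_trans d2).
apply: (@mulfI _ (d / 3 * (d / 3))); first by rewrite mulf_neq0 // lt0r_neq0 // divr_gt0.
apply: etrans (esym Hy) (etrans _ Hz).
move: (_ *: _) (_ *: _) => u w.
by rewrite (addrAC x u w) [X in X + f x = _]addrAC.
Qed.

End EuclideanCalculus.

(** * Functions of class C^k on an open set *)

Section SmoothFunctions.
Context {R : realType} {n : nat}.
Implicit Types (f g : 'rV[R]_n -> R) (O : set 'rV[R]_n).

Lemma near_open_eq {T : topologicalType} {U} (p q : T -> U) (O : set T) x :
  open O -> O x -> (forall y, O y -> p y = q y) -> \forall y \near x, p y = q y.
Proof. by move=> oO Ox pq; apply: filterS (open_nbhs_nbhs (conj oO Ox)) => y /pq. Qed.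

Lemma Ck_continuous k f O x : Ck k f O -> O x -> {for x, continuous f}.
Proof. by case: k => [|k] [c _]; apply: c. Qed.

Lemma Ck_derivable k f O x i : Ck k.+1 f O -> O x -> derivable f x (delta_mx 0 i).
Proof. by move=> [_ /(_ i) [d _]]; apply: d. Qed.

Lemma Ck_partial k f O i : Ck k.+1 f O -> Ck k (fun x => 'D_(delta_mx 0 i) f x) O.
Proof. by move=> [_ /(_ i) []]. Qed.

Lemma CkW k f O : Ck k.+1 f O -> Ck k f O.
Proof.
elim: k f => [|k IH] f [c d]; split=> // i.
by have [di ki] := d i; split=> //; apply: IH.
Qed.

Lemma Ck_sub k f O O' : O' `<=` O -> Ck k f O -> Ck k f O'.
Proof.
move=> OO; elim: k f => [|k IH] f [c d]; first by split=> // x /OO; apply: c.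
split=> [x /OO|i]; first exact: c.
by have [di ki] := d i; split=> [x /OO|]; [apply: di|apply: IH].
Qed.

Lemma near_eq_continuous f g x : (\forall y \near x, f y = g y) ->
  {for x, continuous f} -> {for x, continuous g}.
Proof.
move=> E; rewrite /prop_for /continuous_at -(nbhs_singleton E) => c.
exact: (cvg_trans (@near_eq_cvg _ _ (nbhs x) (nbhs_filter x) f g E) c).
Qed.

Lemma Ck_congr k f g O : open O -> (forall x, O x -> f x = g x) ->
  Ck k f O -> Ck k g O.
Proof.
move=> oO; elim: k f g => [|k IH] f g fg [c d].
  by split=> // x Ox; apply: near_eq_continuous (near_open_eq oO Ox fg) (c x Ox).
split=> [x Ox|i].
  exact: near_eq_continuous (near_open_eq oO Ox fg) (c x Ox).
have [di ki] := d i; split=> [x Ox|].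
  by apply: near_eq_derivable (di x Ox); apply: near_open_eq Ox fg.
apply: IH ki => x Ox; apply: near_eq_derive; exact: near_open_eq Ox fg.
Qed.

Lemma Ck_cst k (a : R) O : Ck k (fun=> a) O.
Proof.
elim: k a => [|k IH] a; first by split=> // x _; apply: cst_continuous.
split=> [x _|i]; first exact: cst_continuous.
split=> [x _|]; first exact: derivable_cst.
rewrite (_ : 'D_(delta_mx 0 i) (fun=> a) = fun=> 0) //.
by apply/funext => x; apply: derive_cst.
Qed.

Lemma Ck_add k f g O : open O -> Ck k f O -> Ck k g O -> Ck k (fun x => f x + g x) O.
Proof.
move=> oO; elim: k f g => [|k IH] f g [cf df] [cg dg].
  by split=> // x Ox; exact: continuousD (cf x Ox) (cg x Ox).
split=> [x Ox|i]; first by exact: continuousD (cf x Ox) (cg x Ox).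
have [dfi kfi] := df i; have [dgi kgi] := dg i; split=> [x Ox|].
  by apply: derivableD; [apply: dfi|apply: dgi].
apply: Ck_congr (IH _ _ kfi kgi) => // x Ox.
by rewrite (@deriveD _ _ _ f g) //; [apply: dfi|apply: dgi].
Qed.

Lemma Ck_mul k f g O : open O -> Ck k f O -> Ck k g O -> Ck k (fun x => f x * g x) O.
Proof.
move=> oO; elim: k f g => [|k IH] f g kf kg.
  move: kf kg => [cf _] [cg _].
  by split=> // x Ox; exact: continuousM (cf x Ox) (cg x Ox).
have kf' := CkW kf; have kg' := CkW kg; move: kf kg => [cf df] [cg dg].
split=> [x Ox|i]; first by exact: continuousM (cf x Ox) (cg x Ox).
have [dfi kfi] := df i; have [dgi kgi] := dg i; split=> [x Ox|].
  by apply: derivableM; [apply: dfi|apply: dgi].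
apply: Ck_congr (Ck_add oO (IH _ _ kf' kgi) (IH _ _ kg' kfi)) => // x Ox.
by rewrite (@deriveM _ _ f g) //; [apply: dfi|apply: dgi].
Qed.

Lemma Ck_sum (I : Type) (s : seq I) (P : pred I) k (F : I -> 'rV[R]_n -> R) O : open O ->
  (forall i, P i -> Ck k (F i) O) -> Ck k (fun x => \sum_(i <- s | P i) F i x) O.
Proof.
move=> oO kF; elim: s => [|i s IH].
  by apply: Ck_congr (Ck_cst k 0 O) => // x _; rewrite big_nil.
case Pi: (P i).
  by apply: Ck_congr (Ck_add oO (kF i Pi) IH) => // x _; rewrite big_cons Pi.
by apply: Ck_congr IH => // x _; rewrite big_cons Pi.
Qed.

Lemma Ck1_differentiable f O x : open O -> O x -> Ck 1 f O ->
  differentiable f x /\ forall v, 'D_v f x = \sum_i 'D_(delta_mx 0 i) f x * v 0 i.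
Proof.
move=> oO Ox [_ d]; apply: differentiable_of_partials => [|i].
  by apply: filterS (open_nbhs_nbhs (conj oO Ox)) => y Oy i; apply: (proj1 (d i)).
exact: (proj1 (proj2 (d i)) x Ox).
Qed.

Lemma Ck2_mixed f O x i j : open O -> O x -> Ck 2 f O ->
  'D_(delta_mx 0 j) (fun z => 'D_(delta_mx 0 i) f z) x =
  'D_(delta_mx 0 i) (fun z => 'D_(delta_mx 0 j) f z) x.
Proof.
move=> oO Ox kf; apply: (mixed_partials oO Ox) => [y Oy|y Oy||].
- by split; [apply: Ck_derivable kf Oy|apply: Ck_derivable (Ck_partial _ kf) Oy].
- by split; [apply: Ck_derivable kf Oy|apply: Ck_derivable (Ck_partial _ kf) Oy].
- exact: Ck_continuous (Ck_partial _ (Ck_partial _ kf)) Ox.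
- exact: Ck_continuous (Ck_partial _ (Ck_partial _ kf)) Ox.
Qed.

End SmoothFunctions.

(** * Chain rule and locally constant functions *)

Section Composition.
Context {R : realType}.

Lemma differentiable_rV m n (h : 'rV[R]_m -> 'rV[R]_n) x :
  (forall j, differentiable (fun y => h y 0 j) x) -> differentiable h x.
Proof.
move=> dh; rewrite (_ : h = \sum_j (fun y => h y 0 j *: delta_mx 0 j)); last first.
  by apply/funext => y; rewrite fct_sumE; apply: row_sum_delta.
by apply: differentiable_sum => j; apply: differentiableZl.
Qed.

Lemma derive_rV_coord m n (h : 'rV[R]_m -> 'rV[R]_n) x v j : differentiable h x ->
  ('D_v h x) 0 j = 'D_v (fun y => h y 0 j) x.
Proof. by move=> dh; rewrite derive_mx ?mxE //; apply: diff_derivable. Qed.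

Lemma derive_comp_rV m n (h : 'rV[R]_m -> 'rV[R]_n) (f : 'rV[R]_n -> R) x v :
  differentiable h x -> differentiable f (h x) ->
  'D_v (fun y => f (h y)) x = 'D_('D_v h x) f (h x).
Proof.
move=> dh df; rewrite deriveE; last exact: (@differentiable_comp _ _ _ _ h f).
by rewrite (@diff_comp _ _ _ _ h f) //= -deriveE // -deriveE.
Qed.

(** One more order is required of h than of f, so that h is differentiable, hence continuous,
    already for k = 0. The induction uses the chain rule: each term is a partial derivative of f
    composed with h, times a partial derivative of h. *)
Lemma Ck_comp m n k (h : 'rV[R]_m -> 'rV[R]_n) (f : 'rV[R]_n -> R) O O' :
  open O -> open O' -> (forall x, O' x -> O (h x)) ->
  (forall j, Ck k.+1 (fun y => h y 0 j) O') -> Ck k f O -> Ck k (fun y => f (h y)) O'.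
Proof.
move=> oO oO' hO; elim: k f => [|k IH] f kh kf.
  have dh x : O' x -> differentiable h x.
    by move=> Ox; apply: differentiable_rV => j; apply: (proj1 (Ck1_differentiable oO' Ox (kh j))).
  split=> // x Ox; apply: continuous_comp; first exact: differentiable_continuous (dh x Ox).
  by apply: (Ck_continuous kf); apply: hO.
have kh' j : Ck k.+1 (fun y => h y 0 j) O' by apply: CkW.
have kh1 j : Ck 1 (fun y => h y 0 j) O'.
  by elim: (k) (kh' j) => // l IHl /CkW.
have kf1 : Ck 1 f O by elim: (k) kf => // l IHl /CkW.
have dh x : O' x -> differentiable h x.
  by move=> Ox; apply: differentiable_rV => j; apply: (proj1 (Ck1_differentiable oO' Ox (kh1 j))).
have df x : O x -> differentiable f x.
  by move=> Ox; apply: (proj1 (Ck1_differentiable oO Ox kf1)).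
have dfh x : O' x -> differentiable (fun y => f (h y)) x.
  by move=> Ox; apply: (@differentiable_comp _ _ _ _ h f); [apply: dh|apply: df; apply: hO].
split=> [x Ox|i]; first exact: differentiable_continuous (dfh x Ox).
split=> [x Ox|]; first exact: diff_derivable (dfh x Ox).
apply: (@Ck_congr _ _ _ (fun x => \sum_j 'D_(delta_mx 0 j) f (h x)
   * 'D_(delta_mx 0 i) (fun y => h y 0 j) x)) => //.
  move=> x Ox; rewrite derive_comp_rV; [|exact: dh|by apply: df; apply: hO].
  rewrite (proj2 (Ck1_differentiable oO (hO x Ox) kf1)).
  by apply: eq_bigr => j _; rewrite derive_rV_coord //; apply: dh.
apply: Ck_sum => // j _; apply: Ck_mul => //; last exact: CkW (Ck_partial _ (kh j)).
by apply: (IH (fun z => 'D_(delta_mx 0 j) f z)) => //; apply: Ck_partial.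
Qed.

Lemma partials0_near_cst n (f : 'rV[R]_n -> R) (O : set 'rV[R]_n) x : open O -> O x ->
  (forall y, O y -> forall i, derivable f y (delta_mx 0 i) /\ 'D_(delta_mx 0 i) f y = 0) ->
  \forall y \near x, f y = f x.
Proof.
move=> oO Ox H; have HO : \forall y \near x, O y by exact: open_nbhs_nbhs.
have /nbhs_ballP[d /= d0 Hd] := HO.
apply/nbhs_ballP; exists d => // y; rewrite -ball_normE /= => yd.
(* With all a_i = 0 and error bound 0, the estimate says exactly that f(y) = f(x). *)
have := @partials_approx _ _ f x d 0 (fun=> 0) _ (y - x); rewrite distrC in yd.
rewrite [x + _]addrC subrK mul0r (big1 _ _ (fun i => 0 * _)) ?subr0; last by move=> i _; rewrite mul0r.
move=> P; apply/eqP; rewrite -subr_eq0 -normr_le0; apply: P => // z zd i.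
 have [|dz Dz] := H z _ i.
  by apply: Hd; rewrite -ball_normE /= distrC.
by rewrite Dz subr0 normr0.
Qed.

End Composition.

(** * Charts, connections and curvature in a frame *)

(* Locked: unifying two unequal partial derivatives would unfold the limits
   which define them. *)
Fact pd_key : unit. Proof. by []. Qed.

Section Charts.
Context {R : realType} {n : nat} {M : manifold R n}.
Implicit Types (c d e : chart M) (U V : set M) (f g : M -> R) (v : 'rV[R]_n) (q : M).

Definition chart_img c U : set 'rV[R]_n := cmap c @` (U `&` cdom c).

Lemma chart_imgP c U x : chart_img c U x ->
  [/\ U (cinv c x), cdom c (cinv c x) & cmap c (cinv c x) = x].
Proof. by move=> [q [Uq cq] <-]; rewrite cmapK. Qed.

Lemma chart_img_cmap c U q : U q -> cdom c q -> chart_img c U (cmap c q).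
Proof. by move=> Uq cq; exists q. Qed.

Lemma open_chart_img c U : open U -> open (chart_img c U).
Proof.
move=> oU; rewrite openE => x xU; have [Ux cx Ex] := chart_imgP xU.
have ix : (cmap c @` cdom c) x by exists (cinv c x).
have C := cinv_cont ix.
have N1 : nbhs (cinv c x) (U `&` cdom c).
  by apply: open_nbhs_nbhs; split=> //; apply: openI => //; apply: cdom_open.
have N2 : nbhs x (cmap c @` cdom c).
  by apply: open_nbhs_nbhs; split=> //; apply: cimg_open.
have N3 : nbhs x (cinv c @^-1` (U `&` cdom c)) by apply: C.
apply: (@filterS _ _ (nbhs_filter x) _ _ _ (@filterI _ _ (nbhs_filter x) _ _ N2 N3)).
move=> y [[p cp <-]] /=; rewrite /preimage /= cmapK // => H.
by exists p.
Qed.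

Arguments open_chart_img c {U}.

Lemma near_chart_img c U q (P : set 'rV[R]_n) : open U -> U q -> cdom c q ->
  (forall x, chart_img c U x -> P x) -> \forall x \near cmap c q, P x.
Proof.
move=> oU Uq cq; have N : nbhs (cmap c q) (chart_img c U).
  by apply: open_nbhs_nbhs; split; [apply: open_chart_img | apply: chart_img_cmap].
by move=> H; apply: filterS N.
Qed.

Lemma smooth_on_sub U V f : V `<=` U -> smooth_on U f -> smooth_on V f.
Proof.
move=> VU sf c k; apply: Ck_sub (sf c k) => _ [p [/VU Up cp] <-].
by exists p.
Qed.

Lemma smooth_on_congr U f g : open U -> (forall q, U q -> f q = g q) ->
  smooth_on U f -> smooth_on U g.
Proof.
move=> oU fg sf c k; apply: Ck_congr (sf c k); first exact: open_chart_img.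
by move=> x /chart_imgP[Ux _ _]; apply: fg.
Qed.

Lemma smooth_on_cst U (a : R) : smooth_on U (fun=> a).
Proof. by move=> c k; apply: Ck_cst. Qed.

Lemma smooth_on_add U f g : open U -> smooth_on U f -> smooth_on U g ->
  smooth_on U (fun q => f q + g q).
Proof. by move=> oU sf sg c k; apply: (Ck_add _ (sf c k) (sg c k)); apply: open_chart_img. Qed.

Lemma smooth_on_mul U f g : open U -> smooth_on U f -> smooth_on U g ->
  smooth_on U (fun q => f q * g q).
Proof. by move=> oU sf sg c k; apply: (Ck_mul _ (sf c k) (sg c k)); apply: open_chart_img. Qed.

Lemma smooth_on_sum (I : Type) (s : seq I) (P : pred I) U (F : I -> M -> R) : open U ->
  (forall i, P i -> smooth_on U (F i)) -> smooth_on U (fun q => \sum_(i <- s | P i) F i q).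
Proof.
move=> oU sF c k; apply: (@Ck_sum _ _ _ _ _ _ (fun i x => F i (cinv c x))).
  exact: open_chart_img.
by move=> i Pi; apply: (sF i Pi c k).
Qed.

(** Smoothness in one chart passes to every other one by composition with the smooth transition
    map. *)
Lemma smooth_on_chart c U f : open U -> U `<=` cdom c ->
  Cinfty (fun x => f (cinv c x)) (chart_img c U) -> smooth_on U f.
Proof.
move=> oU Uc sf e k.
apply: (@Ck_congr _ _ _ (fun x => f (cinv c (cmap c (cinv e x))))).
- exact: open_chart_img.
- by move=> x /chart_imgP[Ux _ _]; rewrite cmapK //; apply: Uc.
apply: (@Ck_comp _ _ _ _ (fun x => cmap c (cinv e x)) (fun x => f (cinv c x)) (chart_img c U)).
- exact: open_chart_img.
- exact: open_chart_img.
- by move=> x /chart_imgP[Ux _ _]; apply: chart_img_cmap => //; apply: Uc.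
- move=> j; apply: Ck_sub (c_smooth e c j k.+1) => _ [q [Uq eq] <-].
  by exists q => //; split=> //; apply: Uc.
- exact: sf.
Qed.

Definition pd := locked_with pd_key
  (fun c v f q => 'D_v (fun x => f (cinv c x)) (cmap c q) : R).

Lemma pdE c v f q : pd c v f q = 'D_v (fun x => f (cinv c x)) (cmap c q).
Proof. by rewrite /pd unlock. Qed.

Lemma dderivE q v f : dderiv q v f = pd (chart_at q) v f q.
Proof. by rewrite pdE. Qed.

Lemma pd_congr c v f g q U : open U -> U q -> cdom c q ->
  (forall q', U q' -> cdom c q' -> f q' = g q') -> pd c v f q = pd c v g q.
Proof.
move=> oU Uq cq fg; rewrite !pdE; apply: near_eq_derive.
apply: (near_chart_img oU Uq cq) => x.
by move=> /chart_imgP[Ux cx _]; apply: fg.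
Qed.

Section AtPoint.
Context (c : chart M) (U : set M) (q : M) (oU : open U) (Uq : U q) (cq : cdom c q).

Lemma smooth_on_differentiable f : smooth_on U f ->
  differentiable (fun x => f (cinv c x)) (cmap c q) /\
  forall v, pd c v f q = \sum_i pd c (delta_mx 0 i) f q * v 0 i.
Proof.
move=> sf.
have [df E] := Ck1_differentiable (open_chart_img c oU) (chart_img_cmap Uq cq) (sf c 1%N).
by split=> // v; rewrite pdE E; apply: eq_bigr => i _; rewrite pdE.
Qed.

Lemma pd_add v f g : smooth_on U f -> smooth_on U g ->
  pd c v (fun p => f p + g p) q = pd c v f q + pd c v g q.
Proof.
move=> /smooth_on_differentiable[sf _] /smooth_on_differentiable[sg _].
by rewrite !pdE -deriveD //; apply: diff_derivable.
Qed.

Lemma pd_mul v f g : smooth_on U f -> smooth_on U g ->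
  pd c v (fun p => f p * g p) q = pd c v f q * g q + f q * pd c v g q.
Proof.
move=> /smooth_on_differentiable[sf _] /smooth_on_differentiable[sg _].
rewrite !pdE (@deriveM _ _ (fun x => f (cinv c x)) (fun x => g (cinv c x)));
  try exact: diff_derivable.
by rewrite cmapK // addrC [X in X + _]mulrC.
Qed.

Lemma pd_cst v (a : R) : pd c v (fun=> a) q = 0.
Proof. by rewrite pdE; exact: derive_cst. Qed.

Lemma pd_sum (I : Type) (s : seq I) (P : pred I) v (F : I -> M -> R) :
  (forall i, P i -> smooth_on U (F i)) ->
  pd c v (fun p => \sum_(i <- s | P i) F i p) q = \sum_(i <- s | P i) pd c v (F i) q.
Proof.
move=> sF; elim: s => [|i s IH].
  by rewrite big_nil -[RHS](pd_cst v 0); congr pd; apply/funext => p; rewrite big_nil.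
rewrite big_cons; case Pi: (P i).
  rewrite -IH -pd_add //; [|exact: sF|exact: smooth_on_sum].
  by congr pd; apply/funext => p; rewrite big_cons Pi.
by rewrite -IH; congr pd; apply/funext => p; rewrite big_cons Pi.
Qed.

Lemma pd_comm f i j : smooth_on U f ->
  pd c (delta_mx 0 i) (pd c (delta_mx 0 j) f) q =
  pd c (delta_mx 0 j) (pd c (delta_mx 0 i) f) q.
Proof.
move=> sf.
have E k l : pd c (delta_mx 0 k) (pd c (delta_mx 0 l) f) q =
    'D_(delta_mx 0 k) (fun y => 'D_(delta_mx 0 l) (fun x => f (cinv c x)) y) (cmap c q).
  rewrite pdE; apply: near_eq_derive.
  apply: (near_chart_img oU Uq cq) => x.
  by move=> /chart_imgP[Ux cx E]; rewrite pdE E.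
rewrite !E; apply: (Ck2_mixed _ _ (open_chart_img c oU)) (sf c 2).
exact: chart_img_cmap.
Qed.

End AtPoint.

Lemma smooth_on_pd c U f i : open U -> U `<=` cdom c -> smooth_on U f ->
  smooth_on U (pd c (delta_mx 0 i) f).
Proof.
move=> oU Uc sf; apply: (@smooth_on_chart c) => // k.
apply: Ck_congr (Ck_partial i (sf c k.+1)); first exact: open_chart_img.
by move=> x /chart_imgP[_ _ E]; rewrite pdE E.
Qed.

Lemma smooth_on_cmap c i : smooth_on (cdom c) (fun q => cmap c q 0 i).
Proof.
move=> d k; apply: Ck_sub (c_smooth d c i k) => _ [q [cq dq] <-].
by exists q.
Qed.

Lemma pd_cmap c v q i : cdom c q -> pd c v (fun p => cmap c p 0 i) q = v 0 i.
Proof.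
move=> cq; rewrite pdE (@near_eq_derive _ _ _ _ (fun x : 'rV[R]_n => x 0 i)).
  by rewrite -(@derive_rV_coord _ _ _ id) // derive_id.
apply: (near_chart_img openT I cq) => // x.
by move=> /chart_imgP[_ _ ->].
Qed.

(** The coordinates in the chart d of the tangent vector at q whose coordinates in c are v. *)
Definition transfer c d v q : 'rV[R]_n := \row_i pd c v (fun p => cmap d p 0 i) q.

(** Near q the function read in c is the function read in d composed with the transition map; this
    is the chain rule for that composition. *)
Lemma pd_transfer c d v f q U : open U -> U q -> cdom c q -> cdom d q ->
  smooth_on U f -> pd d (transfer c d v q) f q = pd c v f q.
Proof.
move=> oU Uq cq dq sf; rewrite [RHS]pdE.
rewrite (@near_eq_derive _ _ _ _ (fun x => f (cinv d (cmap d (cinv c x))))); last first.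
  apply: (near_chart_img (@cdom_open _ _ _ d) dq cq) => x.
  by move=> /chart_imgP[dx _ _]; rewrite cmapK.
have dh j : differentiable (fun x => cmap d (cinv c x) 0 j) (cmap c q).
  exact: (proj1 (smooth_on_differentiable (@cdom_open _ _ _ d) dq cq (smooth_on_cmap d j))).
have dh' : differentiable (fun x => cmap d (cinv c x)) (cmap c q) by exact: differentiable_rV.
rewrite (@derive_comp_rV _ _ _ (fun x => cmap d (cinv c x)) (fun x => f (cinv d x))) //.
  rewrite pdE cmapK //; congr ('D_ _ _ _).
  by apply/rowP => j; rewrite derive_rV_coord // mxE pdE.
by rewrite cmapK //; exact: (proj1 (smooth_on_differentiable oU Uq dq sf)).
Qed.

Lemma transfer_id c v q : cdom c q -> transfer c c v q = v.
Proof. by move=> cq; apply/rowP => i; rewrite mxE pd_cmap. Qed.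

Lemma transfer_trans c d e v q : cdom c q -> cdom d q -> cdom e q ->
  transfer d e (transfer c d v q) q = transfer c e v q.
Proof.
move=> cq dq eq; apply/rowP => i; rewrite !mxE.
exact: (pd_transfer v (@cdom_open _ _ _ e) eq cq dq (smooth_on_cmap e i)).
Qed.

Definition jac c d q : 'M[R]_n := \matrix_i transfer c d (delta_mx 0 i) q.

Lemma transfer_jac c d v q : cdom c q -> cdom d q -> transfer c d v q = v *m jac c d q.
Proof.
move=> cq dq; apply/rowP => j; rewrite !mxE.
rewrite (proj2 (smooth_on_differentiable (@cdom_open _ _ _ d) dq cq (smooth_on_cmap d j))).
by apply: eq_bigr => i _; rewrite !mxE mulrC.
Qed.

Lemma mul_jac c d e q : cdom c q -> cdom d q -> cdom e q -> jac c d q *m jac d e q = jac c e q.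
Proof.
move=> cq dq eq; apply/row_matrixP => i.
by rewrite row_mul !rowK -transfer_jac // transfer_trans.
Qed.

Lemma jac_id c q : cdom c q -> jac c c q = 1%:M.
Proof. by move=> cq; apply/row_matrixP => i; rewrite rowK transfer_id // row1. Qed.

Lemma coord_fieldE c v q : coord_field c v q = transfer c (chart_at q) v q.
Proof. by apply/rowP => i; rewrite !mxE pdE. Qed.

Lemma coord_frame_jac c q : coord_frame c q = jac c (chart_at q) q.
Proof. by apply/row_matrixP => i; rewrite !rowK coord_fieldE. Qed.

Lemma coord_frame_unit c q : cdom c q -> coord_frame c q \in unitmx.
Proof.
move=> cq; have := mul_jac cq (chart_atP q) cq.
by rewrite jac_id // coord_frame_jac => /mulmx1_unit[].
Qed.

Lemma invmx_coord_frame c q : cdom c q -> invmx (coord_frame c q) = jac (chart_at q) c q.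
Proof.
move=> cq; have U := coord_frame_unit cq.
by rewrite -[LHS]mulmx1 -(jac_id cq) -(mul_jac cq (chart_atP q) cq) -coord_frame_jac mulKmx.
Qed.

Lemma coord_field_at c v q : cdom c q -> coord_field c v q = v *m coord_frame c q.
Proof.
by move=> cq; rewrite coord_fieldE coord_frame_jac -transfer_jac //; apply: chart_atP.
Qed.

Lemma del_at (p : M) i : del p i p = delta_mx 0 i.
Proof. by rewrite /del coord_fieldE transfer_id //; apply: chart_atP. Qed.

(** In the frame of a chart d, the components of a coordinate field of c are partial derivatives in
    c of the coordinates of d. *)
Lemma smooth_coord_field c i U : U `<=` cdom c ->
  smooth_section (TM M) U (coord_field c (delta_mx 0 i)).
Proof.
move=> Uc _ j [d ->] /=.
apply: (@smooth_on_sub (cdom c `&` cdom d)); first by move=> q [/Uc].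
apply: (@smooth_on_congr _ (pd c (delta_mx 0 i) (fun p => cmap d p 0 j))).
- by apply: openI; apply: cdom_open.
- move=> q [cq dq]; rewrite invmx_coord_frame // coord_field_at // -mulmxA.
  rewrite coord_frame_jac mul_jac //; last exact: chart_atP.
  by rewrite -transfer_jac // mxE.
apply: smooth_on_pd.
- by apply: openI; apply: cdom_open.
- by move=> q [].
- by apply: smooth_on_sub (smooth_on_cmap d j) => q [].
Qed.

(** [dderiv] differentiates in [chart_at q], a chart that changes with q without any regularity.
    Passing to a partial derivative in the fixed chart c makes it possible to differentiate
    again. *)
Lemma dderiv_coord_field c i f q U : open U -> U q -> cdom c q -> smooth_on U f ->
  dderiv q (coord_field c (delta_mx 0 i) q) f = pd c (delta_mx 0 i) f q.
Proof.
move=> oU Uq cq sf; rewrite dderivE coord_fieldE.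
exact: (pd_transfer _ oU Uq cq (chart_atP q) sf).
Qed.

(** On the coordinate functions of [chart_at q], both iterated derivatives become partial
    derivatives in the single chart c, and these commute. *)
Lemma bracket_coord_field c i j q : cdom c q ->
  bracket (coord_field c (delta_mx 0 i)) (coord_field c (delta_mx 0 j)) q = 0.
Proof.
move=> cq; apply/rowP => k; rewrite !mxE.
pose d := chart_at q; pose f p := cmap d p 0 k; pose U := cdom c `&` cdom d.
have oU : open U by apply: openI; apply: cdom_open.
have Uq : U q by split=> //; apply: chart_atP.
have sf : smooth_on U f by apply: smooth_on_sub (smooth_on_cmap d k) => p [].
have H i1 i2 : dderiv q (coord_field c (delta_mx 0 i1) q)
    (fun p => dderiv p (coord_field c (delta_mx 0 i2) p) f) =
    pd c (delta_mx 0 i1) (pd c (delta_mx 0 i2) f) q.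
  have sf2 : smooth_on U (pd c (delta_mx 0 i2) f) by apply: smooth_on_pd => // p [].
  apply: etrans (dderiv_coord_field i1 oU Uq cq sf2).
  rewrite !dderivE; apply: (@pd_congr (chart_at q) _ _ _ q U oU Uq (chart_atP q)) => p Up _.
  exact: (dderiv_coord_field i2 oU Up (proj1 Up) sf).
rewrite -[LHS]/(dderiv q (coord_field c (delta_mx 0 i) q)
    (fun p => dderiv p (coord_field c (delta_mx 0 j) p) f) -
  dderiv q (coord_field c (delta_mx 0 j) q)
    (fun p => dderiv p (coord_field c (delta_mx 0 i) p) f)).
by rewrite !H (pd_comm oU Uq cq i j sf) subrr.
Qed.

Lemma pd0_near_cst c f q U : open U -> U q -> cdom c q -> smooth_on U f ->
  (forall p, U p -> cdom c p -> forall i, pd c (delta_mx 0 i) f p = 0) ->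
  \forall p \near q, f p = f q.
Proof.
move=> oU Uq cq sf H.
have oI := open_chart_img c oU.
have N := partials0_near_cst oI (chart_img_cmap Uq cq) (f := fun x => f (cinv c x)) _.
have {}N : \forall y \near cmap c q, f (cinv c y) = f q.
  rewrite cmapK // in N; apply: N => y yI i.
  have [Uy cy Ey] := chart_imgP yI.
  split; first exact: (proj1 (proj2 (sf c 1%N) i) y yI).
  by have := H _ Uy cy i; rewrite pdE Ey.
have C := cmap_cont cq.
have N2 : \forall p \near q, f (cinv c (cmap c p)) = f q by apply: C N.
have N3 : nbhs q (cdom c) by apply: open_nbhs_nbhs; split=> //; apply: cdom_open.
by apply: filterS (filterI N2 N3) => p [E cp]; rewrite -E cmapK.
Qed.

End Charts.

Lemma trmx_commutator_antisym (A : comPzRingType) d (X Y : 'M[A]_d) : X^T = - X -> Y^T = - Y ->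
  (X *m Y - Y *m X)^T = - (X *m Y - Y *m X).
Proof.
move=> tX tY; rewrite raddfB /= !trmx_mul tX tY.
by rewrite !mulNmx !mulmxN !opprK opprB.
Qed.

(** * Smooth sections of a vector bundle *)

Section Sections.
Context {R : realType} {n : nat} {M : manifold R n} {d : nat} {E : vbundle M d}.
Implicit Types (U V : set M) (s t : M -> 'rV[R]_d) (f : M -> R).
Context (oE : forall Vb, E Vb -> open Vb.1).

Lemma smooth_section_sub U V s : V `<=` U -> smooth_section E U s -> smooth_section E V s.
Proof.
move=> VU ss Vb j EVb; apply: smooth_on_sub (ss Vb j EVb) => q [Vq Vbq].
by split=> //; apply: VU.
Qed.

Lemma smooth_section_congr U s t : open U -> (forall q, U q -> s q = t q) ->
  smooth_section E U s -> smooth_section E U t.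
Proof.
move=> oU st ss Vb j EVb; apply: smooth_on_congr (ss Vb j EVb).
  by apply: openI => //; apply: oE.
by move=> q [Uq _]; rewrite st.
Qed.

Lemma smooth_section_add U s t : open U -> smooth_section E U s -> smooth_section E U t ->
  smooth_section E U (fun q => s q + t q).
Proof.
move=> oU ss st Vb j EVb.
have oV : open (U `&` Vb.1) by apply: openI => //; apply: oE.
apply: smooth_on_congr (smooth_on_add oV (ss Vb j EVb) (st Vb j EVb)) => // q _.
by rewrite mulmxDl [RHS]mxE.
Qed.

Lemma smooth_section_scale U f s : open U -> smooth_on U f -> smooth_section E U s ->
  smooth_section E U (fun q => f q *: s q).
Proof.
move=> oU sf ss Vb j EVb.
have oV : open (U `&` Vb.1) by apply: openI => //; apply: oE.
have sf' : smooth_on (U `&` Vb.1) f by apply: smooth_on_sub sf => q [].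
apply: smooth_on_congr (smooth_on_mul oV sf' (ss Vb j EVb)) => // q _.
by rewrite -scalemxAl [RHS]mxE.
Qed.

Lemma smooth_section0 U : open U -> smooth_section E U (fun=> 0).
Proof.
move=> oU Vb j EVb.
have oV : open (U `&` Vb.1) by apply: openI => //; apply: oE.
apply: smooth_on_congr (smooth_on_cst _ 0) => // q _.
by rewrite mul0mx mxE.
Qed.

Lemma smooth_section_sum (I : Type) (r : seq I) U (f : I -> M -> 'rV[R]_d) : open U ->
  (forall i, smooth_section E U (f i)) ->
  smooth_section E U (fun q => \sum_(i <- r) f i q).
Proof.
move=> oU sf; elim: r => [|i r IH].
  by apply: smooth_section_congr (smooth_section0 oU) => // q _; rewrite big_nil.
apply: smooth_section_congr (smooth_section_add oU (sf i) IH) => // q _.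
by rewrite big_cons.
Qed.

End Sections.

(** * Covariant derivatives and curvature in a local frame *)

Section Connection.
Context {R : realType} {n : nat} {M : manifold R n} {d : nat} {E : vbundle M d}.
Context (oE : forall Vb, E Vb -> open Vb.1).
Context (nabla : connection M d) (nablaE : is_connection E nabla).
Context (c : chart M) (U : set M) (oU : open U) (Uc : U `<=` cdom c).
Implicit Types (s t : M -> 'rV[R]_d) (f : M -> R) (i j : 'I_n).

Local Notation "'d_ i" := (pd c (delta_mx 0 i)) (at level 10, i at level 8).

Definition cov_deriv i s (q : M) : 'rV[R]_d := nabla q (coord_field c (delta_mx 0 i) q) s.
Local Notation D := cov_deriv.

Lemma smooth_cov_deriv i s : smooth_section E U s -> smooth_section E U (D i s).
Proof. by have [_ _ _ _ H] := nablaE oU; apply: H; apply: smooth_coord_field. Qed.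

Lemma cov_deriv_congr i s t q : smooth_section E U s -> smooth_section E U t ->
  (forall p, U p -> s p = t p) -> U q -> D i s q = D i t q.
Proof. by have [_ _ _ H _] := nablaE oU; move=> ss st st' Uq; apply: H. Qed.

Lemma cov_deriv_add i s t q : smooth_section E U s -> smooth_section E U t -> U q ->
  D i (fun p => s p + t p) q = D i s q + D i t q.
Proof. by have [_ H _ _ _] := nablaE oU; move=> ss st Uq; apply: H. Qed.

Lemma cov_deriv_scale i f s q : smooth_on U f -> smooth_section E U s -> U q ->
  D i (fun p => f p *: s p) q = 'd_i f q *: s q + f q *: D i s q.
Proof.
have [_ _ H _ _] := nablaE oU; move=> sf ss Uq; rewrite /cov_deriv H //.
by rewrite (dderiv_coord_field i oU Uq (Uc Uq) sf).
Qed.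

Lemma cov_deriv0 i q : U q -> D i (fun=> 0) q = 0.
Proof.
move=> Uq; have := cov_deriv_add i (smooth_section0 oE oU) (smooth_section0 oE oU) Uq.
have -> : (fun p : M => 0 + 0 : 'rV[R]_d) = fun=> 0 by apply/funext => p; rewrite addr0.
by rewrite -{1}[D i _ q]addr0 => /addrI.
Qed.

Lemma cov_deriv_sum (I : Type) (r : seq I) i (s : I -> M -> 'rV[R]_d) q :
  (forall k, smooth_section E U (s k)) -> U q ->
  D i (fun p => \sum_(k <- r) s k p) q = \sum_(k <- r) D i (s k) q.
Proof.
move=> ss Uq; elim: r => [|k r IH].
  rewrite big_nil -[RHS](cov_deriv0 i Uq); congr (D i _ q).
  by apply/funext => p; rewrite big_nil.
rewrite big_cons -IH -cov_deriv_add //; last exact: smooth_section_sum.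
by congr (D i _ q); apply/funext => p; rewrite big_cons.
Qed.

Lemma curvature_coord_field i j s q : smooth_section E U s -> U q ->
  curvature nabla (coord_field c (delta_mx 0 i)) (coord_field c (delta_mx 0 j)) s q =
  D i (D j s) q - D j (D i s) q.
Proof.
move=> ss Uq; rewrite /curvature bracket_coord_field; last exact: Uc.
have [H _ _ _ _] := nablaE oU.
(* Linearity at 1 * 0 + 0 reads nabla_0 s = nabla_0 s + nabla_0 s, so the bracket term of the
   curvature vanishes. *)
have := H s ss q Uq 1 0 0; rewrite scaler0 addr0 scale1r -{1}[nabla q 0 s]addr0.
by move=> /addrI <-; rewrite subr0.
Qed.

Local Notation K i j s q := (D i (D j s) q - D j (D i s) q).

(** After applying Leibniz twice, the terms containing first derivatives of f are symmetric in i and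
    j, and so are those containing second derivatives by [pd_comm]; all of them cancel. *)
Lemma curvature_scale i j f s q : smooth_on U f -> smooth_section E U s -> U q ->
  K i j (fun p => f p *: s p) q = f q *: K i j s q.
Proof.
move=> sf ss Uq.
have H k l : D k (D l (fun p => f p *: s p)) q =
   'd_k ('d_l f) q *: s q + 'd_l f q *: D k s q
   + ('d_k f q *: D l s q + f q *: D k (D l s) q).
  have sl := smooth_on_pd l oU Uc sf; have sDl := smooth_cov_deriv l ss.
  rewrite -!cov_deriv_scale // -cov_deriv_add //; try exact: smooth_section_scale.
  apply: cov_deriv_congr => //.
  - by apply: smooth_cov_deriv; apply: smooth_section_scale.
  - by apply: smooth_section_add => //; apply: smooth_section_scale.
  - by move=> p Up; rewrite cov_deriv_scale.
rewrite !H (pd_comm oU Uq (Uc Uq) i j sf) scalerBr.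
move: ('d_j ('d_i f) q *: s q) ('d_j f q *: D i s q) ('d_i f q *: D j s q) => x y z.
rewrite -[x + z + _]addrA [z + (y + _)]addrCA -[x + y + _]addrA.
by rewrite opprD addrACA subrr add0r !opprD addrACA subrr add0r addrACA subrr add0r.
Qed.

Lemma curvature_sum (I : Type) (r : seq I) i j (f : I -> M -> R) (s : I -> M -> 'rV[R]_d) q :
  (forall k, smooth_on U (f k)) -> (forall k, smooth_section E U (s k)) -> U q ->
  K i j (fun p => \sum_(k <- r) f k p *: s k p) q =
  \sum_(k <- r) f k q *: K i j (s k) q.
Proof.
move=> sf ss Uq.
have sfs k : smooth_section E U (fun p => f k p *: s k p) by apply: smooth_section_scale.
have H a b : D a (D b (fun p => \sum_(k <- r) f k p *: s k p)) q =
    \sum_(k <- r) D a (D b (fun p => f k p *: s k p)) q.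
  rewrite -cov_deriv_sum //; last by move=> k; apply: smooth_cov_deriv.
  apply: cov_deriv_congr => //.
  - by apply: smooth_cov_deriv; apply: smooth_section_sum.
  - by apply: smooth_section_sum => // k; apply: smooth_cov_deriv.
  - by move=> p Up; rewrite cov_deriv_sum.
rewrite !H -sumrB; apply: eq_bigr => k _; exact: curvature_scale.
Qed.

Section Frame.
Context (G : M -> 'M[R]_d) (GE : is_metric E G) (nablaG : is_metric_connection E G nabla).
Context (e : M -> 'M[R]_d) (se : smooth_frame E U e)
  (one : forall q, U q -> Defs.orthonormal G q (e q)).
Implicit Types a b : 'I_d.

Definition coeff s a (q : M) : R := ip G q (s q) (row a (e q)).

Lemma coeffE s q : \row_a coeff s a q = s q *m (G q *m (e q)^T).
Proof.
by apply/rowP => a; rewrite mxE /coeff /ip mulmxA tr_row !mxE; apply: eq_bigr => k _; rewrite !mxE.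
Qed.

(** Orthonormality says that G e^T is a right inverse of the square matrix e, hence also a left
    inverse. This is the matrix of the dual coframe. *)
Lemma frame_inv q : U q -> (G q *m (e q)^T) *m e q = 1%:M.
Proof. by move=> Uq; apply: mulmx1C; rewrite mulmxA; apply: one. Qed.

Lemma frame_unit q : U q -> e q \in unitmx.
Proof. by move=> /frame_inv /mulmx1_unit[]. Qed.

Lemma coeff_expand s q : U q -> s q = (\row_a coeff s a q) *m e q.
Proof. by move=> Uq; rewrite coeffE -mulmxA frame_inv // mulmx1. Qed.

Lemma smooth_coeff s a : smooth_section E U s -> smooth_on U (coeff s a).
Proof. by move=> ss; have [_ _ H] := GE; apply: H. Qed.

Definition conn_form i (q : M) : 'M[R]_d := \matrix_(a, b) coeff (D i (fun p => row a (e p))) b q.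
Local Notation W := conn_form.

Lemma conn_formE i q a b : W i q a b = coeff (D i (fun p => row a (e p))) b q.
Proof. by rewrite mxE. Qed.

Lemma smooth_conn_form i a b : smooth_on U (fun q => W i q a b).
Proof.
apply: smooth_on_congr (smooth_coeff b (smooth_cov_deriv i (se a))) => // q _.
by rewrite conn_formE.
Qed.

(** Differentiate the constant function <e_a, e_b> with the metric connection. *)
Lemma conn_form_antisym i q a b : U q -> W i q b a = - W i q a b.
Proof.
move=> Uq; apply/eqP; rewrite -addr_eq0 addrC !conn_formE.
have := (proj2 nablaG) U _ _ oU (se a) (se b) q Uq (coord_field c (delta_mx 0 i) q).
rewrite (dderiv_coord_field i oU Uq (Uc Uq)); last by have [_ _ H] := GE; apply: H.
rewrite (@pd_congr _ _ _ c _ _ (fun=> (a == b)%:R) q U) //; last 2 first.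
- exact: Uc.
- move=> p Up _; have /matrixP/(_ a b) := one Up; rewrite [RHS]mxE => <-.
  by rewrite /ip -row_mul tr_row !mxE; apply: eq_bigr => k _; rewrite !mxE.
rewrite pd_cst => H; apply/eqP; rewrite {1}/coeff /coeff.
have sym (u v : 'rV[R]_d) : ip G q u v = ip G q v u.
  have [S _ _] := GE.
  rewrite /ip -[in LHS](trmxK (u *m G q *m v^T)) mxE.
  by rewrite !trmx_mul trmxK S mulmxA.
by rewrite [X in _ + X]sym -H.
Qed.

Lemma cov_deriv_row i q (h : M -> 'rV[R]_d) : (forall a, smooth_on U (fun p => h p 0 a)) -> U q ->
  D i (fun p => h p *m e p) q = (\row_a 'd_i (fun p => h p 0 a) q + h q *m W i q) *m e q.
Proof.
move=> sh Uq.
have -> : (fun p => h p *m e p) = (fun p => \sum_a h p 0 a *: row a (e p)).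
  by apply/funext => p; rewrite mulmx_sum_row.
rewrite cov_deriv_sum //; last by move=> a; apply: smooth_section_scale => //; apply: se.
rewrite mulmxDl -mulmxA !mulmx_sum_row -big_split /=; apply: eq_bigr => a _.
rewrite (cov_deriv_scale i (sh a) (se a) Uq).
rewrite mxE row_mul; congr (_ + _ *: _); rewrite {1}(coeff_expand (D i _) Uq).
by congr (_ *m _); apply/rowP => b; rewrite [LHS]mxE [RHS]mxE conn_formE.
Qed.

(* Coefficients are row vectors, whence dW - W /\ W rather than dW + W /\ W. *)
Definition curv_form i j (q : M) : 'M[R]_d :=
  \matrix_(a, b) ('d_i (fun p => W j p a b) q - 'd_j (fun p => W i p a b) q)
  + (W j q *m W i q - W i q *m W j q).

Lemma curv_formE i j q a b : curv_form i j q a b =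
  'd_i (fun p => W j p a b) q - 'd_j (fun p => W i p a b) q
  + (W j q *m W i q - W i q *m W j q) a b.
Proof. by rewrite [LHS]mxE; congr (_ + _); rewrite mxE. Qed.

Lemma curv_form_antisym i j q a b : U q -> curv_form i j q b a = - curv_form i j q a b.
Proof.
move=> Uq.
have dW k l : 'd_k (fun p => W l p b a) q = - 'd_k (fun p => W l p a b) q.
  rewrite (@pd_congr _ _ _ c _ _ (fun p => -1 * W l p a b) q U) //; last 2 first.
  - exact: Uc.
  - by move=> p Up _; rewrite mulN1r conn_form_antisym.
  have sW := smooth_conn_form l a b.
  by rewrite (pd_mul oU Uq (Uc Uq) _ (smooth_on_cst U (-1)) sW) pd_cst mul0r add0r mulN1r.
have WT k : (W k q)^T = - W k q.
  by apply/matrixP => x y; rewrite [LHS]mxE [RHS]mxE conn_form_antisym.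
have T : (W j q *m W i q - W i q *m W j q)^T = - (W j q *m W i q - W i q *m W j q).
  exact: trmx_commutator_antisym.
have T1 := congr1 (fun A : 'M[R]_d => A a b) T; rewrite [LHS]mxE in T1.
rewrite [RHS]mxE in T1.
by rewrite !curv_formE T1 !dW -!opprD.
Qed.

Lemma curv_form_skew i j q a b : curv_form j i q a b = - curv_form i j q a b.
Proof.
apply: etrans (curv_formE j i q a b) (etrans _ (congr1 -%R (esym (curv_formE i j q a b)))).
move: (pd _ _ _ _) (pd _ _ _ _) (W j q) (W i q) => x y A B.
by rewrite opprD opprB -[B *m A - _]opprB; congr (_ + _); rewrite [LHS]mxE.
Qed.

(** By tensoriality only the frame fields need to be differentiated. The first derivative of e_a is
    row a of the connection form times e, again a combination of frame fields, so [cov_deriv_row]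
    computes the second derivative. *)
Lemma curvature_row i j q (h : M -> 'rV[R]_d) :
  (forall a, smooth_on U (fun p => h p 0 a)) -> U q ->
  K i j (fun p => h p *m e p) q = h q *m curv_form i j q *m e q.
Proof.
move=> sh Uq.
have -> : (fun p => h p *m e p) = (fun p => \sum_a h p 0 a *: row a (e p)).
  by apply/funext => p; rewrite mulmx_sum_row.
rewrite curvature_sum // -mulmxA mulmx_sum_row; apply: eq_bigr => a _.
congr (_ *: _); rewrite row_mul.
have H k l : D k (D l (fun p => row a (e p))) q =
    (\row_b 'd_k (fun p => W l p a b) q + row a (W l q *m W k q)) *m e q.
  have sW b : smooth_on U (fun p => (row a (W l p)) 0 b).
    by apply: smooth_on_congr (smooth_conn_form l a b) => // p _; rewrite !mxE.
  have sR : smooth_section E U (fun p => row a (W l p) *m e p).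
    apply: (@smooth_section_congr _ _ _ _ _ oE U (fun p => \sum_b (row a (W l p)) 0 b *: row b (e p))) => //.
      by move=> p Up; rewrite mulmx_sum_row.
    by apply: smooth_section_sum => // b; apply: smooth_section_scale.
  rewrite (cov_deriv_congr k (smooth_cov_deriv l (se a)) sR _ Uq); last first.
    move=> p Up; rewrite (coeff_expand (D l _) Up); congr (_ *m _).
    by apply/rowP => b; rewrite [LHS]mxE [RHS]mxE conn_formE.
  rewrite (cov_deriv_row k sW Uq) row_mul; congr ((_ + _) *m _).
  apply/rowP => b; rewrite !mxE; congr pd; apply/funext => p.
  by rewrite mxE.
rewrite !H -mulmxBl; congr (_ *m _).
have L (u v : 'rV[R]_d) (X Y : 'M[R]_d) b :
    (u + row a X - (v + row a Y)) 0 b = u 0 b - v 0 b + (X - Y) a b.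
  by rewrite !mxE; ring.
apply/rowP => b; rewrite L [RHS]mxE curv_formE; congr (_ - _ + _); exact: mxE.
Qed.

Lemma curvature_coeff i j s q : smooth_section E U s -> U q ->
  K i j s q = (\row_a coeff s a q) *m curv_form i j q *m e q.
Proof.
move=> ss Uq; pose h p := \row_a coeff s a p : 'rV[R]_d.
have sh a : smooth_on U (fun p => h p 0 a).
  by apply: smooth_on_congr (smooth_coeff a ss) => // p _; rewrite mxE.
rewrite -[\row_a _]/(h q) -curvature_row //.
have sR : smooth_section E U (fun p => h p *m e p).
  by apply: smooth_section_congr ss => // p Up; apply: coeff_expand.
have H k l : D k (D l s) q = D k (D l (fun p => h p *m e p)) q.
  apply: cov_deriv_congr => //; try exact: smooth_cov_deriv.
  by move=> p Up; apply: cov_deriv_congr => // p' Up'; apply: coeff_expand.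
by rewrite !H.
Qed.

End Frame.
End Connection.

(** * Torsion and the first Bianchi identity *)

Section LeviCivita.
Context {R : realType} {n : nat} {M : manifold R n}.
Context (G : M -> 'M[R]_n) (GM : is_metric (TM M) G).
Context (nabla : connection M n) (LC : is_levi_civita G nabla).
Context (c : chart M) (U : set M) (oU : open U) (Uc : U `<=` cdom c).
Context (e : M -> 'M[R]_n) (se : smooth_frame (TM M) U e)
  (one : forall q, U q -> Defs.orthonormal G q (e q)).

Lemma open_TM Vb : @TM R n M Vb -> open Vb.1.
Proof. by move=> [d ->]; apply: cdom_open. Qed.

Let nablaE : is_connection (TM M) nabla := proj1 (proj1 LC).
Local Notation D := (cov_deriv nabla c).
Local Notation del i := (coord_field c (delta_mx 0 i)).
Local Notation "'d_ i" := (pd c (delta_mx 0 i)) (at level 10, i at level 8).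
Local Notation W := (conn_form nabla c G e).
Local Notation Om := (curv_form nabla c G e).

Lemma smooth_del i : smooth_section (TM M) U (del i).
Proof. exact: smooth_coord_field. Qed.

Lemma cov_deriv_del i j q : U q -> D j (del i) q = D i (del j) q.
Proof.
move=> Uq; apply/eqP; rewrite -subr_eq0; apply/eqP.
rewrite -(@bracket_coord_field _ _ _ c j i q (Uc Uq)).
exact: ((proj2 LC) U _ _ oU (smooth_del j) (smooth_del i) q Uq).
Qed.

Definition coframe i a q : R := coeff G e (del i) a q.
Local Notation B := coframe.

Lemma coframeE q : \matrix_(i, a) B i a q = coord_frame c q *m (G q *m (e q)^T).
Proof.
apply/row_matrixP => i; rewrite row_mul rowK.
by rewrite -[RHS]coeffE; apply/rowP => a; rewrite !mxE.
Qed.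

Lemma smooth_coframe i a : smooth_on U (B i a).
Proof. exact: (smooth_coeff oU GM se a (smooth_del i)). Qed.

(** Cartan's first structure equation. The coordinate fields commute, so vanishing torsion means
    nabla_j del_i = nabla_i del_j; compare the coefficients of both sides in the frame e. *)
Lemma coframe_torsion i j a q : U q ->
  'd_j (B i a) q + \sum_b B i b q * W j q b a = 'd_i (B j a) q + \sum_b B j b q * W i q b a.
Proof.
move=> Uq.
have H k l : D l (del k) q = (\row_a ('d_l (B k a) q + \sum_b B k b q * W l q b a)) *m e q.
  pose h p := \row_a B k a p : 'rV[R]_n.
  have sh b : smooth_on U (fun p => h p 0 b).
    by apply: smooth_on_congr (smooth_coframe k b) => // p _; rewrite mxE.
  have E p : U p -> del k p = h p *m e p by move=> Up; apply: (coeff_expand one).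
  rewrite (@cov_deriv_congr _ _ _ _ _ nabla nablaE c U oU l (del k) (fun p => h p *m e p)) //.
  - rewrite (cov_deriv_row open_TM nablaE oU Uc se one l sh Uq); congr (_ *m _).
    apply/rowP => b; rewrite !mxE; congr (_ + _); last first.
      by apply: eq_bigr => b' _; rewrite !mxE.
    by congr pd; apply/funext => p; rewrite mxE.
  - exact: smooth_del.
  - by apply: (smooth_section_congr open_TM oU E); apply: smooth_del.
have inj : injective (mulmx^~ (e q) : 'rV[R]_n -> 'rV[R]_n).
  exact: can_inj (mulmxK (frame_unit one Uq)).
have /inj/rowP/(_ a) := etrans (esym (H i j)) (etrans (cov_deriv_del i j Uq) (H j i)).
by rewrite [LHS]mxE [RHS]mxE.
Qed.

Lemma curvature_del i j k q : U q ->
  curvature nabla (del i) (del j) (del k) q = (\row_a B k a q) *m Om i j q *m e q.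
Proof.
move=> Uq; rewrite (curvature_coord_field nablaE oU Uc) //; last exact: smooth_del.
exact: (curvature_coeff open_TM nablaE oU Uc GM se one i j (smooth_del k) Uq).
Qed.

(** Written with second covariant derivatives, the cyclic sum has six terms. Symmetry of nabla_j
    del_k in j and k makes them cancel in pairs. *)
Lemma curvature_bianchi i j k q : U q ->
  (\row_a B k a q) *m Om i j q + (\row_a B i a q) *m Om j k q
    + (\row_a B j a q) *m Om k i q = 0.
Proof.
move=> Uq; apply: (can_inj (mulmxK (frame_unit one Uq))).
have K a b l : (\row_x B l x q) *m Om a b q *m e q =
    D a (D b (del l)) q - D b (D a (del l)) q.
  apply: etrans (esym (curvature_del a b l Uq)) _.
  exact: (curvature_coord_field nablaE oU Uc a b (smooth_del l) Uq).
have Z (X Y T : 'rV[R]_n) x y z : X *m e q = x -> Y *m e q = y -> T *m e q = z ->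
    x + y + z = 0 -> (X + Y + T) *m e q = 0 *m e q.
  by move=> <- <- <- E; rewrite !mulmxDl mul0mx.
apply: (Z _ _ _ _ _ _ (K i j k) (K j k i) (K k i j)) => {Z K}.
have H a b l : D a (D b (del l)) q = D a (D l (del b)) q.
  have sD x y : smooth_section (TM M) U (D x (del y)).
    exact: (smooth_cov_deriv nablaE oU Uc x (smooth_del y)).
  exact: (cov_deriv_congr nablaE c oU a (sD b l) (sD l b) (fun p Up => cov_deriv_del l b Up) Uq).
rewrite (H i j k) (H j k i) (H k i j).
move: (D i (D k (del j)) q) (D j (D i (del k)) q) (D k (D j (del i)) q) => x y z.
by rewrite !subrKA subrr.
Qed.

End LeviCivita.

(** * Clifford algebra and the spin group *)

Section CliffordAlgebra.
Context {R : realType} {n : nat}.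
Implicit Types (A B C : {set 'I_n}) (a b c : Cl R n) (x y v : 'rV[R]_n).

Definition symdiff A B : {set 'I_n} := ((A :\: B) :|: (B :\: A))%SET.

Lemma in_symdiff i A B : (i \in symdiff A B) = (i \in A) (+) (i \in B).
Proof. by rewrite !inE; case: (i \in A); case: (i \in B). Qed.

Lemma symdiffC A B : symdiff A B = symdiff B A.
Proof. by apply/setP => i; rewrite !in_symdiff addbC. Qed.

Lemma symdiffA A B C : symdiff A (symdiff B C) = symdiff (symdiff A B) C.
Proof. by apply/setP => i; rewrite !in_symdiff addbA. Qed.

Lemma symdiffK A : involutive (symdiff A).
Proof. by move=> B; apply/setP => i; rewrite !in_symdiff addbA addbb. Qed.

Lemma symdiffv A : symdiff A A = finset.set0.
Proof. by apply/setP => i; rewrite in_symdiff addbb inE. Qed.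

Lemma symdiff0 A : symdiff A finset.set0 = A.
Proof. by apply/setP => i; rewrite in_symdiff inE addbF. Qed.

Definition clsign A B : R := (-1) ^+ #|[set ij : 'I_n * 'I_n |
  [&& ij.1 \in A, ij.2 \in B & (ij.2 <= ij.1)%N]]%SET|.

Lemma clsign_prod A B : clsign A B =
  \prod_(ij : 'I_n * 'I_n) (if [&& ij.1 \in A, ij.2 \in B & (ij.2 <= ij.1)%N] then -1 else 1).
Proof.
rewrite /clsign -[LHS]prodr_const [LHS]big_mkcond /=.
by apply: eq_bigr => ij _; rewrite inE.
Qed.

(** The exponent of the sign is bilinear over the field with two elements, so the sign is a
    bicharacter of the group of subsets under symmetric difference. Associativity and the reversal
    rule are consequences. *)
Lemma clsignDl A A' B : clsign (symdiff A A') B = clsign A B * clsign A' B.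
Proof.
rewrite !clsign_prod -big_split /=; apply: eq_bigr => -[i j] _ /=; rewrite in_symdiff.
by case: (i \in A); case: (i \in A'); case: (j \in B); case: (j <= i)%N;
  rewrite /= ?mulr1 ?mul1r ?mulrNN ?mulr1.
Qed.

Lemma clsignDr A B B' : clsign A (symdiff B B') = clsign A B * clsign A B'.
Proof.
rewrite !clsign_prod -big_split /=; apply: eq_bigr => -[i j] _ /=; rewrite in_symdiff.
by case: (i \in A); case: (j \in B); case: (j \in B'); case: (j <= i)%N;
  rewrite /= ?mulr1 ?mul1r ?mulrNN ?mulr1.
Qed.

Lemma clsign_sqr A B : clsign A B * clsign A B = 1.
Proof. by rewrite /clsign -signr_odd; case: odd; rewrite ?expr0 ?expr1 ?mulrNN mulr1. Qed.

Lemma clsign0r A : clsign A finset.set0 = 1.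
Proof. by rewrite clsign_prod big1 // => ij _; rewrite inE andbF. Qed.

Lemma clsign0l A : clsign finset.set0 A = 1.
Proof. by rewrite clsign_prod big1 // => ij _; rewrite inE. Qed.

Lemma clmulE a b C : clmul a b C = \sum_A clsign A (symdiff A C) * (a A * b (symdiff A C)).
Proof.
rewrite ffunE; apply: eq_bigr => A _.
rewrite (eq_bigl (pred1 (symdiff A C))) ?big_pred1_eq // => B /=.
rewrite -/(symdiff A B); apply/eqP/eqP => ->; by rewrite symdiffK.
Qed.

Lemma clmulA a b c : clmul a (clmul b c) = clmul (clmul a b) c.
Proof.
apply/ffunP => D; rewrite !clmulE.
transitivity (\sum_A \sum_X clsign A (symdiff A D) *
  clsign (symdiff A X) (symdiff X D) * (a A * b (symdiff A X) * c (symdiff X D))).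
  apply: eq_bigr => A _; rewrite clmulE.
  (* The new index X is the set of the product e_A e_B, which is the outer summation index on the
     other side. *)
  rewrite (reindex_inj (can_inj (symdiffK A))) /= !mulr_sumr.
  apply: eq_bigr => X _.
  have -> : symdiff (symdiff A X) (symdiff A D) = symdiff X D.
    by rewrite -symdiffA (symdiffC X) -symdiffA symdiffK symdiffC.
  by ring.
rewrite exchange_big /=; apply: eq_bigr => X _; rewrite clmulE mulr_suml mulr_sumr.
apply: eq_bigr => A _.
have E : symdiff A D = symdiff (symdiff A X) (symdiff X D).
  by rewrite -symdiffA symdiffK.
rewrite E clsignDr clsignDl.
rewrite (_ : _ * _ * (clsign A (symdiff X D) * _) = clsign X (symdiff X D) *
  clsign A (symdiff A X) * (clsign A (symdiff X D) * clsign A (symdiff X D))); last by ring.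
by rewrite clsign_sqr; ring.
Qed.

Lemma clmul1l a : clmul cl1 a = a.
Proof.
apply/ffunP => C; rewrite clmulE (bigD1 (finset.set0 : {set 'I_n})) //= big1 ?addr0.
  by rewrite ffunE eqxx symdiffC symdiff0 clsign0l !mul1r.
by move=> A /negPf A0; rewrite ffunE A0 mul0r mulr0.
Qed.

Lemma clmul1r a : clmul a cl1 = a.
Proof.
apply/ffunP => C; rewrite clmulE (bigD1 C) //= big1 ?addr0.
  by rewrite ffunE symdiffv eqxx clsign0r mulr1 mul1r.
move=> A AC; rewrite ffunE; case: eqP => [E|]; last by rewrite !mulr0.
by case/eqP: AC; rewrite -[C](symdiffK A) E symdiff0.
Qed.

Lemma clmulDl a b c : clmul (a + b) c = clmul a c + clmul b c.
Proof.
by apply/ffunP => C; rewrite [RHS]ffunE !clmulE -big_split; apply: eq_bigr => A _; rewrite ffunE /=; ring.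
Qed.

Definition clscale (t : R) a : Cl R n := [ffun A => t * a A].

Lemma clmulZl t a b : clmul (clscale t a) b = clscale t (clmul a b).
Proof.
by apply/ffunP => C; rewrite [RHS]ffunE !clmulE mulr_sumr; apply: eq_bigr => A _; rewrite ffunE; ring.
Qed.

Lemma clmulZr t a b : clmul a (clscale t b) = clscale t (clmul a b).
Proof.
by apply/ffunP => C; rewrite [RHS]ffunE !clmulE mulr_sumr; apply: eq_bigr => A _; rewrite ffunE; ring.
Qed.

Lemma clrev_clmul a b : clrev (clmul a b) = clmul (clrev b) (clrev a).
Proof.
(* The reversal sign in terms of [clsign]: the pairs j <= i in A number C(|A| + 1, 2) = C(|A|, 2) +
   |A|. They are counted by covering A x A with the pairs j <= i and the pairs i <= j, which overlap
   in the diagonal. *)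
have revE A : (-1) ^+ 'C(#|A|, 2) = clsign A A * (-1) ^+ #|A| :> R.
  pose N := #|[set ij : 'I_n * 'I_n | [&& ij.1 \in A, ij.2 \in A & (ij.2 <= ij.1)%N]]%SET|.
  rewrite /clsign -exprD -/N.
  suff -> : N = 'C(#|A|.+1, 2).
    by rewrite binS bin1 -addnA addnn exprD -[(-1) ^+ _.*2]signr_odd odd_double mulr1.
  suff : (N * 2 = #|A|.+1 * #|A|)%N.
    by move=> E; rewrite bin2 -E muln2 doubleK.
  pose S := [set ij : 'I_n * 'I_n | [&& ij.1 \in A, ij.2 \in A & (ij.2 <= ij.1)%N]]%SET.
  pose S' := [set ij : 'I_n * 'I_n | [&& ij.1 \in A, ij.2 \in A & (ij.1 <= ij.2)%N]]%SET.
  have sw : injective (fun p : 'I_n * 'I_n => (p.2, p.1)) by move=> [? ?] [? ?] [-> ->].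
  have NS' : #|S'| = N.
    rewrite -[N]/(#|S|) -(card_imset S sw); apply: eq_card => -[i j]; rewrite inE /=.
    apply/idP/imsetP => [/and3P[iA jA ij]|[[j' i'] + [-> ->]]].
      by exists (j, i); rewrite // inE /= jA iA.
    by rewrite inE /= => /and3P[-> ->].
  have SU : (S :|: S')%SET = finset.setX A A.
    apply/setP => -[i j]; rewrite !inE /=.
    by case: (i \in A); case: (j \in A); rewrite //= leq_total.
  have SI : (S :&: S')%SET = [set (i, i) | i in A]%SET.
    apply/setP => -[i j]; rewrite !inE /=; apply/idP/imsetP.
      move=> /andP[/and3P[iA _ ji] /and3P[_ _ ij]]; exists i => //.
      by congr (_, _); apply: val_inj; apply/eqP; rewrite eqn_leq ji.
    by move=> [k kA [-> ->]]; rewrite kA leqnn.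
  rewrite muln2 -addnn -{2}NS' -cardsUI SU SI cardsX card_imset; last by move=> ? ? [].
  by rewrite mulSn addnC.
apply/ffunP => C; rewrite [LHS]ffunE !clmulE mulr_sumr.
rewrite [RHS](reindex_inj (can_inj (fun A => symdiffK C A))) /=; apply: eq_bigr => A _.
rewrite !ffunE !revE (symdiffC C A).
have -> : symdiff (symdiff A C) C = A by rewrite -symdiffA symdiffv symdiff0.
have [B EB EC] : exists2 B, symdiff A C = B & C = symdiff A B.
  by exists (symdiff A C); rewrite ?symdiffK.
rewrite EB.
have sE (D : {set 'I_n}) : (-1) ^+ #|D| = \prod_i (if i \in D then -1 else 1) :> R.
  by rewrite -prodr_const big_mkcond.
have -> : (-1) ^+ #|C| = (-1) ^+ #|A| * (-1) ^+ #|B| :> R.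
  rewrite EC !sE -big_split /=; apply: eq_bigr => i _; rewrite in_symdiff.
  by case: (i \in A); case: (i \in B); rewrite /= ?mulr1 ?mul1r ?mulrNN ?mulr1.
transitivity ((clsign A B * clsign A B) * (clsign A A * clsign B B * clsign B A *
  ((-1) ^+ #|A| * (-1) ^+ #|B|) * (a A * b B))); first by rewrite EC clsignDl !clsignDr; ring.
by rewrite clsign_sqr; ring.
Qed.

Lemma clvec1 x i : clvec x [set i]%SET = x 0 i.
Proof.
rewrite ffunE (big_pred1 i) // => j /=; apply/eqP/eqP => [/setP/(_ i)|->] //.
by rewrite !inE eqxx => /esym/eqP.
Qed.

Lemma sum_clvec x (g : {set 'I_n} -> R) :
  \sum_A clvec x A * g A = \sum_i x 0 i * g [set i]%SET.
Proof.
under eq_bigr do rewrite ffunE mulr_suml.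
rewrite (exchange_big_dep predT) //=; apply: eq_bigr => i _.
by rewrite (big_pred1 [set i]%SET).
Qed.

Lemma sum_clvecZ (V : lmodType R[i]) x (g : {set 'I_n} -> V) :
  \sum_A (clvec x A)%:C *: g A = \sum_i (x 0 i)%:C *: g [set i]%SET.
Proof.
under eq_bigr do rewrite ffunE rmorph_sum scaler_suml.
rewrite (exchange_big_dep predT) //=; apply: eq_bigr => i _.
by rewrite (big_pred1 [set i]%SET).
Qed.

Lemma clsign11 i j : clsign [set i]%SET [set j]%SET = if (j <= i)%N then -1 else 1.
Proof.
rewrite clsign_prod (bigD1 (i, j)) //= !inE !eqxx /= big1 ?mulr1 // => -[i' j'] /=.
rewrite !inE => H; case: ifP => // /and3P[/eqP E1 /eqP E2 _].
by rewrite E1 E2 eqxx in H.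
Qed.

Lemma clmul_vec_anticomm x y :
  clmul (clvec x) (clvec y) + clmul (clvec y) (clvec x) =
  clscale (- 2 * \sum_i x 0 i * y 0 i) cl1.
Proof.
apply/ffunP => C.
have H u v : clmul (clvec u) (clvec v) C = \sum_i \sum_j
    u 0 i * v 0 j * (if C == symdiff [set i]%SET [set j]%SET then
      (if (j <= i)%N then -1 else 1) else 0) :> R.
  rewrite clmulE.
  transitivity (\sum_A clvec u A * (clsign A (symdiff A C) * clvec v (symdiff A C))).
    by apply: eq_bigr => A _; ring.
  rewrite sum_clvec; apply: eq_bigr => i _.
  rewrite ffunE big_mkcond !mulr_sumr; apply: eq_bigr => j _.
  rewrite -mulrA; congr (_ * _).
  have -> : (symdiff [set i]%SET C == [set j]%SET) = (C == symdiff [set i]%SET [set j]%SET).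
    by apply/eqP/eqP => [<-|->]; rewrite symdiffK.
  case: eqP => [->|_]; last by rewrite !mulr0.
  by rewrite symdiffK clsign11 mulrC.
(* Off the diagonal, (i, j) and (j, i) carry opposite signs and the same set; the diagonal
   contributes -1 from each product. *)
rewrite [LHS]ffunE !H [X in _ + X]exchange_big -big_split /= !ffunE.
rewrite mulr_sumr mulr_suml; apply: eq_bigr => i _.
rewrite -big_split /= (bigD1 i) //= big1 ?addr0.
  by rewrite symdiffv leqnn; case: eqP => _ /=; ring.
move=> j /negPf ji; rewrite (symdiffC [set j]%SET).
case: eqP => _; rewrite ?mulr0 ?addr0 //.
by case: (ltngtP i j) ji => [||/val_inj ->]; rewrite ?eqxx // => *; ring.
Qed.

Lemma clvec_sqr v : \sum_i (v 0 i) ^+ 2 = 1 -> clmul (clvec v) (clvec v) = clscale (-1) cl1.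
Proof.
move=> v1; have /ffunP H := clmul_vec_anticomm v v; apply/ffunP => C.
have := H C; rewrite !ffunE (_ : \sum_i v 0 i * v 0 i = 1); last first.
  by rewrite -v1; apply: eq_bigr => i _; rewrite expr2.
by case: (C == _) => /= E; lra.
Qed.

Definition reflect_vec v y : 'rV[R]_n := y - (2 * \sum_i v 0 i * y 0 i) *: v.

(** As v^-1 = -v, the product v y v is -v y v^-1, which fixes the hyperplane orthogonal to v and
    reverses v. *)
Lemma clvec_sandwich v y : \sum_i (v 0 i) ^+ 2 = 1 ->
  clmul (clmul (clvec v) (clvec y)) (clvec v) = clvec (reflect_vec v y).
Proof.
move=> v1.
have -> : clmul (clvec v) (clvec y) =
    clscale (- 2 * \sum_i v 0 i * y 0 i) cl1 + clscale (-1) (clmul (clvec y) (clvec v)).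
  by apply/ffunP => C; have /ffunP/(_ C) := clmul_vec_anticomm v y; rewrite !ffunE => <-; ring.
rewrite clmulDl !clmulZl clmul1l -clmulA clvec_sqr // clmulZr clmul1r.
rewrite /reflect_vec; move: (\sum_i v 0 i * y 0 i) => s.
apply/ffunP => C; rewrite !ffunE !mulr_sumr -!big_split /=.
by apply: eq_bigr => i _; rewrite !mxE; ring.
Qed.

Definition spin_word (vs : seq 'rV[R]_n) : Cl R n :=
  foldr (fun v => clmul (clvec v)) cl1 vs.

Lemma clrev_vec v : clrev (clvec v) = clvec v.
Proof.
apply/ffunP => A; rewrite !ffunE; case: (pickP (fun i : 'I_n => A == [set i]%SET)) => [i /eqP ->|H].
  by rewrite cards1 mul1r.
by rewrite big_pred0 // mulr0.
Qed.

Lemma clrev1 : clrev (cl1 : Cl R n) = cl1.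
Proof.
apply/ffunP => A; rewrite !ffunE; case: eqP => [->|]; last by rewrite mulr0.
by rewrite cards0 mul1r.
Qed.

(** Reversal puts the same letters on the right in opposite order, so they enclose x in pairs, and
    every pair is a reflection by [clvec_sandwich]. *)
Lemma clmul_vec_spin vs x : all (fun v : 'rV[R]_n => \sum_i (v 0 i) ^+ 2 == 1) vs ->
  clmul (clmul (spin_word vs) (clvec x)) (clrev (spin_word vs)) =
  clvec (foldr reflect_vec x vs).
Proof.
elim: vs => [|v vs IH] /=; first by rewrite clrev1 clmul1l clmul1r.
move=> /andP[/eqP v1 /IH {}IH]; rewrite clrev_clmul clrev_vec.
by rewrite -(clvec_sandwich _ v1) -IH !clmulA.
Qed.

End CliffordAlgebra.

(** * Action of the spin group on spinors *)

Section SpinorRepresentation.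
Context {R : realType} {n : nat} (k : spin_rep R n) (k_rep : is_spin_rep k).
Implicit Types (A B : {set 'I_n}) (a b : Cl R n) (x y v : 'rV[R]_n).
Local Notation N := (2 ^ n./2)%N.
Local Notation ctr A := ((map_mx conjc A)^T).

Lemma spin_rep_anticomm i j : k i *m k j = - (k j *m k i) - ((i == j)%:R *+ 2)%:M.
Proof.
by have [/(_ i j)/(canRL (addrK _)) -> _ _] := k_rep; rewrite raddfN addrC.
Qed.

Lemma kappa_basisE A : kappa_basis k A = \big[mulmx/1%:M]_(i <- enum 'I_n | i \in A) k i.
Proof. by rewrite -big_filter enumT. Qed.

Lemma addmm_inj (X Y : 'M[R[i]]_N) : X + X = Y + Y -> X = Y.
Proof.
move=> /matrixP H; apply/matrixP => i j; have := H i j; rewrite !mxE -!mulr2n.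
exact: pmulrnI.
Qed.

(** Push k_i to its place in the increasing word. It anticommutes with each smaller letter of A, and
    if i itself is in A the two copies give -1; hence one sign for every j <= i in A. *)
Lemma spin_rep_mul_word (l : seq 'I_n) i A : uniq l -> sorted ltn (map val l) -> i \in l ->
  k i *m \big[mulmx/1%:M]_(j <- l | j \in A) k j =
  (-1) ^+ count (fun j : 'I_n => (j \in A) && (j <= i)%N) l *:
    \big[mulmx/1%:M]_(j <- l | j \in symdiff [set i]%SET A) k j.
Proof.
elim: l => // j l IH /= /andP[jl ul] srt; rewrite inE.
have srt' := path_sorted srt.
have jlt j' : j' \in l -> (j < j')%N.
  move=> j'l; have /allP/(_ (val j')) := order_path_min (@ltn_trans) srt.
  by apply; apply: map_f.
rewrite !big_cons in_symdiff inE.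
have [-> _|ij /= il] := eqVneq i j.
  rewrite leqnn andbT /=.
  have -> : count (fun j' : 'I_n => (j' \in A) && (j' <= j)%N) l = 0%N.
    apply/eqP; rewrite -leqn0 leqNgt -has_count; apply/hasPn => j' /jlt.
    by rewrite ltnNge => /negPf ->; rewrite andbF.
  have -> : \big[mulmx/1%:M]_(j' <- l | j' \in symdiff [set j]%SET A) k j' =
      \big[mulmx/1%:M]_(j' <- l | j' \in A) k j'.
    rewrite big_seq_cond [RHS]big_seq_cond; apply: eq_bigl => j'.
    rewrite in_symdiff inE; have [->|] := eqVneq j' j; first by rewrite (negPf jl).
    by [].
  case: (j \in A) => /=; rewrite addn0 ?expr0 ?expr1 ?scale1r //.
  rewrite mulmxA; have [H _ _] := k_rep.
  have E : k j *m k j = (-1)%:M.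
    by apply: addmm_inj; rewrite H eqxx -raddfD /= mulr2n opprD.
  by rewrite E mul_scalar_mx.
have ji := jlt _ il; rewrite (ltnW ji) andbT.
case: (j \in A) => /=; last by rewrite add0n IH.
rewrite mulmxA spin_rep_anticomm (negPf ij) mul0rn raddf0 subr0 mulNmx -mulmxA IH //.
by rewrite -scalemxAr exprS mulN1r scaleNr.
Qed.

Lemma kappa_basis_vecl i A :
  k i *m kappa_basis k A = (clsign [set i]%SET A : R)%:C *: kappa_basis k (symdiff [set i]%SET A).
Proof.
rewrite !kappa_basisE spin_rep_mul_word ?mem_enum ?enum_uniq //; last first.
  by rewrite val_enum_ord iota_ltn_sorted.
congr (_ *: _); rewrite /clsign rmorphXn rmorphN1; congr (_ ^+ _).
rewrite -size_filter -(card_uniqP _) ?filter_uniq ?enum_uniq //.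
have inj : injective (fun j : 'I_n => (i, j)) by move=> ? ? [].
rewrite -(card_imset _ inj); apply: eq_card => -[i' j]; rewrite inE /= inE.
apply/imsetP/and3P => [[j' + [-> ->]]|[/eqP -> jA ji]].
  by rewrite mem_filter => /andP[/andP[-> ->] _].
  by exists j => //; rewrite mem_filter jA ji mem_enum.
by rewrite -enumT enum_uniq.
Qed.

(** An element of Spin is a word in vectors, and peeling off the first letter is the step of the
    inductions on words. *)
Lemma kappa_clmul_vec x a : kappa k (clmul (clvec x) a) = kappa_vec k x *m kappa k a.
Proof.
rewrite /kappa; under eq_bigr do rewrite clmulE rmorph_sum scaler_suml.
rewrite exchange_big /=.
transitivity (\sum_A (clvec x A)%:C *: \sum_B
   ((clsign A B * a B)%:C *: kappa_basis k (symdiff A B))).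
  apply: eq_bigr => A _; rewrite (reindex_inj (can_inj (symdiffK A))) scaler_sumr.
  apply: eq_bigr => B _; rewrite symdiffK scalerA -rmorphM; congr (_%:C *: _); ring.
rewrite sum_clvecZ /kappa_vec mulmx_suml; apply: eq_bigr => i _.
rewrite -scalemxAl; congr (_ *: _); rewrite mulmx_sumr; apply: eq_bigr => B _.
by rewrite -scalemxAr kappa_basis_vecl scalerA -rmorphM; congr (_%:C *: _); ring.
Qed.

Lemma kappa1 : kappa k cl1 = 1%:M.
Proof.
rewrite /kappa (bigD1 (finset.set0 : {set 'I_n})) //= big1 ?addr0.
  by rewrite ffunE eqxx scale1r /kappa_basis enum_set0 big_nil.
by move=> A /negPf A0; rewrite ffunE A0 scale0r.
Qed.

Lemma kappa_vecD x y : kappa_vec k (x + y) = kappa_vec k x + kappa_vec k y.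
Proof.
by rewrite /kappa_vec -big_split /=; apply: eq_bigr => i _; rewrite mxE rmorphD scalerDl.
Qed.

Lemma kappa_vecZ t x : kappa_vec k (t *: x) = t%:C *: kappa_vec k x.
Proof.
by rewrite /kappa_vec scaler_sumr; apply: eq_bigr => i _; rewrite mxE rmorphM scalerA.
Qed.

Lemma kappa_vec_anticomm x y : kappa_vec k x *m kappa_vec k y + kappa_vec k y *m kappa_vec k x =
  ((- 2 * \sum_i x 0 i * y 0 i)%:C)%:M.
Proof.
have E u v : kappa_vec k u *m kappa_vec k v =
    \sum_i \sum_j (u 0 i * v 0 j)%:C *: (k i *m k j).
  rewrite /kappa_vec mulmx_suml; apply: eq_bigr => i _.
  rewrite mulmx_sumr; apply: eq_bigr => j _.
  by rewrite -scalemxAl -scalemxAr scalerA -rmorphM.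
rewrite !E [X in _ + X]exchange_big -big_split /= rmorphM rmorph_sum /=.
rewrite mulr_sumr raddf_sum; apply: eq_bigr => i _.
rewrite -big_split /= (bigD1 i) //= big1 ?addr0.
  rewrite [y 0 i * _]mulrC -scalerDr; have [-> _ _] := k_rep.
  by rewrite eqxx scale_scalar_mx rmorphN rmorph_nat mulrC.
move=> j ji; rewrite [y 0 j * _]mulrC -scalerDr; have [-> _ _] := k_rep.
by rewrite eq_sym (negPf ji) mul0rn oppr0 raddf0 scaler0.
Qed.

Lemma kappa_vec_sqr v : \sum_i (v 0 i) ^+ 2 = 1 -> kappa_vec k v *m kappa_vec k v = (-1)%:M.
Proof.
move=> v1; have := kappa_vec_anticomm v v.
rewrite (_ : \sum_i v 0 i * v 0 i = 1); last by rewrite -v1; apply: eq_bigr => i _; rewrite expr2.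
rewrite mulr1 => E; apply: addmm_inj; rewrite E -raddfD /= rmorphN rmorph_nat.
by rewrite -opprD.
Qed.

Lemma kappa_vec_reflect v y : \sum_i (v 0 i) ^+ 2 = 1 ->
  kappa_vec k v *m kappa_vec k y = - (kappa_vec k (reflect_vec v y) *m kappa_vec k v).
Proof.
move=> v1; rewrite /reflect_vec -scaleNr kappa_vecD kappa_vecZ mulmxDl -scalemxAl.
rewrite kappa_vec_sqr // scale_scalar_mx rmorphN mulrNN mulr1 opprD addrC.
by apply/(canRL (addrK _)); rewrite kappa_vec_anticomm mulNr rmorphN raddfN.
Qed.

(** Moving a unit vector past y replaces y by minus its reflection. The signs accumulate to the
    parity of the word, which is even in Spin. *)
Lemma kappa_spin_word vs x : all (fun v : 'rV[R]_n => \sum_i (v 0 i) ^+ 2 == 1) vs ->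
  kappa k (spin_word vs) *m kappa_vec k x =
  (-1) ^+ size vs *: (kappa_vec k (foldr reflect_vec x vs) *m kappa k (spin_word vs)).
Proof.
elim: vs => [|v vs IH] /=; first by rewrite kappa1 mulmx1 mul1mx scale1r.
move=> /andP[/eqP v1 /IH {}IH]; rewrite kappa_clmul_vec -mulmxA IH -scalemxAr.
rewrite [kappa_vec k v *m (_ *m _)]mulmxA kappa_vec_reflect // mulNmx scalerN exprS mulN1r scaleNr.
by rewrite mulmxA.
Qed.

Lemma ctr_mul p (X Y : 'M[R[i]]_p) : ctr (X *m Y) = ctr Y *m ctr X.
Proof. by rewrite map_mxM trmx_mul. Qed.

Lemma ctrZ p (t : R) (X : 'M[R[i]]_p) : ctr (t%:C *: X) = t%:C *: ctr X.
Proof.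
apply/matrixP => a b; rewrite !mxE rmorphM; congr (_ * _); exact: conjc_real.
Qed.

Lemma kappa_vec_skew x : ctr (kappa_vec k x) = - kappa_vec k x.
Proof.
rewrite /kappa_vec -sumrN map_mx_sum raddf_sum; apply: eq_bigr => i _ /=.
by have [_ E _] := k_rep; rewrite ctrZ E scalerN.
Qed.

(** A unit vector acts by a skew-Hermitian matrix of square -1, hence unitarily. *)
Lemma kappa_spin_word_unitary vs : all (fun v : 'rV[R]_n => \sum_i (v 0 i) ^+ 2 == 1) vs ->
  ctr (kappa k (spin_word vs)) *m kappa k (spin_word vs) = 1%:M.
Proof.
elim: vs => [|v vs IH] /=.
  by rewrite kappa1 mulmx1 map_scalar_mx rmorph1 tr_scalar_mx.
move=> /andP[/eqP v1 /IH {}IH]; rewrite kappa_clmul_vec ctr_mul kappa_vec_skew.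
rewrite mulmxA -[_ *m _ *m kappa_vec k v]mulmxA mulNmx kappa_vec_sqr //.
by rewrite -raddfN opprK mulmx1.
Qed.

Lemma kappa_spin_unitary a : Spin R n a -> ctr (kappa k a) *m kappa k a = 1%:M.
Proof. by move=> [vs [_ v1 ->]]; apply: kappa_spin_word_unitary. Qed.

Lemma kappa_spin_conj a x : Spin R n a ->
  kappa k a *m kappa_vec k x = kappa_vec k (x *m (spin_cover a)^T) *m kappa k a.
Proof.
move=> [vs [ev v1 ->]]; rewrite -/(spin_word vs).
have H i : kappa k (spin_word vs) *m kappa_vec k (delta_mx 0 i) =
    kappa_vec k (row i (spin_cover (spin_word vs))^T) *m kappa k (spin_word vs).
  rewrite kappa_spin_word // -signr_odd (negPf ev) scale1r; congr (kappa_vec k _ *m _).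
  by apply/rowP => j; rewrite !mxE clmul_vec_spin // clvec1.
rewrite [x in LHS]row_sum_delta.
have S (f : 'I_n -> 'rV[R]_n) : kappa_vec k (\sum_i f i) = \sum_i kappa_vec k (f i).
  apply: (big_morph (kappa_vec k) kappa_vecD).
  by rewrite /kappa_vec big1 // => i _; rewrite mxE scale0r.
move: (kappa k (spin_word vs)) H => K H.
rewrite S mulmx_sum_row S mulmx_suml mulmx_sumr; apply: eq_bigr => i _.
by rewrite !kappa_vecZ -scalemxAl -scalemxAr H.
Qed.

End SpinorRepresentation.

(** * Twisted spinors *)

Lemma sum_sym_lt (V : zmodType) (n : nat) (f : 'I_n -> 'I_n -> V) :
  (forall a b, f b a = f a b) -> (forall a, f a a = 0) ->
  \sum_a \sum_b f a b = (\sum_(a < n) \sum_(b < n | (a < b)%N) f a b) *+ 2.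
Proof.
move=> fC faa.
transitivity (\sum_(a < n) (\sum_(b < n | (a < b)%N) f a b + \sum_(b < n | (b < a)%N) f a b)).
  apply: eq_bigr => a _; rewrite (bigID (fun b : 'I_n => (a < b)%N)) /=; congr (_ + _).
  rewrite (bigD1 a) ?ltnn //= faa add0r; apply: eq_bigl => b.
  by rewrite -leqNgt ltn_neqAle andbC.
rewrite big_split /= [X in _ + X](exchange_big_dep predT) //= mulr2n; congr (_ + _).
by apply: eq_bigr => a _; apply: eq_bigr => b _; apply: fC.
Qed.

Section SpinorOperators.
Context {R : realType} {n r m : nat}.
Local Notation C := R[i].
Local Notation Nn := (2 ^ n./2)%N.
Local Notation Nr := (2 ^ r./2)%N.
Local Notation spinor := (spinor R n r m).
Local Notation index := (@spinor_index n r m).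
Local Notation ctr A := ((map_mx conjc A)^T).
Implicit Types (A : 'M[C]_Nn) (B : 'M[C]_Nr) (F : 'I_m -> 'M[C]_Nr) (psi chi : spinor).

Lemma spinorZE (c : C) psi x : (c *: psi) x = c * psi x.
Proof. by rewrite ffunE. Qed.

(** The operator A (x) F_1 (x) ... (x) F_m. [act_left], [act_factor] and [spin_act] are all of this
    form, so composition and adjoints are computed once for all three. *)
Definition tens A F psi : spinor :=
  [ffun x : index => \sum_(y : index) A x.1 y.1 * (\prod_a F a (x.2 a) (y.2 a)) * psi y].

Lemma tensM A F A' F' psi :
  tens A F (tens A' F' psi) = tens (A *m A') (fun a => F a *m F' a) psi.
Proof.
apply/ffunP => x; rewrite !ffunE.
under eq_bigr => y _ do rewrite ffunE mulr_sumr.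
rewrite exchange_big /=; apply: eq_bigr => z _.
under [X in _ = _ * X * _]eq_bigr do rewrite mxE.
rewrite bigA_distr_bigA /= mxE mulr_suml mulr_suml.
rewrite (eq_bigr (fun y : index => (A x.1 y.1 * A' y.1 z.1) *
   (\prod_a (F a (x.2 a) (y.2 a) * F' a (y.2 a) (z.2 a))) * psi z)); last first.
  move=> y _; rewrite big_split /=; ring.
rewrite -(pair_bigA _ (fun i (f : {ffun 'I_m -> 'I_Nr}) => A x.1 i * A' i z.1 *
   (\prod_a (F a (x.2 a) (f a) * F' a (f a) (z.2 a))) * psi z)) /=.
apply: eq_bigr => i _; rewrite mulr_sumr mulr_suml.
by apply: eq_bigr => f _.
Qed.

Lemma tens_linear A F : linear (tens A F).
Proof.
move=> c psi chi; apply/ffunP => x; rewrite !(spinorZE, ffunE) mulr_sumr -big_split /=.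
by apply: eq_bigr => y _; rewrite !(spinorZE, ffunE); ring.
Qed.

Lemma prod_mx1 (f g : {ffun 'I_m -> 'I_Nr}) :
  \prod_a (1%:M : 'M[C]_Nr) (f a) (g a) = (f == g)%:R.
Proof.
case: eqP => [->|fg]; first by rewrite big1 // => a _; rewrite mxE eqxx.
case: (pickP (fun a => f a != g a)) => [a /negPf fga|E].
  by rewrite (bigD1 a) //= mxE fga mul0r.
by case: fg; apply/ffunP => a; have /negbFE/eqP := E a.
Qed.

Lemma spinor_index_sum (G : index -> C) :
  \sum_y G y = \sum_i \sum_(f : {ffun 'I_m -> 'I_Nr}) G (i, f).
Proof. by rewrite pair_bigA; apply: eq_bigr => -[]. Qed.

Lemma act_leftE A psi : act_left A psi = tens A (fun=> 1%:M) psi.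
Proof.
apply/ffunP => x; rewrite !ffunE.
rewrite [RHS]spinor_index_sum /=.
apply: eq_bigr => i _; rewrite (bigD1 x.2) //= prod_mx1 eqxx mulr1 big1 ?addr0 // => f fx.
by rewrite prod_mx1 eq_sym (negPf fx) mulr0 mul0r.
Qed.

Definition only_at (a : 'I_m) B : 'I_m -> 'M[C]_Nr := fun b => if b == a then B else 1%:M.

Lemma act_factorE a B psi : act_factor a B psi = tens 1%:M (only_at a B) psi.
Proof.
apply/ffunP => x; rewrite !ffunE.
rewrite [RHS]spinor_index_sum /=.
rewrite (bigD1 x.1) //= [X in _ + X]big1 ?addr0; last first.
  by move=> i ix; rewrite big1 // => f _; rewrite mxE eq_sym (negPf ix) !mul0r.
(* Group the families by their value j at a. The entries of the identity matrices leave a single one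
   in each group: x.2 with its value at a replaced by j. *)
rewrite (partition_big (fun f : {ffun 'I_m -> 'I_Nr} => f a) predT) //=.
apply: eq_bigr => j _.
pose g : {ffun 'I_m -> 'I_Nr} := [ffun b => if b == a then j else x.2 b].
have ga : g a = j by rewrite ffunE eqxx.
rewrite (bigD1 g) ?ga //= mxE eqxx mul1r [X in _ = _ + X]big1 ?addr0.
  congr (_ * _); rewrite (bigD1 a) //= /only_at eqxx ga big1 ?mulr1 // => b /negPf ba.
  by rewrite ba ffunE ba mxE eqxx.
move=> f /andP[/eqP fa fg]; rewrite mul1r.
case: (pickP (fun b => f b != g b)) => [b fgb|E]; last first.
  by case/eqP: fg; apply/ffunP => b; have /negbFE/eqP := E b.
have ba : b != a by apply: contraNneq fgb => ->; rewrite fa ga.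
rewrite (bigD1 b) //= {1}/only_at (negPf ba) mxE eq_sym.
by move: fgb; rewrite ffunE (negPf ba) => /negPf ->; rewrite !mul0r.
Qed.

(* kappa^m_{r*}: [kappa_star u w] is [dop (kappa_vec u *m kappa_vec w)]. *)
Definition dop B psi : spinor := \sum_a act_factor a B psi.

Lemma tens_eq A F F' psi : (forall a, F a = F' a) -> tens A F psi = tens A F' psi.
Proof.
by move=> E; apply/ffunP => x; rewrite !ffunE; apply: eq_bigr => y _; under eq_bigr do rewrite E.
Qed.

Lemma tens1 psi : tens 1%:M (fun=> 1%:M) psi = psi.
Proof.
apply/ffunP => x; rewrite ffunE (bigD1 x) //= [X in _ + X]big1 ?addr0.
  by rewrite prod_mx1 mxE !eqxx !mul1r.
move=> [y1 y2] yx; rewrite prod_mx1 mxE /=.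
have [E1|] := eqVneq x.1 y1; last by rewrite !mul0r.
have [E2|] := eqVneq x.2 y2; last by rewrite mulr0 mul0r.
by case/eqP: yx; rewrite -E1 -E2; case: (x).
Qed.

Lemma act_leftM A A' psi : act_left A (act_left A' psi) = act_left (A *m A') psi.
Proof. by rewrite !act_leftE tensM; apply: tens_eq => a; rewrite mul1mx. Qed.

Lemma act_left1 psi : act_left 1%:M psi = psi.
Proof. by rewrite act_leftE tens1. Qed.

Lemma act_left_linear A : linear (act_left A : spinor -> spinor).
Proof. by move=> c psi chi; rewrite !act_leftE tens_linear. Qed.

Lemma act_leftDl A A' psi : act_left (A + A') psi = act_left A psi + act_left A' psi.
Proof.
by apply/ffunP => x; rewrite !ffunE -big_split; apply: eq_bigr => i _; rewrite mxE mulrDl.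
Qed.

Lemma act_leftZl c A psi : act_left (c *: A) psi = c *: act_left A psi.
Proof.
by apply/ffunP => x; rewrite !(spinorZE, ffunE) mulr_sumr;
  apply: eq_bigr => i _; rewrite mxE mulrA.
Qed.

Lemma act_factor_linear a B : linear (act_factor a B : spinor -> spinor).
Proof. by move=> c psi chi; rewrite !act_factorE tens_linear. Qed.

Lemma act_factorDl a B B' psi : act_factor a (B + B') psi = act_factor a B psi + act_factor a B' psi.
Proof.
by apply/ffunP => x; rewrite !ffunE -big_split; apply: eq_bigr => i _; rewrite mxE mulrDl.
Qed.

Lemma act_factorZl a c B psi : act_factor a (c *: B) psi = c *: act_factor a B psi.
Proof.
by apply/ffunP => x; rewrite !(spinorZE, ffunE) mulr_sumr;
  apply: eq_bigr => i _; rewrite mxE mulrA.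
Qed.

Lemma act_factorM a B B' psi : act_factor a B (act_factor a B' psi) = act_factor a (B *m B') psi.
Proof.
rewrite !act_factorE tensM mul1mx; apply: tens_eq => b; rewrite /only_at.
by case: eqP; rewrite ?mul1mx.
Qed.

Lemma act_factorC a b B B' psi : a != b ->
  act_factor a B (act_factor b B' psi) = act_factor b B' (act_factor a B psi).
Proof.
move=> ab; rewrite !act_factorE !tensM !mul1mx; apply: tens_eq => d; rewrite /only_at.
have [->|_] := eqVneq d a; last by rewrite mul1mx mulmx1.
by rewrite (negPf ab) mul1mx mulmx1.
Qed.

Lemma act_left_factor a A B psi :
  act_left A (act_factor a B psi) = act_factor a B (act_left A psi).
Proof.
rewrite !act_factorE !act_leftE !tensM mul1mx mulmx1; apply: tens_eq => d.
by rewrite mul1mx mulmx1.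
Qed.

Section LinearOperator.
Context (L : spinor -> spinor) (lin : linear L).

Lemma lin_opD psi chi : L (psi + chi) = L psi + L chi.
Proof. by have := lin 1 psi chi; rewrite !scale1r. Qed.

Lemma lin_op0 : L 0 = 0.
Proof. by apply: (@addrI _ (L 0)); rewrite -lin_opD !addr0. Qed.

Lemma lin_opZ c psi : L (c *: psi) = c *: L psi.
Proof. by have := lin c psi 0; rewrite lin_op0 !addr0. Qed.

Lemma lin_opN psi : L (- psi) = - L psi.
Proof. by rewrite -scaleN1r lin_opZ scaleN1r. Qed.

Lemma lin_op_sum (I : Type) (s : seq I) (P : pred I) (f : I -> spinor) :
  L (\sum_(i <- s | P i) f i) = \sum_(i <- s | P i) L (f i).
Proof. exact: (big_morph L lin_opD lin_op0). Qed.

End LinearOperator.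

Lemma dop_linear B : linear (dop B).
Proof.
move=> c psi chi; rewrite /dop scaler_sumr -big_split; apply: eq_bigr => a _.
exact: act_factor_linear.
Qed.

Lemma dopDl B B' psi : dop (B + B') psi = dop B psi + dop B' psi.
Proof. by rewrite /dop -big_split; apply: eq_bigr => a _; rewrite act_factorDl. Qed.

Lemma dopZl c B psi : dop (c *: B) psi = c *: dop B psi.
Proof. by rewrite /dop scaler_sumr; apply: eq_bigr => a _; rewrite act_factorZl. Qed.

Lemma act_leftNl A psi : act_left (- A) psi = - act_left A psi.
Proof. by rewrite -scaleN1r act_leftZl scaleN1r. Qed.

Lemma act_left_suml (I : Type) (s : seq I) (P : pred I) (f : I -> 'M[C]_Nn) psi :
  act_left (\sum_(i <- s | P i) f i) psi = \sum_(i <- s | P i) act_left (f i) psi.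
Proof.
apply: (big_morph (fun A => act_left A psi)) => [A A'|]; first exact: act_leftDl.
by have := act_leftZl 0 0 psi; rewrite !scale0r.
Qed.

Lemma dopNl B psi : dop (- B) psi = - dop B psi.
Proof. by rewrite -scaleN1r dopZl scaleN1r. Qed.

Lemma dop_suml (I : Type) (s : seq I) (P : pred I) (f : I -> 'M[C]_Nr) psi :
  dop (\sum_(i <- s | P i) f i) psi = \sum_(i <- s | P i) dop (f i) psi.
Proof.
have z : dop 0 psi = 0 by have := dopZl 0 0 psi; rewrite !scale0r.
elim: s => [|i s IH]; first by rewrite !big_nil.
by rewrite !big_cons; case: (P i) => //; rewrite dopDl IH.
Qed.

(** Operators on distinct factors commute, so the off-diagonal terms of the two double sums agree
    and one commutator per factor remains. *)
Lemma dop_comm B B' psi : dop B (dop B' psi) - dop B' (dop B psi) = dop (B *m B' - B' *m B) psi.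
Proof.
have E X Y : dop X (dop Y psi) = \sum_a (act_factor a (X *m Y) psi
    + \sum_(b | b != a) act_factor a X (act_factor b Y psi)).
  apply: eq_bigr => a _; rewrite /dop (lin_op_sum (act_factor_linear a X)).
  by rewrite (bigD1 a) //= act_factorM.
rewrite !E !big_split /= opprD addrACA.
rewrite [X in _ + (_ - X)](exchange_big_dep predT) //=.
rewrite [X in _ + (X - _)](eq_bigr (fun a => \sum_(b | a != b)
    act_factor b B' (act_factor a B psi))); last first.
  move=> a _; rewrite (eq_bigl (fun b => a != b)); last by move=> b; rewrite eq_sym.
  by apply: eq_bigr => b ab; rewrite act_factorC.
rewrite subrr addr0 -sumrB /dop; apply: eq_bigr => a _.
by rewrite act_factorDl -[in RHS]scaleN1r act_factorZl scaleN1r.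
Qed.

Lemma act_left_dop A B psi : act_left A (dop B psi) = dop B (act_left A psi).
Proof.
rewrite /dop (lin_op_sum (act_left_linear A)); apply: eq_bigr => a _.
exact: act_left_factor.
Qed.

Lemma hermDl psi psi' chi : herm (psi + psi') chi = herm psi chi + herm psi' chi.
Proof. by rewrite /herm -big_split; apply: eq_bigr => x _; rewrite ffunE mulrDl. Qed.

Lemma hermZl c psi chi : herm (c *: psi) chi = c * herm psi chi.
Proof.
by rewrite /herm mulr_sumr; apply: eq_bigr => x _; rewrite spinorZE mulrA.
Qed.

Lemma herm_conj psi chi : herm psi chi = conjc (herm chi psi).
Proof.
rewrite /herm rmorph_sum; apply: eq_bigr => x _; rewrite rmorphM /=.
by rewrite [X in _ = _ * X]conjcK mulrC.
Qed.

Lemma Re_herm_sym psi chi : complex.Re (herm psi chi) = complex.Re (herm chi psi).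
Proof. by rewrite herm_conj; case: (herm chi psi). Qed.

Lemma hermNl psi chi : herm (- psi) chi = - herm psi chi.
Proof. by rewrite -scaleN1r hermZl mulN1r. Qed.

Lemma hermNr psi chi : herm psi (- chi) = - herm psi chi.
Proof. by rewrite [LHS]herm_conj hermNl [in RHS]herm_conj; exact: rmorphN. Qed.

Lemma herm0l chi : herm 0 chi = 0.
Proof. by have := hermZl 0 0 chi; rewrite scale0r mul0r. Qed.

Lemma herm_suml (I : Type) (s : seq I) (P : pred I) (f : I -> spinor) chi :
  herm (\sum_(i <- s | P i) f i) chi = \sum_(i <- s | P i) herm (f i) chi.
Proof. by apply: (big_morph (fun p => herm p chi)) => [p p'|]; [apply: hermDl|apply: herm0l]. Qed.

Lemma herm_sumr (I : Type) (s : seq I) (P : pred I) (f : I -> spinor) chi :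
  herm chi (\sum_(i <- s | P i) f i) = \sum_(i <- s | P i) herm chi (f i).
Proof.
rewrite herm_conj herm_suml rmorph_sum; apply: eq_bigr => i _.
by rewrite /= -herm_conj.
Qed.

Lemma herm_tens A F psi chi :
  herm (tens A F psi) chi = herm psi (tens (ctr A) (fun a => ctr (F a)) chi).
Proof.
rewrite /herm; under eq_bigr do rewrite ffunE mulr_suml.
rewrite exchange_big /=; apply: eq_bigr => y _; rewrite ffunE rmorph_sum mulr_sumr.
apply: eq_bigr => x _; rewrite !rmorphM rmorph_prod /= !mxE /= [X in _ = _ * (X * _ * _)]conjcK.
rewrite [X in _ = _ * (_ * X * _)](eq_bigr (fun a => F a (x.2 a) (y.2 a))); last first.
  by move=> a _; rewrite !mxE; exact: conjcK.
by ring.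
Qed.

Lemma ctr1 p : ctr (1%:M : 'M[C]_p) = 1%:M.
Proof. by rewrite map_scalar_mx rmorph1 tr_scalar_mx. Qed.

Lemma herm_act_left A psi chi : herm (act_left A psi) chi = herm psi (act_left (ctr A) chi).
Proof.
by rewrite !act_leftE herm_tens; congr herm; apply: tens_eq => a; rewrite ctr1.
Qed.

Lemma herm_dop B psi chi : herm (dop B psi) chi = herm psi (dop (ctr B) chi).
Proof.
rewrite herm_suml herm_sumr; apply: eq_bigr => a _.
rewrite !act_factorE herm_tens ctr1; congr herm; apply: tens_eq => b.
by rewrite /only_at; case: eqP => _ //; rewrite ctr1.
Qed.

Lemma skew_Re_herm (L : spinor -> spinor) psi :
  herm (L psi) psi = - herm psi (L psi) -> complex.Re (herm (L psi) psi) = 0.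
Proof.
move=> E; have S := Re_herm_sym (L psi) psi.
have T : complex.Re (herm (L psi) psi) = - complex.Re (herm psi (L psi)).
  by rewrite E; case: (herm psi (L psi)).
by rewrite -S in T; lra.
Qed.

End SpinorOperators.

(* The lift so(n) -> spin(n), sum_(a<b) W_ab E_ab |-> 1/2 sum_(a<b) W_ab e_a e_b,
   see [spin_lie_lt]; locked for the same reason as [pd]. *)
Fact spin_lie_key : unit. Proof. by []. Qed.

(** * The Lie algebra of the spin group *)

Section SpinLieAlgebra.
Context {R : realType} {n : nat} (k : spin_rep R n) (k_rep : is_spin_rep k).
Local Notation ctr A := ((map_mx conjc A)^T).
Implicit Types (V W : 'M[R]_n) (x : 'rV[R]_n).

Definition spin_lie := locked_with spin_lie_key
  (fun W => 4^-1 *: \sum_a \sum_b (W a b)%:C *: (k a *m k b)).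
Local Notation S := spin_lie.

Lemma spin_lieE W : S W = 4^-1 *: \sum_a \sum_b (W a b)%:C *: (k a *m k b).
Proof. by rewrite /spin_lie unlock. Qed.

Lemma spin_lieD V W : S (V + W) = S V + S W.
Proof.
rewrite !spin_lieE -scalerDr; congr (_ *: _); rewrite -big_split; apply: eq_bigr => a _.
by rewrite -big_split; apply: eq_bigr => b _; rewrite mxE rmorphD scalerDl.
Qed.

Lemma spin_lieZ t W : S (t *: W) = t%:C *: S W.
Proof.
rewrite !spin_lieE scalerA mulrC -scalerA; congr (_ *: _); rewrite scaler_sumr; apply: eq_bigr => a _.
by rewrite scaler_sumr; apply: eq_bigr => b _; rewrite mxE rmorphM scalerA.
Qed.

Lemma spin_lieN W : S (- W) = - S W.
Proof. by rewrite -scaleN1r spin_lieZ rmorphN1 scaleN1r. Qed.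

Lemma spin_rep_comm3 a b c : k a *m k b *m k c - k c *m (k a *m k b) =
  (if a == c then 2 else 0) *: k b - (if b == c then 2 else 0) *: k a.
Proof.
have A i j : k i *m k j = - (k j *m k i) - (if i == j then 2 else 0) *: 1%:M.
  rewrite (spin_rep_anticomm k_rep) -scalemx1; congr (_ - _ *: _).
  by case: eqP => _ //=; rewrite mul0rn.
have H1 : k a *m k b *m k c = - (k a *m k c *m k b) - (if b == c then 2 else 0) *: k a.
  by rewrite -mulmxA (A b c) mulmxBr mulmxN -scalemxAr mulmx1 mulmxA.
have H2 : k a *m k c *m k b = - (k c *m (k a *m k b)) - (if a == c then 2 else 0) *: k b.
  by rewrite (A a c) mulmxBl mulNmx -scalemxAl mul1mx mulmxA.
rewrite H1 H2; move: (k c *m _) (_ *: _) (_ *: _) => X Y Z.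
by rewrite opprB opprK addrAC addrK.
Qed.

(** This is the differential of the double cover. Each Kronecker term of [spin_rep_comm3]
    contributes twice row c of W, the second one thanks to antisymmetry, and the factor 1/4 of the
    lift compensates for the total of 4. *)
Lemma spin_lie_comm_gen W c : W^T = - W ->
  S W *m k c - k c *m S W = kappa_vec k (row c W).
Proof.
move=> WT; have Wba a b : W b a = - W a b by have /matrixP/(_ a b) := WT; rewrite !mxE.
rewrite !spin_lieE -scalemxAl -scalemxAr -scalerBr mulmx_suml mulmx_sumr -sumrB.
transitivity (4^-1 *: \sum_a \sum_b (W a b)%:C *:
   ((if a == c then 2 else 0) *: k b - (if b == c then 2 else 0) *: k a)).
  congr (_ *: _); apply: eq_bigr => a _; rewrite mulmx_suml mulmx_sumr -sumrB.
  by apply: eq_bigr => b _; rewrite -scalemxAl -scalemxAr -scalerBr spin_rep_comm3.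
under eq_bigr do under eq_bigr do rewrite scalerBr.
under eq_bigr do rewrite sumrB.
rewrite sumrB.
have -> : \sum_a \sum_b (W a b)%:C *: ((if a == c then 2 else 0) *: k b) =
    2 *: kappa_vec k (row c W).
  rewrite (bigD1 c) //= eqxx [X in _ + X]big1 ?addr0; last first.
    by move=> a /negPf ->; rewrite big1 // => b _; rewrite scale0r scaler0.
  rewrite /kappa_vec scaler_sumr; apply: eq_bigr => b _; rewrite mxE !scalerA; congr (_ *: _).
  by rewrite mulrC.
have -> : \sum_a \sum_b (W a b)%:C *: ((if b == c then 2 else 0) *: k a) =
    - (2 *: kappa_vec k (row c W)).
  rewrite /kappa_vec scaler_sumr -sumrN; apply: eq_bigr => a _.
  rewrite (bigD1 c) //= eqxx [X in _ + X]big1 ?addr0; last first.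
    by move=> b /negPf ->; rewrite scale0r scaler0.
  by rewrite mxE Wba rmorphN scaleNr !scalerA mulrC.
rewrite opprK -scalerDl scalerA [X in X *: _](_ : _ = 1) ?scale1r //.
by rewrite -natrD mulVf // pnatr_eq0.
Qed.

Lemma spin_lie_comm_vec W x : W^T = - W ->
  S W *m kappa_vec k x - kappa_vec k x *m S W = kappa_vec k (x *m W).
Proof.
move=> WT.
have Sm (f : 'I_n -> 'rV[R]_n) : kappa_vec k (\sum_i f i) = \sum_i kappa_vec k (f i).
  apply: (big_morph (kappa_vec k) (kappa_vecD k)).
  by rewrite /kappa_vec big1 // => i _; rewrite mxE scale0r.
rewrite mulmx_sum_row Sm {1 2}/kappa_vec mulmx_sumr mulmx_suml -sumrB.
apply: eq_bigr => c _; rewrite -scalemxAl -scalemxAr -scalerBr spin_lie_comm_gen //.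
by rewrite kappa_vecZ.
Qed.

(** Matrices act on row vectors, which reverses composition: the lift is an antihomomorphism for the
    commutator of matrices. *)
Lemma spin_lie_comm V W : V^T = - V -> W^T = - W ->
  S V *m S W - S W *m S V = S (W *m V - V *m W).
Proof.
move=> VT WT; have Vba a b : V b a = - V a b by have /matrixP/(_ a b) := VT; rewrite !mxE.
(* The commutator with S V is a derivation, so on k_a k_b it is determined by its value on
   generators. *)
have H a b : S V *m (k a *m k b) - (k a *m k b) *m S V =
    \sum_c ((V a c)%:C *: (k c *m k b) + (V b c)%:C *: (k a *m k c)).
  rewrite (_ : _ - _ = (S V *m k a - k a *m S V) *m k b + k a *m (S V *m k b - k b *m S V)).
    rewrite !spin_lie_comm_gen // /kappa_vec mulmx_suml mulmx_sumr -big_split /=.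
    by apply: eq_bigr => c _; rewrite !mxE -scalemxAl -scalemxAr.
  by rewrite mulmxBl mulmxBr !mulmxA subrKA.
have E1 : \sum_a \sum_b \sum_c (W a b)%:C *: ((V a c)%:C *: (k c *m k b)) =
    \sum_c \sum_b (- (V *m W) c b)%:C *: (k c *m k b).
  under eq_bigr do rewrite exchange_big.
  rewrite exchange_big; apply: eq_bigr => c _ /=; rewrite exchange_big; apply: eq_bigr => b _ /=.
  rewrite mxE -sumrN rmorph_sum scaler_suml; apply: eq_bigr => a _.
  by rewrite scalerA -rmorphM /= (Vba c a) mulrN mulrC.
have E2 : \sum_a \sum_b \sum_c (W a b)%:C *: ((V b c)%:C *: (k a *m k c)) =
    \sum_a \sum_c ((W *m V) a c)%:C *: (k a *m k c).
  apply: eq_bigr => a _; rewrite exchange_big; apply: eq_bigr => c _ /=.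
  rewrite mxE rmorph_sum scaler_suml; apply: eq_bigr => b _.
  by rewrite scalerA -rmorphM.
move: (S V) H => SV H.
rewrite !(spin_lieE W) -scalemxAl -scalemxAr -scalerBr mulmx_suml mulmx_sumr -sumrB.
transitivity (4^-1 *: (\sum_a \sum_b \sum_c (W a b)%:C *: ((V a c)%:C *: (k c *m k b))
   + \sum_a \sum_b \sum_c (W a b)%:C *: ((V b c)%:C *: (k a *m k c)))).
  congr (_ *: _); rewrite -big_split; apply: eq_bigr => a _ /=.
  rewrite mulmx_suml mulmx_sumr -sumrB -big_split; apply: eq_bigr => b _ /=.
  rewrite -scalemxAl -scalemxAr -scalerBr H scaler_sumr -big_split /=.
  by apply: eq_bigr => c _; rewrite scalerDr.
rewrite [RHS]spin_lieE; congr (_ *: _).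
apply: etrans (congr2 +%R E1 E2) _.
rewrite addrC -big_split; apply: eq_bigr => a _ /=; rewrite -big_split; apply: eq_bigr => b _ /=.
have -> : (W *m V - V *m W) a b = (W *m V) a b - (V *m W) a b.
  by move: (W *m V) (V *m W) => X Y; rewrite !mxE.
by rewrite -scalerDl -rmorphD.
Qed.

Lemma spin_lie_skew W : W^T = - W -> ctr (S W) = - S W.
Proof.
move=> WT; have Wba a b : W b a = - W a b by have /matrixP/(_ a b) := WT; rewrite !mxE.
have E4 : (4^-1 : R[i]) = (4^-1 : R)%:C by rewrite fmorphV rmorph_nat.
have [_ kS _] := k_rep.
rewrite !spin_lieE E4 ctrZ -scalerN; congr (_ *: _).
have ctr_sum (f : 'I_n -> 'M[R[i]]_(2 ^ n./2)) : ctr (\sum_i f i) = \sum_i ctr (f i).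
  by rewrite map_mx_sum raddf_sum.
rewrite ctr_sum exchange_big -sumrN; apply: eq_bigr => a _ /=.
rewrite ctr_sum -sumrN; apply: eq_bigr => b _ /=.
by rewrite ctrZ ctr_mul !kS mulNmx mulmxN opprK (Wba a b) rmorphN scaleNr opprK.
Qed.

(** Exchanging a and b changes the sign of both W_ab and k_a k_b for a != b, so ordered pairs count
    everything twice. This reconciles the 1/4 of [spin_lie] with the 1/2 of [spinor_nabla]. *)
Lemma spin_lie_lt W : W^T = - W ->
  2^-1 *: \sum_(a < n) \sum_(b < n | (a < b)%N) (W a b)%:C *: (k a *m k b) = S W.
Proof.
move=> WT; have Wba a b : W b a = - W a b by have /matrixP/(_ a b) := WT; rewrite !mxE.
have Waa a : W a a = 0 by have := Wba a a; lra.
pose f (a b : 'I_n) := (W a b)%:C *: (k a *m k b).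
have fC a b : f b a = f a b.
  rewrite /f; have [->|/negPf ab] := eqVneq a b; first by [].
  by rewrite (spin_rep_anticomm k_rep b a) eq_sym ab mul0rn raddf0 subr0 Wba rmorphN scaleNr scalerN opprK.
rewrite spin_lieE -/f.
rewrite (sum_sym_lt fC); last by move=> a; rewrite /f Waa scale0r.
move: (\sum_(a < n) _) => v; rewrite -(@scaler_nat R[i] _ 2 v) scalerA; congr (_ *: _).
by rewrite (_ : 4 = 2 * 2) ?invfM ?mulfVK ?pnatr_eq0 // -natrM.
Qed.

End SpinLieAlgebra.

(** * Partial derivatives of spinor fields *)

Section SpinorCalculus.
Context {R : realType} {n r m : nat} {M : manifold R n}.
Local Notation C := R[i].
Local Notation spinor := (spinor R n r m).
Local Notation index := (@spinor_index n r m).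
Context (c : chart M) (U : set M) (oU : open U) (Uc : U `<=` cdom c).
Implicit Types (Psi Phi : M -> spinor) (f : M -> R) (q : M) (i j : 'I_n).
Local Notation "'d_ i" := (pd c (delta_mx 0 i)) (at level 10, i at level 8).

Definition smooth_spinor Psi : Prop := forall x : index,
  smooth_on U (fun p => complex.Re (Psi p x)) /\ smooth_on U (fun p => complex.Im (Psi p x)).

Definition spd i Psi q : spinor := [ffun x : index =>
  'd_i (fun p => complex.Re (Psi p x)) q +i* 'd_i (fun p => complex.Im (Psi p x)) q].

Lemma spd_congr i Psi Phi q : U q -> (forall p, U p -> Psi p = Phi p) ->
  spd i Psi q = spd i Phi q.
Proof.
move=> Uq E; apply/ffunP => x; rewrite !ffunE; congr (_ +i* _);
  by apply: (pd_congr _ oU Uq (Uc Uq)) => p Up _; rewrite E.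
Qed.

Lemma smooth_spinor_congr Psi Phi : (forall p, U p -> Psi p = Phi p) ->
  smooth_spinor Psi -> smooth_spinor Phi.
Proof.
move=> E sP x; have [s1 s2] := sP x.
by split; [apply: smooth_on_congr s1|apply: smooth_on_congr s2] => // p Up; rewrite E.
Qed.

Lemma spd_Re i Psi x :
  (fun p => complex.Re (spd i Psi p x)) = 'd_i (fun p => complex.Re (Psi p x)).
Proof. by apply/funext => p; rewrite ffunE. Qed.

Lemma spd_Im i Psi x :
  (fun p => complex.Im (spd i Psi p x)) = 'd_i (fun p => complex.Im (Psi p x)).
Proof. by apply/funext => p; rewrite ffunE. Qed.

Lemma spd_comm i j Psi q : smooth_spinor Psi -> U q ->
  spd i (spd j Psi) q = spd j (spd i Psi) q.
Proof.
move=> sP Uq; apply/ffunP => x; rewrite !ffunE; have [s1 s2] := sP x.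
congr (_ +i* _); rewrite ?spd_Re ?spd_Im; exact: (pd_comm oU Uq (Uc Uq)).
Qed.

Lemma cReD (x y : C) : complex.Re (x + y) = complex.Re x + complex.Re y.
Proof. by case: x; case: y. Qed.
Lemma cImD (x y : C) : complex.Im (x + y) = complex.Im x + complex.Im y.
Proof. by case: x; case: y. Qed.
Lemma cReM (x y : C) : complex.Re (x * y) =
  complex.Re x * complex.Re y - complex.Im x * complex.Im y.
Proof. by case: x; case: y. Qed.
Lemma cImM (x y : C) : complex.Im (x * y) =
  complex.Re x * complex.Im y + complex.Im x * complex.Re y.
Proof. by case: x; case: y. Qed.
Lemma cRe_sum (I : Type) (s : seq I) (P : pred I) (F : I -> C) :
  complex.Re (\sum_(k <- s | P k) F k) = \sum_(k <- s | P k) complex.Re (F k).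
Proof. exact: (big_morph (@complex.Re R) cReD). Qed.
Lemma cIm_sum (I : Type) (s : seq I) (P : pred I) (F : I -> C) :
  complex.Im (\sum_(k <- s | P k) F k) = \sum_(k <- s | P k) complex.Im (F k).
Proof. exact: (big_morph (@complex.Im R) cImD). Qed.

Lemma smooth_spinor_add Psi Phi : smooth_spinor Psi -> smooth_spinor Phi ->
  smooth_spinor (fun p => Psi p + Phi p).
Proof.
move=> sP sF x; have [s1 s2] := sP x; have [t1 t2] := sF x; split.
  by apply: smooth_on_congr (smooth_on_add oU s1 t1) => // p _; rewrite ffunE cReD.
by apply: smooth_on_congr (smooth_on_add oU s2 t2) => // p _; rewrite ffunE cImD.
Qed.

Lemma smooth_spinor0 : smooth_spinor (fun=> 0).
Proof.
move=> x; split; apply: smooth_on_congr (smooth_on_cst U 0) => // p _; rewrite ffunE //.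
Qed.

Lemma smooth_spinor_scale f Psi : smooth_on U f -> smooth_spinor Psi ->
  smooth_spinor (fun p => (f p)%:C *: Psi p).
Proof.
move=> sf sP x; have [s1 s2] := sP x; split.
  apply: smooth_on_congr (smooth_on_mul oU sf s1) => // p _.
  by rewrite spinorZE cReM /= mul0r subr0.
apply: smooth_on_congr (smooth_on_mul oU sf s2) => // p _.
by rewrite spinorZE cImM /= mul0r addr0.
Qed.

Lemma smooth_spinor_sum (I : Type) (s : seq I) (F : I -> M -> spinor) :
  (forall k, smooth_spinor (F k)) -> smooth_spinor (fun p => \sum_(k <- s) F k p).
Proof.
move=> sF; elim: s => [|k s IH].
  by apply: smooth_spinor_congr smooth_spinor0 => p _; rewrite big_nil.
by apply: smooth_spinor_congr (smooth_spinor_add (sF k) IH) => p _; rewrite big_cons.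
Qed.

Section At.
Context (q : M) (Uq : U q).

Lemma spd_add i Psi Phi : smooth_spinor Psi -> smooth_spinor Phi ->
  spd i (fun p => Psi p + Phi p) q = spd i Psi q + spd i Phi q.
Proof.
move=> sP sF; apply/ffunP => x; rewrite !ffunE; have [s1 s2] := sP x; have [t1 t2] := sF x.
rewrite -[RHS]/((_ + _) +i* (_ + _)) -!(pd_add oU Uq (Uc Uq)) //.
by congr (_ +i* _); congr pd; apply/funext => p; rewrite ffunE ?cReD ?cImD.
Qed.

Lemma spd_scale i f Psi : smooth_on U f -> smooth_spinor Psi ->
  spd i (fun p => (f p)%:C *: Psi p) q = ('d_i f q)%:C *: Psi q + (f q)%:C *: spd i Psi q.
Proof.
move=> sf sP; apply/ffunP => x; have [s1 s2] := sP x.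
rewrite ffunE [RHS]ffunE !spinorZE ffunE.
have -> : 'd_i (fun p => complex.Re (((f p)%:C *: Psi p) x)) q =
    'd_i (fun p => f p * complex.Re (Psi p x)) q.
  by congr pd; apply/funext => p; rewrite spinorZE cReM /= mul0r subr0.
have -> : 'd_i (fun p => complex.Im (((f p)%:C *: Psi p) x)) q =
    'd_i (fun p => f p * complex.Im (Psi p x)) q.
  by congr pd; apply/funext => p; rewrite spinorZE cImM /= mul0r addr0.
rewrite !(pd_mul oU Uq (Uc Uq)) //; case: (Psi q x) => a b.
by apply/eqP; rewrite eq_complex /=; apply/andP; split; apply/eqP; ring.
Qed.

Lemma spd_sum (I : Type) (s : seq I) i (F : I -> M -> spinor) :
  (forall k, smooth_spinor (F k)) ->
  spd i (fun p => \sum_(k <- s) F k p) q = \sum_(k <- s) spd i (F k) q.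
Proof.
move=> sF; elim: s => [|k s IH].
  rewrite big_nil; apply/ffunP => x; rewrite !ffunE.
  rewrite (_ : (fun p => complex.Re _) = fun=> 0); last by apply/funext => p; rewrite big_nil ffunE.
  rewrite (_ : (fun p => complex.Im _) = fun=> 0); last by apply/funext => p; rewrite big_nil ffunE.
  by rewrite pd_cst.
rewrite big_cons -IH -spd_add //; last exact: smooth_spinor_sum.
by congr (spd i _ q); apply/funext => p; rewrite big_cons.
Qed.

End At.

Section Linear.
Context (L : spinor -> spinor) (lin : linear L).

Let e (y : index) : spinor := [ffun z => (z == y)%:R].
Let K (x y : index) : C := L (e y) x.

(** [spd] differentiates real and imaginary parts componentwise. The matrix of L in the standard
    basis shows that these parts of L psi are constant real combinations of those of psi. *)
Lemma lin_op_kernel psi x : L psi x = \sum_y K x y * psi y.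
Proof.
have {1}-> : psi = \sum_y psi y *: e y.
  apply/ffunP => z; rewrite sum_ffunE (bigD1 z) //= spinorZE ffunE eqxx mulr1.
  by rewrite big1 ?addr0 // => y yz; rewrite spinorZE ffunE eq_sym (negPf yz) mulr0.
rewrite (lin_op_sum lin) sum_ffunE; apply: eq_bigr => y _.
by rewrite (lin_opZ lin) spinorZE mulrC.
Qed.

Lemma lin_op_Re psi x : complex.Re (L psi x) = \sum_y
  (complex.Re (K x y) * complex.Re (psi y) + (- complex.Im (K x y)) * complex.Im (psi y)).
Proof. by rewrite lin_op_kernel cRe_sum; apply: eq_bigr => y _; rewrite cReM mulNr. Qed.

Lemma lin_op_Im psi x : complex.Im (L psi x) = \sum_y
  (complex.Re (K x y) * complex.Im (psi y) + complex.Im (K x y) * complex.Re (psi y)).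
Proof. by rewrite lin_op_kernel cIm_sum; apply: eq_bigr => y _; rewrite cImM. Qed.

Let sZ (t : R) f : smooth_on U f -> smooth_on U (fun p => t * f p).
Proof. by move=> sf; apply: smooth_on_mul sf => //; apply: smooth_on_cst. Qed.

Let reL Psi x : (fun p => complex.Re (L (Psi p) x)) = (fun p => \sum_y
  (complex.Re (K x y) * complex.Re (Psi p y) + (- complex.Im (K x y)) * complex.Im (Psi p y))).
Proof. by apply/funext => p; rewrite lin_op_Re. Qed.

Let imL Psi x : (fun p => complex.Im (L (Psi p) x)) = (fun p => \sum_y
  (complex.Re (K x y) * complex.Im (Psi p y) + complex.Im (K x y) * complex.Re (Psi p y))).
Proof. by apply/funext => p; rewrite lin_op_Im. Qed.

Lemma smooth_spinor_lin Psi : smooth_spinor Psi -> smooth_spinor (fun p => L (Psi p)).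
Proof.
move=> sP x; rewrite reL imL; split; apply: smooth_on_sum => // y _;
  by have [s1 s2] := sP y; apply: smooth_on_add => //; apply: sZ.
Qed.

Lemma spd_lin i Psi q : smooth_spinor Psi -> U q ->
  spd i (fun p => L (Psi p)) q = L (spd i Psi q).
Proof.
move=> sP Uq.
have pdZ (t : R) f : smooth_on U f -> 'd_i (fun p => t * f p) q = t * 'd_i f q.
  move=> sf; rewrite (pd_mul oU Uq (Uc Uq) _ (smooth_on_cst U t) sf).
  by rewrite pd_cst mul0r add0r.
apply/ffunP => x; rewrite ffunE; apply/eqP; rewrite eq_complex /=.
rewrite lin_op_Re lin_op_Im; apply/andP; split; apply/eqP.
  rewrite reL (pd_sum oU Uq (Uc Uq)); last first.
    by move=> y _; have [s1 s2] := sP y; apply: smooth_on_add => //; apply: sZ.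
  apply: eq_bigr => y _; have [s1 s2] := sP y.
  by rewrite (pd_add oU Uq (Uc Uq)) ?pdZ ?ffunE //; apply: sZ.
rewrite imL (pd_sum oU Uq (Uc Uq)); last first.
  by move=> y _; have [s1 s2] := sP y; apply: smooth_on_add => //; apply: sZ.
apply: eq_bigr => y _; have [s1 s2] := sP y.
by rewrite (pd_add oU Uq (Uc Uq)) ?pdZ ?ffunE //; apply: sZ.
Qed.

End Linear.

(** Leibniz rule for operators depending on the point: Clifford multiplication by a vector field and
    the lift of a connection form are both fixed operators weighted by real functions. *)
Lemma spd_comb (I : finType) i (f : I -> M -> R) (L : I -> spinor -> spinor) Psi q :
  (forall t, linear (L t)) -> (forall t, smooth_on U (f t)) -> smooth_spinor Psi -> U q ->
  smooth_spinor (fun p => \sum_t (f t p)%:C *: L t (Psi p)) /\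
  spd i (fun p => \sum_t (f t p)%:C *: L t (Psi p)) q =
  \sum_t ('d_i (f t) q)%:C *: L t (Psi q) + \sum_t (f t q)%:C *: L t (spd i Psi q).
Proof.
move=> lin sf sP Uq.
have s t : smooth_spinor (fun p => (f t p)%:C *: L t (Psi p)).
  by apply: smooth_spinor_scale => //; apply: smooth_spinor_lin.
split; first exact: smooth_spinor_sum.
rewrite (spd_sum Uq) // -big_split; apply: eq_bigr => t _ /=.
by rewrite (spd_scale Uq) ?spd_lin //; apply: smooth_spinor_lin.
Qed.

End SpinorCalculus.

(** * Curvature of Killing spinors *)

Section SpinCommutators.
Context {R : realType} {n r m : nat}.
Local Notation C := R[i].
Local Notation spinor := (spinor R n r m).

(** The scalar identity behind [commutator_step], which applies it to each component, where [ring]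
    is available. *)
Lemma commutator_arith (K : comPzRingType) (a b c x y g d e f h z s : K) :
  a + b - (d + e) = s - z -> a + b + c + (x + y) + g = d + e + f + (y + x) + h ->
  s + (c - f + (g - h)) = z.
Proof.
move=> E1 E2.
have -> : s = a + b - (d + e) + z by rewrite E1 subrK.
have -> : a + b - (d + e) + z + (c - f + (g - h)) =
  z + ((a + b + c + (x + y) + g) - (d + e + f + (y + x) + h)) by ring.
by rewrite E2 subrr addr0.
Qed.

(** The last premise equates the two mixed second derivatives of psi. Its cross terms, with one
    operator on Delta_n and one on the twist, are symmetric in i and j and drop out, leaving a
    commutator on each side. *)
Lemma commutator_step (S Z Xi Xj Dx Dx' : 'M[C]_(2 ^ n./2)) (T Yi Yj Dy Dy' : 'M[C]_(2 ^ r./2))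
    (t : C) (psi : spinor) :
  Dx + Xi *m Xj - (Dx' + Xj *m Xi) = S - t *: Z ->
  Dy - Dy' + (Yi *m Yj - Yj *m Yi) = T ->
  act_left (Dx + Xi *m Xj) psi + dop Dy psi
    + (act_left Xi (dop Yj psi) + act_left Xj (dop Yi psi)) + dop Yi (dop Yj psi) =
  act_left (Dx' + Xj *m Xi) psi + dop Dy' psi
    + (act_left Xj (dop Yi psi) + act_left Xi (dop Yj psi)) + dop Yj (dop Yi psi) ->
  act_left S psi + dop T psi = t *: act_left Z psi.
Proof.
move=> /(congr1 (fun A => act_left A psi)) SE <-.
rewrite (dopDl (Dy - Dy')) (dopDl Dy) dopNl -dop_comm -act_leftZl.
move: SE; rewrite act_leftDl act_leftNl [X in _ = X -> _]act_leftDl act_leftNl.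
rewrite !(act_leftDl Dx) !(act_leftDl Dx').
move: (act_left S psi) (act_left (_ *: _) psi) (act_left Dx psi) (act_left Dx' psi) => s z a d.
move: (act_left (_ *m _) psi) (act_left (_ *m _) psi) (dop Dy psi) (dop Dy' psi) => b e c f.
move: (act_left Xi (dop Yj psi)) (act_left Xj (dop Yi psi)) (dop Yi (dop Yj psi)) (dop Yj (dop Yi psi)) => x y g h /ffunP E1 /ffunP E2.
apply/ffunP => k; have := E1 k; have := E2 k.
rewrite !ffunE => e2 e1; exact: commutator_arith e1 e2.
Qed.
Lemma spin_lie_curv p (k : spin_rep R p) (k_rep : is_spin_rep k) (P P' A A' : 'M[R]_p) :
  A^T = - A -> A'^T = - A' ->
  spin_lie k (P - P' + (A' *m A - A *m A')) =
  spin_lie k P - spin_lie k P' + (spin_lie k A *m spin_lie k A' - spin_lie k A' *m spin_lie k A).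
Proof.
move=> AT AT'; rewrite (spin_lieD k (P - P')) (spin_lieD k P) spin_lieN.
by rewrite (spin_lie_comm k_rep AT AT').
Qed.

Lemma curvature_commutator (k : spin_rep R r) (k_rep : is_spin_rep k) (P P' A A' : 'M[R]_r) :
  A^T = - A -> A'^T = - A' ->
  - spin_lie k P' - - spin_lie k P + ((- spin_lie k A) *m (- spin_lie k A')
     - (- spin_lie k A') *m (- spin_lie k A)) =
  spin_lie k (P - P' + (A' *m A - A *m A')).
Proof.
move=> AT AT'; rewrite (spin_lie_curv k_rep) //.
move: (spin_lie k P) (spin_lie k P') (spin_lie k A) (spin_lie k A') => p p' s s'.
by rewrite !mulNmx !mulmxN !opprK addrC [- p' + p]addrC addrC.
Qed.

(** Here b, b' are the rows of the coframe for the directions i, j, with mixed derivatives d, d'.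
    The commutators of the lift with vectors turn into b A' and b' A by [spin_lie_comm_vec], so all
    terms of first order in t cancel by the structure equation. What is left is curvature and the
    t^2 term. *)
Lemma killing_commutator (k : spin_rep R n) (k_rep : is_spin_rep k) (t : R) (P P' A A' : 'M[R]_n)
    (b b' d d' : 'rV[R]_n) : A^T = - A -> A'^T = - A' -> d + b *m A' = d' + b' *m A ->
  t%:C *: kappa_vec k d - spin_lie k P'
    + (t%:C *: kappa_vec k b - spin_lie k A) *m (t%:C *: kappa_vec k b' - spin_lie k A')
  - (t%:C *: kappa_vec k d' - spin_lie k P
    + (t%:C *: kappa_vec k b' - spin_lie k A') *m (t%:C *: kappa_vec k b - spin_lie k A)) =
  spin_lie k (P - P' + (A' *m A - A *m A'))
    - (t ^+ 2)%:C *: (kappa_vec k b' *m kappa_vec k b - kappa_vec k b *m kappa_vec k b').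
Proof.
move=> AT AT' tor.
have Kt : kappa_vec k d + kappa_vec k (b *m A') = kappa_vec k d' + kappa_vec k (b' *m A).
  by rewrite -!kappa_vecD tor.
rewrite (spin_lie_curv k_rep) //.
rewrite -(spin_lie_comm_vec k_rep b AT') -(spin_lie_comm_vec k_rep b' AT) in Kt.
rewrite [t ^+ 2]expr2 rmorphM.
move: (kappa_vec k d) (kappa_vec k d') (kappa_vec k b) (kappa_vec k b') Kt => x x' y y' Kt.
move: (spin_lie k P) (spin_lie k P') (spin_lie k A) (spin_lie k A') Kt => p p' s s' Kt.
rewrite !mulmxBl !mulmxBr -!scalemxAl -!scalemxAr !scalerA.
move: (y *m y') (y' *m y) (y *m s') (s' *m y) (s *m y') (y' *m s) (s *m s') (s' *m s) Kt.
move=> m1 m2 m3 m4 m5 m6 m7 m8 /matrixP Kt.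
apply/matrixP => i j; have := Kt i j; rewrite !mxE => /(canRL (addrK _)) ->.
ring.
Qed.

End SpinCommutators.

(** * Integrability condition of the Killing equation *)

Section Integrability.
Context {R : realType} {n r m : nat} {M : manifold R n}.
Local Notation C := R[i].
Local Notation spinor := (spinor R n r m).
Context (kn : spin_rep R n) (kn_rep : is_spin_rep kn).
Context (kr : spin_rep R r) (kr_rep : is_spin_rep kr).
Context (c : chart M) (U : set M) (oU : open U) (Uc : U `<=` cdom c).
Local Notation "'d_ i" := (pd c (delta_mx 0 i)) (at level 10, i at level 8).
Implicit Types (psi : spinor) (i j : 'I_n).

Lemma lin_op_scale (t : C) (L : spinor -> spinor) : linear L -> linear (fun psi => t *: L psi).
Proof. by move=> lin a u v; rewrite lin scalerDr !scalerA mulrC. Qed.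

Lemma act_leftZB (t : C) (A A' : 'M[C]_(2 ^ n./2)) psi :
  act_left (t *: A - A') psi = t *: act_left A psi - act_left A' psi.
Proof. by rewrite act_leftDl act_leftZl act_leftNl. Qed.

Lemma act_left_kappa (x : 'rV[R]_n) psi :
  act_left (kappa_vec kn x) psi = \sum_a (x 0 a)%:C *: act_left (kn a) psi.
Proof. by rewrite /kappa_vec act_left_suml; apply: eq_bigr => a _; rewrite act_leftZl. Qed.

Lemma act_left_spin_lie (W : 'M[R]_n) psi : act_left (spin_lie kn W) psi =
  \sum_(ab : 'I_n * 'I_n) (W ab.1 ab.2)%:C *: (4^-1 *: act_left (kn ab.1 *m kn ab.2) psi).
Proof.
rewrite spin_lieE act_leftZl act_left_suml -(pair_bigA _ (fun a b =>
  (W a b)%:C *: (4^-1 *: act_left (kn a *m kn b) psi))) scaler_sumr; apply: eq_bigr => a _.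
rewrite act_left_suml scaler_sumr; apply: eq_bigr => b _.
by rewrite act_leftZl !scalerA mulrC.
Qed.

Lemma dop_spin_lie (W : 'M[R]_r) psi : dop (spin_lie kr W) psi =
  \sum_(ab : 'I_r * 'I_r) (W ab.1 ab.2)%:C *: (4^-1 *: dop (kr ab.1 *m kr ab.2) psi).
Proof.
rewrite spin_lieE dopZl dop_suml -(pair_bigA _ (fun a b =>
  (W a b)%:C *: (4^-1 *: dop (kr a *m kr b) psi))) scaler_sumr; apply: eq_bigr => a _.
rewrite dop_suml scaler_sumr; apply: eq_bigr => b _.
by rewrite dopZl !scalerA mulrC.
Qed.

Context (Psi : M -> spinor) (sPsi : smooth_spinor U Psi).

Lemma spd_kappa j (x : M -> 'rV[R]_n) q : (forall a, smooth_on U (fun p => x p 0 a)) -> U q ->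
  smooth_spinor U (fun p => act_left (kappa_vec kn (x p)) (Psi p)) /\
  spd c j (fun p => act_left (kappa_vec kn (x p)) (Psi p)) q =
  act_left (kappa_vec kn (\row_a 'd_j (fun p => x p 0 a) q)) (Psi q)
  + act_left (kappa_vec kn (x q)) (spd c j Psi q).
Proof.
move=> sx Uq; rewrite !act_left_kappa.
have -> : (fun p => act_left (kappa_vec kn (x p)) (Psi p)) =
    (fun p => \sum_a (x p 0 a)%:C *: act_left (kn a) (Psi p)).
  by apply/funext => p; rewrite act_left_kappa.
have [s E] := @spd_comb _ _ _ _ _ c U oU Uc _ j (fun a p => x p 0 a)
  (fun a => act_left (kn a)) Psi q (fun a => act_left_linear (kn a)) sx sPsi Uq.
split=> //; rewrite E; congr (_ + _); apply: eq_bigr => a _; by rewrite mxE.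
Qed.

Lemma spd_act_left_spin_lie j (W : M -> 'M[R]_n) q :
  (forall a b, smooth_on U (fun p => W p a b)) -> U q ->
  smooth_spinor U (fun p => act_left (spin_lie kn (W p)) (Psi p)) /\
  spd c j (fun p => act_left (spin_lie kn (W p)) (Psi p)) q =
  act_left (spin_lie kn (\matrix_(a, b) 'd_j (fun p => W p a b) q)) (Psi q)
  + act_left (spin_lie kn (W q)) (spd c j Psi q).
Proof.
move=> sW Uq; rewrite !act_left_spin_lie.
have -> : (fun p => act_left (spin_lie kn (W p)) (Psi p)) = (fun p =>
    \sum_(ab : 'I_n * 'I_n) (W p ab.1 ab.2)%:C *: (4^-1 *: act_left (kn ab.1 *m kn ab.2) (Psi p))).
  by apply/funext => p; rewrite act_left_spin_lie.
have [s E] := @spd_comb _ _ _ _ _ c U oU Uc _ j (fun (ab : 'I_n * 'I_n) p => W p ab.1 ab.2)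
  (fun ab psi => 4^-1 *: act_left (kn ab.1 *m kn ab.2) psi) Psi q
  (fun ab => lin_op_scale _ (act_left_linear _)) (fun ab => sW ab.1 ab.2) sPsi Uq.
split=> //; rewrite E; congr (_ + _); apply: eq_bigr => ab _; by rewrite mxE.
Qed.

Lemma spd_dop_spin_lie j (W : M -> 'M[R]_r) q :
  (forall a b, smooth_on U (fun p => W p a b)) -> U q ->
  smooth_spinor U (fun p => dop (spin_lie kr (W p)) (Psi p)) /\
  spd c j (fun p => dop (spin_lie kr (W p)) (Psi p)) q =
  dop (spin_lie kr (\matrix_(a, b) 'd_j (fun p => W p a b) q)) (Psi q)
  + dop (spin_lie kr (W q)) (spd c j Psi q).
Proof.
move=> sW Uq; rewrite !dop_spin_lie.
have -> : (fun p => dop (spin_lie kr (W p)) (Psi p)) = (fun p =>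
    \sum_(ab : 'I_r * 'I_r) (W p ab.1 ab.2)%:C *: (4^-1 *: dop (kr ab.1 *m kr ab.2) (Psi p))).
  by apply/funext => p; rewrite dop_spin_lie.
have [s E] := @spd_comb _ _ _ _ _ c U oU Uc _ j (fun (ab : 'I_r * 'I_r) p => W p ab.1 ab.2)
  (fun ab psi => 4^-1 *: dop (kr ab.1 *m kr ab.2) psi) Psi q
  (fun ab => lin_op_scale _ (dop_linear _)) (fun ab => sW ab.1 ab.2) sPsi Uq.
split=> //; rewrite E; congr (_ + _); apply: eq_bigr => ab _; by rewrite mxE.
Qed.

Context (mu : R) (B : 'I_n -> M -> 'rV[R]_n) (W : 'I_n -> M -> 'M[R]_n) (V : 'I_n -> M -> 'M[R]_r).
Context (sB : forall i a, smooth_on U (fun p => B i p 0 a)).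
Context (sW : forall i a b, smooth_on U (fun p => W i p a b)).
Context (sV : forall i a b, smooth_on U (fun p => V i p a b)).
Context (WT : forall i p, U p -> (W i p)^T = - W i p).
Context (VT : forall i p, U p -> (V i p)^T = - V i p).
Context (torsion : forall i j p, U p ->
  \row_a 'd_j (fun p => B i p 0 a) p + B i p *m W j p =
  \row_a 'd_i (fun p => B j p 0 a) p + B j p *m W i p).

(** With [Y], the operators of the Killing equation solved for partial derivatives: the lifted
    connection forms have moved to the right side, whence the minus signs. *)
Let X i p : 'M[C]_(2 ^ n./2) := mu%:C *: kappa_vec kn (B i p) - spin_lie kn (W i p).
Let Y i p : 'M[C]_(2 ^ r./2) := - spin_lie kr (V i p).

Context (killing : forall i p, U p ->
  spd c i Psi p = act_left (X i p) (Psi p) + dop (Y i p) (Psi p)).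

Let dX j i p : 'M[C]_(2 ^ n./2) :=
  mu%:C *: kappa_vec kn (\row_a 'd_j (fun p => B i p 0 a) p)
  - spin_lie kn (\matrix_(a, b) 'd_j (fun p => W i p a b) p).
Let dY j i p : 'M[C]_(2 ^ r./2) := - spin_lie kr (\matrix_(a, b) 'd_j (fun p => V i p a b) p).

Lemma spd_spd_killing i j q : U q -> spd c j (spd c i Psi) q =
  act_left (dX j i q + X i q *m X j q) (Psi q) + dop (dY j i q) (Psi q)
  + (act_left (X i q) (dop (Y j q) (Psi q)) + act_left (X j q) (dop (Y i q) (Psi q)))
  + dop (Y i q) (dop (Y j q) (Psi q)).
Proof.
move=> Uq.
have [s1 E1] := spd_kappa j (sB i) Uq.
have [s2 E2] := spd_act_left_spin_lie j (sW i) Uq.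
have [s3 E3] := spd_dop_spin_lie j (sV i) Uq.
have muL : linear (fun psi : spinor => mu%:C *: psi).
  by move=> a u v; rewrite scalerDr !scalerA mulrC.
have NL : linear (fun psi : spinor => - psi) by move=> a u v; rewrite opprD scalerN.
rewrite (@spd_congr _ _ _ _ _ c U oU Uc j (spd c i Psi) (fun p =>
    mu%:C *: act_left (kappa_vec kn (B i p)) (Psi p)
    + (- act_left (spin_lie kn (W i p)) (Psi p) + - dop (spin_lie kr (V i p)) (Psi p)))) //; last first.
  move=> p Up; rewrite (killing i Up) /X /Y act_leftZB dopNl.
  by rewrite addrA.
have s2' : smooth_spinor U (fun p => - act_left (spin_lie kn (W i p)) (Psi p)).
  exact: (smooth_spinor_lin oU NL s2).
have s3' : smooth_spinor U (fun p => - dop (spin_lie kr (V i p)) (Psi p)).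
  exact: (smooth_spinor_lin oU NL s3).
have s1' : smooth_spinor U (fun p => mu%:C *: act_left (kappa_vec kn (B i p)) (Psi p)).
  exact: (smooth_spinor_lin oU muL s1).
rewrite (spd_add oU Uc Uq j s1' (smooth_spinor_add oU s2' s3')).
rewrite (spd_add oU Uc Uq j s2' s3').
rewrite (spd_lin oU Uc muL j s1 Uq) (spd_lin oU Uc NL j s2 Uq) (spd_lin oU Uc NL j s3 Uq).
rewrite E1 E2 E3.
transitivity (act_left (dX j i q) (Psi q) + dop (dY j i q) (Psi q)
  + (act_left (X i q) (spd c j Psi q) + dop (Y i q) (spd c j Psi q))).
  have rg (a1 a2 b1 b2 c1 c2 : spinor) : a1 + a2 + (- (b1 + b2) - (c1 + c2)) =
      a1 - b1 - c1 + (a2 - b2 - c2).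
    by rewrite !opprD (addrACA (- b1)) (addrACA a1) !addrA.
  rewrite /dX /X /dY /Y.
  move: (spin_lie kn _) (spin_lie kn _) (spin_lie kr _) (spin_lie kr _) => S1 S2 S3 S4.
  rewrite !act_leftZB !dopNl scalerDr.
  exact: rg.
rewrite (killing j Uq).
move: (X i q) (X j q) (Y i q) (Y j q) (dX j i q) (dY j i q) (Psi q) => Xi Xj Yi Yj Dx Dy psi.
rewrite (lin_opD (act_left_linear Xi)) (lin_opD (dop_linear Yi)).
rewrite act_leftM act_leftDl -act_left_dop.
have rg (a b x y z t : spinor) : a + b + (x + y + (z + t)) = a + x + b + (y + z) + t.
  by rewrite !addrA (addrAC a b).
exact: rg.
Qed.


Let mx_pd_sub p (f g : 'I_p -> 'I_p -> R) :
  \matrix_(a, b) (f a b - g a b) = \matrix_(a, b) f a b - \matrix_(a, b) g a b.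
Proof. by apply/matrixP => a b; rewrite !mxE. Qed.

Lemma killing_integrability i j q : U q ->
  act_left (spin_lie kn (\matrix_(a, b) ('d_i (fun p => W j p a b) q - 'd_j (fun p => W i p a b) q)
     + (W j q *m W i q - W i q *m W j q))) (Psi q) +
  dop (spin_lie kr (\matrix_(a, b) ('d_i (fun p => V j p a b) q - 'd_j (fun p => V i p a b) q)
     + (V j q *m V i q - V i q *m V j q))) (Psi q) =
  (mu ^+ 2)%:C *: act_left (kappa_vec kn (B j q) *m kappa_vec kn (B i q)
     - kappa_vec kn (B i q) *m kappa_vec kn (B j q)) (Psi q).
Proof.
move=> Uq; have := spd_comm oU Uc j i sPsi Uq.
rewrite (spd_spd_killing i j Uq) (spd_spd_killing j i Uq).
have Xc : dX j i q + X i q *m X j q - (dX i j q + X j q *m X i q) =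
  spin_lie kn (\matrix_(a, b) ('d_i (fun p => W j p a b) q - 'd_j (fun p => W i p a b) q)
     + (W j q *m W i q - W i q *m W j q)) - (mu ^+ 2)%:C *: (kappa_vec kn (B j q) *m kappa_vec kn (B i q)
     - kappa_vec kn (B i q) *m kappa_vec kn (B j q)).
  rewrite mx_pd_sub; exact: (killing_commutator kn_rep _ _ _ (WT i Uq) (WT j Uq) (torsion i j Uq)).
have Yc : dY j i q - dY i j q + (Y i q *m Y j q - Y j q *m Y i q) =
  spin_lie kr (\matrix_(a, b) ('d_i (fun p => V j p a b) q - 'd_j (fun p => V i p a b) q)
     + (V j q *m V i q - V i q *m V j q)).
  rewrite mx_pd_sub; exact: (curvature_commutator kr_rep _ _ (VT i Uq) (VT j Uq)).
by move=> /(commutator_step Xc Yc).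
Qed.

End Integrability.

(** * Clifford contraction of the curvature *)

Section CurvatureContraction.
Context {R : realType} {n : nat} (k : spin_rep R n) (k_rep : is_spin_rep k).
Local Notation C := R[i].
Context (Om : 'I_n -> 'I_n -> 'M[R]_n).
Context (Om_skew : forall x y a b, Om y x a b = - Om x y a b).
Context (Om_antisym : forall x y a b, Om x y b a = - Om x y a b).
Context (bianchi : forall x y z b, Om x y z b + Om y z x b + Om z x y b = 0).

(** Four instances of the Bianchi identity, one for each choice of last index, combine linearly with
    the two antisymmetries; [lra] finds the combination. *)
Lemma curvature_pair_sym x y a b : Om x y a b = Om a b x y.
Proof.
have := bianchi x y a b; have := bianchi y a b x; have := bianchi a b x y; have := bianchi b x y a.
have := (Om_skew x a y b, Om_antisym x a y b, Om_skew y b a x, Om_antisym y b a x).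
have := (Om_skew a b x y, Om_antisym a b x y, Om_antisym b x y a, Om_skew b x y a).
have := (Om_antisym x y a b, Om_antisym y a b x, Om_antisym a x y b, Om_antisym b y a x).
have := (Om_skew x b y a, Om_antisym x b y a, Om_antisym a b x y, Om_antisym y b x a).
have := (Om_antisym b x a y, Om_antisym x a b y, Om_antisym y a x b, Om_skew y a x b).
have := (Om_skew b y a x, Om_skew x a b y, Om_antisym b y x a, Om_skew a y x b).
move=> [[[? ?] ?] ?] [[[? ?] ?] ?] [[[? ?] ?] ?] [[[? ?] ?] ?] [[[? ?] ?] ?] [[[? ?] ?] ?] ? ? ? ?.
lra.
Qed.

(** For the curvature, row x of the Ricci tensor: Ric(e_x, e_b) = sum_y <R(e_x, e_y) e_y, e_b>,
    positive on round spheres. *)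
Definition ricci_vec x : 'rV[R]_n := \row_b \sum_y Om x y y b.

Lemma ricci_contract b x : \sum_y Om y b x y = ricci_vec x 0 b.
Proof. by rewrite mxE; apply: eq_bigr => y _; rewrite curvature_pair_sym. Qed.

Definition tri (c : 'I_n -> 'I_n -> 'I_n -> R) : 'M[C]_(2 ^ n./2) :=
  \sum_y \sum_a \sum_b (c y a b)%:C *: (k y *m k a *m k b).

Lemma spin_rep_mul3 y a b : k y *m k a *m k b =
  k a *m k b *m k y + ((y == b)%:R *+ 2) *: k a - ((y == a)%:R *+ 2) *: k b.
Proof.
have A i j : k i *m k j = - (k j *m k i) - ((i == j)%:R *+ 2) *: 1%:M.
  by rewrite (spin_rep_anticomm k_rep) scalemx1.
have H1 : k a *m k y *m k b = - (k a *m k b *m k y) - ((y == b)%:R *+ 2) *: k a.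
  by rewrite -mulmxA (A y b) mulmxBr mulmxN -scalemxAr mulmx1 mulmxA.
rewrite (A y a) mulmxBl mulNmx -scalemxAl mul1mx H1.
move: (k a *m k b *m k y) (_ *: k a) (_ *: k b) => X Y Z.
by rewrite opprB opprK [Y + X]addrC.
Qed.

(** Moving the first of three generators to the end costs two Clifford relations, and each leaves a
    trace of the coefficients. *)
Lemma tri_cycle c : tri c = tri (fun y a b => c b y a)
  + 2 *: kappa_vec k (\row_a \sum_y c y a y) - 2 *: kappa_vec k (\row_b \sum_y c y y b).
Proof.
rewrite {1}/tri.
transitivity (\sum_y \sum_a \sum_b ((c y a b)%:C *: (k a *m k b *m k y)
   + (c y a b)%:C *: (((y == b)%:R *+ 2) *: k a) - (c y a b)%:C *: (((y == a)%:R *+ 2) *: k b))).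
  apply: eq_bigr => y _; apply: eq_bigr => a _; apply: eq_bigr => b _.
  by rewrite spin_rep_mul3 scalerBr scalerDr.
have -> : tri (fun y a b => c b y a) =
    \sum_y \sum_a \sum_b (c y a b)%:C *: (k a *m k b *m k y).
  rewrite /tri exchange_big; under eq_bigr do rewrite exchange_big.
  rewrite exchange_big; apply: eq_bigr => y _ /=; exact: exchange_big.
have -> : 2 *: kappa_vec k (\row_a \sum_y c y a y) =
    \sum_y \sum_a \sum_b (c y a b)%:C *: (((y == b)%:R *+ 2) *: k a).
  rewrite exchange_big /kappa_vec scaler_sumr; apply: eq_bigr => a _ /=.
  rewrite mxE rmorph_sum scaler_suml scaler_sumr; apply: eq_bigr => y _ /=.
  rewrite (bigD1 y) //= eqxx big1 ?addr0; last first.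
    by move=> b /negPf by_; rewrite eq_sym by_ mul0rn scale0r scaler0.
  by rewrite !scalerA mulrC.
have -> : 2 *: kappa_vec k (\row_b \sum_y c y y b) =
    \sum_y \sum_a \sum_b (c y a b)%:C *: (((y == a)%:R *+ 2) *: k b).
  under [RHS]eq_bigr do rewrite exchange_big.
  rewrite exchange_big /kappa_vec scaler_sumr; apply: eq_bigr => b _ /=.
  rewrite mxE rmorph_sum scaler_suml scaler_sumr; apply: eq_bigr => y _ /=.
  rewrite (bigD1 y) //= eqxx big1 ?addr0; last first.
    by move=> a /negPf ay; rewrite eq_sym ay mul0rn scale0r scaler0.
  by rewrite !scalerA mulrC.
rewrite -big_split -sumrB; apply: eq_bigr => y _ /=.
rewrite -big_split -sumrB; apply: eq_bigr => a _ /=.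
by rewrite -big_split -sumrB; apply: eq_bigr => b _ /=.
Qed.

(** Let T be [tri] of the curvature and v the Clifford multiplication by the Ricci row. By
    [tri_cycle] the two rotations of T are T + 4v and T + 2v. The three sum to zero by Bianchi and
    pair symmetry, so T = -2v, and the left side is T / 4. *)
Lemma clifford_ricci x : \sum_y k y *m spin_lie k (Om x y) = - (2^-1 *: kappa_vec k (ricci_vec x)).
Proof.
pose c y a b := Om x y a b.
have T1 := tri_cycle c; have T2 := tri_cycle (fun y a b => c b y a).
have E1 : \row_a \sum_y c y a y = - ricci_vec x.
  by apply/rowP => a; rewrite !mxE -sumrN; apply: eq_bigr => y _; rewrite /c Om_antisym.
have E2 : \row_b \sum_y c y y b = ricci_vec x by apply/rowP => b; rewrite !mxE.
have E3 : \row_a \sum_y c y y a = ricci_vec x by apply/rowP => b; rewrite !mxE.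
have E4 : \row_b \sum_y c b y y = 0.
  apply/rowP => b; rewrite !mxE big1 // => y _; rewrite /c.
  by have := Om_antisym x b y y; lra.
have S0 : tri c + tri (fun y a b => c b y a) + tri (fun y a b => c a b y) = 0.
  rewrite /tri -!big_split big1 // => y _ /=; rewrite -!big_split big1 // => a _ /=.
  rewrite -!big_split big1 // => b _ /=; rewrite -!scalerDl -!rmorphD /c.
  have -> : Om x y a b + Om x b y a + Om x a b y = 0.
    rewrite (curvature_pair_sym x y a b) (curvature_pair_sym x b y a) (curvature_pair_sym x a b y).
    have := bianchi y a b x.
    rewrite (Om_antisym y a x b) (Om_antisym a b x y) (Om_antisym b y x a); lra.
  by rewrite scale0r.
rewrite E1 E2 in T1; rewrite E3 E4 in T2.
have ST : \sum_y k y *m spin_lie k (Om x y) = 4^-1 *: tri c.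
  rewrite /tri scaler_sumr; apply: eq_bigr => y _; rewrite spin_lieE -scalemxAr; congr (_ *: _).
  rewrite mulmx_sumr; apply: eq_bigr => a _; rewrite mulmx_sumr; apply: eq_bigr => b _.
  by rewrite -scalemxAr mulmxA.
rewrite {}ST; move: T1 T2 S0.
rewrite -scaleN1r kappa_vecZ rmorphN1 (_ : kappa_vec k 0 = 0); last first.
  by rewrite /kappa_vec big1 // => i _; rewrite mxE scale0r.
move: (tri _) (tri _) (tri _) (kappa_vec k _) => t1 t2 t3 v /matrixP T1 /matrixP T2 /matrixP S0.
apply/matrixP => i j; have := T1 i j; have := T2 i j; have := S0 i j; rewrite !mxE.
move: (t1 i j) (t2 i j) (t3 i j) (v i j) => a1 a2 a3 w S T2' T1'.
have Ea2 : a2 = a3 + 4 * w by rewrite T1'; ring.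
have Ea1 : a1 = a3 + 2 * w.
  have -> : a1 = a2 - 2 * w by rewrite T2'; ring.
  by rewrite Ea2; ring.
have H3 : 3 * (a3 + 2 * w) = 0 by rewrite -S Ea1 Ea2; ring.
have {}H3 : a3 + 2 * w = 0 by move/eqP: H3; rewrite mulf_eq0 pnatr_eq0 => /eqP.
have -> : a3 = - (2 * w) by apply/eqP; rewrite -addr_eq0 H3.
by field.
Qed.

(** For y = x the commutator vanishes, and each of the n - 1 other indices contributes -2 e_x. *)
Lemma clifford_sandwich_sum x :
  \sum_y k y *m (k y *m k x - k x *m k y) = (- 2 * (n%:R - 1)) *: k x.
Proof.
have A i j : k i *m k j = - (k j *m k i) - ((i == j)%:R *+ 2) *: 1%:M.
  by rewrite (spin_rep_anticomm k_rep) scalemx1.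
have sq y : k y *m k y = (- 1) *: 1%:M.
  have [H _ _] := k_rep.
  by apply: addmm_inj; rewrite (H y y) eqxx -scalerDl scalemx1 mulr2n opprD.
have H y : k y *m (k y *m k x - k x *m k y) = (- 2) *: k x + (if y == x then 2 else 0) *: k x.
  rewrite mulmxBr mulmxA sq -scalemxAl mul1mx (A x y) mulmxBr mulmxN mulmxA sq.
  rewrite -scalemxAl mul1mx -scalemxAr mulmx1 eq_sym; case: eqP => [->|_].
    have -> : true%:R *+ 2 = 2 :> C by [].
    by move: (k x) => X; apply/matrixP => i j; rewrite !mxE; ring.
  have -> : false%:R *+ 2 = 0 :> C by rewrite mul0rn.
  by move: (k x) (k y) => X Y; apply/matrixP => i j; rewrite !mxE; ring.
under eq_bigr do rewrite H.
rewrite big_split /= sumr_const card_ord (bigD1 x) //= eqxx big1 ?addr0; last first.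
  by move=> y /negPf ->; rewrite scale0r.
by rewrite -scaler_nat scalerA -scalerDl; congr (_ *: _); ring.
Qed.

End CurvatureContraction.

(** * The Ricci identity in an orthonormal frame *)

Section RicciIdentity.
Context {R : realType} {n r m : nat}.
Local Notation C := R[i].
Local Notation spinor := (spinor R n r m).
Context (kn : spin_rep R n) (kn_rep : is_spin_rep kn).
Context (kr : spin_rep R r) (kr_rep : is_spin_rep kr).
Local Notation ctr A := ((map_mx conjc A)^T).
Implicit Types (psi chi : spinor).

Definition hermR psi chi : R := complex.Re (herm psi chi).

Lemma hermRDl psi psi' chi : hermR (psi + psi') chi = hermR psi chi + hermR psi' chi.
Proof. by rewrite /hermR hermDl cReD. Qed.

Lemma hermRZl (t : R) psi chi : hermR (t%:C *: psi) chi = t * hermR psi chi.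
Proof. by rewrite /hermR hermZl cReM /= mul0r subr0. Qed.

Lemma hermRNl psi chi : hermR (- psi) chi = - hermR psi chi.
Proof. by have := hermRZl (-1) psi chi; rewrite rmorphN1 scaleN1r mulN1r. Qed.

Lemma hermR_suml (I : Type) (s : seq I) (P : pred I) (f : I -> spinor) chi :
  hermR (\sum_(i <- s | P i) f i) chi = \sum_(i <- s | P i) hermR (f i) chi.
Proof. by rewrite /hermR herm_suml cRe_sum. Qed.

Lemma hermR_sym psi chi : hermR psi chi = hermR chi psi.
Proof. exact: Re_herm_sym. Qed.

Lemma hermR_gen_r b psi chi : hermR psi (act_left (kn b) chi) = - hermR (act_left (kn b) psi) chi.
Proof.
have [_ S _] := kn_rep.
have E : hermR (act_left (kn b) psi) chi = hermR psi (- act_left (kn b) chi).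
  by rewrite /hermR herm_act_left S act_leftNl.
by rewrite E (hermR_sym psi (- _)) hermRNl opprK hermR_sym.
Qed.

(** Moving a generator across reduces both orders to Re<e_a e_b psi, psi> and Re<e_b e_a psi, psi>.
    These are equal by symmetry of the real product, and their sum is given by the Clifford
    relation. *)
Lemma hermR_gen a b psi :
  hermR (act_left (kn a) psi) (act_left (kn b) psi) = (a == b)%:R * hermR psi psi.
Proof.
have [H _ _] := kn_rep.
have E x y : hermR (act_left (kn x) psi) (act_left (kn y) psi) =
    - hermR (act_left (kn y *m kn x) psi) psi by rewrite hermR_gen_r act_leftM.
have S := E a b; have S' := E b a; rewrite hermR_sym in S'.
have T : hermR (act_left (kn b *m kn a) psi) psi + hermR (act_left (kn a *m kn b) psi) psi =
    - 2 * (a == b)%:R * hermR psi psi.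
  rewrite -hermRDl -act_leftDl H -scalemx1 act_leftZl act_left1.
  rewrite eq_sym (_ : _ *- 2 = (- 2 * (a == b)%:R : R)%:C) ?hermRZl //.
  case: (a == b); first by rewrite mulr1 rmorphN rmorph_nat.
  by rewrite mul0rn oppr0 mulr0 rmorph0.
by move: S S' T; move: (hermR _ _) (hermR (act_left _ _) _) (hermR (act_left _ _) _) (hermR _ _) => u v w z; lra.
Qed.

Lemma hermR_dop_lie (V : 'M[R]_r) psi : V^T = - V -> hermR (dop (spin_lie kr V) psi) psi = 0.
Proof.
move=> VT; apply: (@skew_Re_herm _ _ _ _ (dop (spin_lie kr V))).
by rewrite herm_dop (spin_lie_skew kr_rep VT) dopNl hermNr.
Qed.

Context (Om : 'I_n -> 'I_n -> 'M[R]_n) (OmF : 'I_n -> 'I_n -> 'M[R]_r).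
Context (Om_skew : forall x y a b, Om y x a b = - Om x y a b).
Context (Om_antisym : forall x y a b, Om x y b a = - Om x y a b).
Context (bianchi : forall x y z b, Om x y z b + Om y z x b + Om z x y b = 0).
Context (OmF_skew : forall x y, OmF y x = - OmF x y).
Context (OmF_antisym : forall x y, (OmF x y)^T = - OmF x y).
Context (mu : R) (psi : spinor).
Context (integrability : forall x y,
  act_left (spin_lie kn (Om x y)) psi + dop (spin_lie kr (OmF x y)) psi =
  (mu ^+ 2)%:C *: act_left (kn y *m kn x - kn x *m kn y) psi).

(** The form eta on e_b, e_y with an arbitrary matrix A in place of f_k f_l, which makes it linear
    in A. *)
Definition eta_frame b y (A : 'M[C]_(2 ^ r./2)) : R :=
  hermR (act_left (kn b *m kn y + ((b == y)%:R)%:M) (dop A psi)) psi.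

(** The 1/4 of the lift is kept as two halves: one cancels the factor 1/2 in front of Ric, the other
    turns the sum over all k, l into one over k < l. *)
Lemma eta_lie b y x : eta_frame b y (spin_lie kr (OmF y x)) =
  2^-1 * (2^-1 * \sum_k \sum_l eta_frame b y (kr k *m kr l) * OmF y x k l).
Proof.
have E : dop (spin_lie kr (OmF y x)) psi = (4^-1 : R)%:C *: \sum_k \sum_l
    (OmF y x k l)%:C *: dop (kr k *m kr l) psi.
  rewrite spin_lieE dopZl fmorphV rmorph_nat dop_suml; congr (_ *: _).
  apply: eq_bigr => k _; rewrite dop_suml; apply: eq_bigr => l _; exact: dopZl.
rewrite /eta_frame E; move: (_ + _%:M) => A.
have lA : linear (act_left A : spinor -> spinor) := @act_left_linear R n r m A.
rewrite (lin_opZ lA) (lin_op_sum lA) hermRZl hermR_suml !mulr_sumr; apply: eq_bigr => k _.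
rewrite (lin_op_sum lA) hermR_suml !mulr_sumr; apply: eq_bigr => l _.
by rewrite (lin_opZ lA) hermRZl; field.
Qed.

Lemma killing_ricci_frame b x :
  hermR psi psi * \sum_y Om y b x y =
  4 * (n%:R - 1) * mu ^+ 2 * hermR psi psi * (b == x)%:R +
  2^-1 * \sum_k \sum_l \sum_y eta_frame b y (kr k *m kr l) * OmF y x k l.
Proof.
rewrite (ricci_contract Om_skew Om_antisym bianchi).
have E y : act_left (kn y *m spin_lie kn (Om x y)) psi
    + act_left (kn y) (dop (spin_lie kr (OmF x y)) psi) =
    (mu ^+ 2)%:C *: act_left (kn y *m (kn y *m kn x - kn x *m kn y)) psi.
  rewrite -!act_leftM -(lin_opD (act_left_linear (kn y))) integrability.
  by rewrite (lin_opZ (act_left_linear (kn y))).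
have {}E : - (2^-1 * (ricci_vec Om x 0 b * hermR psi psi)) +
    \sum_y hermR (act_left (kn y) (dop (spin_lie kr (OmF x y)) psi)) (act_left (kn b) psi) =
    mu ^+ 2 * (- 2 * (n%:R - 1) * ((x == b)%:R * hermR psi psi)).
  have S : \sum_y act_left (kn y *m spin_lie kn (Om x y)) psi
      + \sum_y act_left (kn y) (dop (spin_lie kr (OmF x y)) psi) =
      (mu ^+ 2)%:C *: \sum_y act_left (kn y *m (kn y *m kn x - kn x *m kn y)) psi.
    by rewrite -big_split scaler_sumr; apply: eq_bigr => y _; exact: E.
  move: S; rewrite -!act_left_suml.
  rewrite (clifford_ricci kn_rep Om_skew Om_antisym bianchi) (clifford_sandwich_sum kn_rep).
  move=> /(congr1 (fun p => hermR p (act_left (kn b) psi))).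
  rewrite hermRDl hermRZl act_leftNl hermRNl hermR_suml.
  have h2 : (2^-1 : C) = (2^-1 : R)%:C by rewrite fmorphV rmorph_nat.
  rewrite act_leftZl {1}h2 hermRZl.
  rewrite (_ : (- 2 * (n%:R - 1) : C) = (- 2 * (n%:R - 1) : R)%:C); last first.
    by rewrite rmorphM rmorphB rmorphN !rmorph_nat rmorph1.
  rewrite act_leftZl hermRZl hermR_gen => <-; congr (- (_ * _) + _).
  rewrite /kappa_vec act_left_suml hermR_suml (bigD1 b) //= big1 ?addr0.
    by rewrite act_leftZl hermRZl hermR_gen eqxx mul1r.
  by move=> a /negPf ab; rewrite act_leftZl hermRZl hermR_gen ab mul0r mulr0.
(* The sign from moving e_b to the left factor is absorbed by exchanging x and y in [OmF]. *)
have F y : hermR (act_left (kn y) (dop (spin_lie kr (OmF x y)) psi)) (act_left (kn b) psi) =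
    eta_frame b y (spin_lie kr (OmF y x)).
  rewrite hermR_gen_r act_leftM /eta_frame act_leftDl hermRDl -[_%:M]scalemx1 act_leftZl act_left1.
  rewrite (OmF_skew x y) spin_lieN dopNl (lin_opN (act_left_linear _)) hermRNl.
  have h (t : bool) : (t%:R : C) = (t%:R : R)%:C by rewrite rmorph_nat.
  rewrite h hermRZl hermRNl.
  by rewrite hermR_dop_lie // oppr0 mulr0 addr0.
have T : \sum_k \sum_l \sum_y eta_frame b y (kr k *m kr l) * OmF y x k l =
    \sum_y \sum_k \sum_l eta_frame b y (kr k *m kr l) * OmF y x k l.
  under eq_bigr do rewrite exchange_big.
  exact: exchange_big.
move: E; under eq_bigr do rewrite F eta_lie.
rewrite -!mulr_sumr -{}T eq_sym.
by move: (hermR _ _) (ricci_vec _ _ _ _) (\sum_k _) ((b == x)%:R) => u v w d; lra.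
Qed.

Definition eta_mx b y : 'M[R]_r := \matrix_(k, l) eta_frame b y (kr k *m kr l).

Lemma eta_frameZ b y (t : R) A : eta_frame b y (t%:C *: A) = t * eta_frame b y A.
Proof.
rewrite /eta_frame dopZl; move: (_ + _%:M) => B.
have lB : linear (act_left B : spinor -> spinor) := @act_left_linear R n r m B.
by rewrite (lin_opZ lB) hermRZl.
Qed.

Lemma eta_frame_sum b y (I : Type) (s : seq I) (Q : pred I) f :
  eta_frame b y (\sum_(i <- s | Q i) f i) = \sum_(i <- s | Q i) eta_frame b y (f i).
Proof.
rewrite /eta_frame dop_suml; move: (_ + _%:M) => B.
have lB : linear (act_left B : spinor -> spinor) := @act_left_linear R n r m B.
by rewrite (lin_op_sum lB) hermR_suml.
Qed.

Lemma eta_frameD b y A A' : eta_frame b y (A + A') = eta_frame b y A + eta_frame b y A'.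
Proof.
rewrite /eta_frame dopDl; move: (_ + _%:M) => B.
have lB : linear (act_left B : spinor -> spinor) := @act_left_linear R n r m B.
by rewrite (lin_opD lB) hermRDl.
Qed.

(** The identity acts on the tensor power as multiplication by m, and Re<e_b e_y psi, psi> =
    -delta_by |psi|^2 cancels the scalar term. As f_k f_l + f_l f_k is scalar, this yields the
    antisymmetry of [eta_mx]. *)
Lemma eta_frame1 b y : eta_frame b y 1%:M = 0.
Proof.
have h (t : bool) : (t%:R : C) = (t%:R : R)%:C by rewrite rmorph_nat.
have -> : eta_frame b y 1%:M = m%:R * hermR (act_left (kn b *m kn y + ((b == y)%:R)%:M) psi) psi.
  rewrite /eta_frame (_ : dop 1%:M psi = (m%:R : R)%:C *: psi); last first.
    rewrite /dop (eq_bigr (fun=> psi)) => [|a _]; last first.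
    rewrite act_factorE -[RHS]tens1; apply: tens_eq => // c.
    by rewrite /only_at; case: ifP.
    by rewrite sumr_const card_ord rmorph_nat scaler_nat.
  by rewrite (lin_opZ (act_left_linear _)) hermRZl.
rewrite act_leftDl hermRDl -scalemx1 act_leftZl act_left1 h hermRZl -act_leftM.
by rewrite hermR_sym hermR_gen_r hermR_gen addNr mulr0.
Qed.

Lemma eta_mx_antisym b y : (eta_mx b y)^T = - eta_mx b y.
Proof.
have [H _ _] := kr_rep.
apply/matrixP => k l; rewrite !mxE; apply/eqP; rewrite -addr_eq0 -eta_frameD H.
rewrite (_ : _%:M = (- (2 * (l == k)%:R) : R)%:C *: 1%:M).
  by rewrite eta_frameZ eta_frame1 mulr0.
rewrite scalemx1; congr (_%:M); case: (l == k).
  by rewrite mulr1 rmorphN rmorph_nat.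
by rewrite mulr0 mul0rn !oppr0 rmorph0.
Qed.

Lemma eta_frame_vec b y (u w : 'rV[R]_r) :
  eta_frame b y (kappa_vec kr u *m kappa_vec kr w) = (u *m eta_mx b y *m w^T) 0 0.
Proof.
rewrite /kappa_vec mulmx_suml eta_frame_sum mxE.
under [RHS]eq_bigr do rewrite mxE mulr_suml.
rewrite exchange_big; apply: eq_bigr => k _; rewrite mulmx_sumr eta_frame_sum.
apply: eq_bigr => l _; rewrite -scalemxAl -scalemxAr !eta_frameZ !mxE.
by move: (eta_frame _ _ _) => t; ring.
Qed.

(** For antisymmetric A and B, the sum over k < l of A_kl B_kl is tr(A B^T) / 2, which is invariant
    under conjugation of both by the orthogonal matrix H. So the frame of F may be replaced by any
    other orthonormal one. *)
Lemma killing_ricci b x (H : 'M[R]_r) : H *m H^T = 1%:M ->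
  hermR psi psi * \sum_y Om y b x y =
  4 * (n%:R - 1) * mu ^+ 2 * hermR psi psi * (b == x)%:R +
  \sum_(k < r) \sum_(l < r | (k < l)%N) \sum_y
    eta_frame b y (kappa_vec kr (row k H) *m kappa_vec kr (row l H)) *
    (row k H *m OmF y x *m (row l H)^T) 0 0.
Proof.
move=> HH; have HH' : H^T *m H = 1%:M by apply: mulmx1C.
rewrite killing_ricci_frame; congr (_ + _).
have rowE (A : 'M[R]_r) k l : (row k H *m A *m (row l H)^T) 0 0 = (H *m A *m H^T) k l.
  rewrite !mxE; apply: eq_bigr => j _; rewrite -row_mul [in LHS]mxE; congr (_ * _).
  by rewrite !mxE.
under [RHS]eq_bigr do under eq_bigr do under eq_bigr do rewrite eta_frame_vec !rowE.
pose f k l := \sum_y (H *m eta_mx b y *m H^T) k l * (H *m OmF y x *m H^T) k l.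
have fC k l : f l k = f k l.
  apply: eq_bigr => y _.
  have sk (A : 'M[R]_r) : A^T = - A -> (H *m A *m H^T) l k = - (H *m A *m H^T) k l.
    move=> AT; transitivity ((H *m A *m H^T)^T k l); first by rewrite [RHS]mxE.
    by rewrite !trmx_mul trmxK AT mulNmx mulmxN mulmxA [LHS]mxE.
  by rewrite !sk ?eta_mx_antisym // mulrNN.
have faa k : f k k = 0.
  apply: big1 => y _.
  have sk (A : 'M[R]_r) : A^T = - A -> (H *m A *m H^T) k k = - (H *m A *m H^T) k k.
    move=> AT; transitivity ((H *m A *m H^T)^T k k); first by rewrite [RHS]mxE.
    by rewrite !trmx_mul trmxK AT mulNmx mulmxN mulmxA [LHS]mxE.
  have := sk _ (OmF_antisym y x); move: ((_ *m _) _ _) ((_ *m _) _ _) => u w; nra.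
have -> : \sum_(k < r) \sum_(l < r | (k < l)%N) f k l = 2^-1 * \sum_k \sum_l f k l.
  by rewrite (sum_sym_lt fC faa); move: (\sum_(k < r) _) => t; lra.
have exch (h : 'I_r -> 'I_r -> 'I_n -> R) :
    \sum_k \sum_l \sum_y h k l y = \sum_y \sum_k \sum_l h k l y.
  by under eq_bigr do rewrite exchange_big; exact: exchange_big.
congr (_ * _); rewrite /f !exch; apply: eq_bigr => y _.
have trE (A B : 'M[R]_r) : \sum_k \sum_l A k l * B k l = \tr (A *m B^T).
  by apply: eq_bigr => k _; rewrite mxE; apply: eq_bigr => l _; rewrite mxE.
transitivity (\sum_k \sum_l eta_mx b y k l * OmF y x k l).
  by apply: eq_bigr => k _; apply: eq_bigr => l _; rewrite [in RHS]mxE.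
rewrite !trE !trmx_mul trmxK; move: (eta_mx b y) ((OmF y x)^T) => A B.
rewrite [RHS](_ : _ = \tr (H *m (A *m B *m H^T))); last first.
  by congr (\tr _); rewrite -!mulmxA (mulmxA H^T H) HH' mul1mx.
by rewrite [RHS]mxtrace_mulC -(mulmxA (A *m B)) HH' mulmx1.
Qed.

End RicciIdentity.

(** * Change of lift and of frame *)

Section SpinInvariance.
Context {R : realType} {n r m : nat}.
Local Notation C := R[i].
Local Notation Nn := (2 ^ n./2)%N.
Local Notation Nr := (2 ^ r./2)%N.
Local Notation spinor := (spinor R n r m).
Local Notation ctr A := ((map_mx conjc A)^T).

Lemma act_left_tens (A X X' : 'M[C]_Nn) (F : 'I_m -> 'M[C]_Nr) (psi : spinor) :
  X *m A = A *m X' -> act_left X (tens A F psi) = tens A F (act_left X' psi).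
Proof.
move=> XA; rewrite !act_leftE !tensM XA; apply: tens_eq => a.
by rewrite mul1mx mulmx1.
Qed.

Lemma dop_tens (A : 'M[C]_Nn) (B Y Y' : 'M[C]_Nr) (psi : spinor) :
  Y *m B = B *m Y' -> dop Y (tens A (fun=> B) psi) = tens A (fun=> B) (dop Y' psi).
Proof.
move=> YB; rewrite /dop.
have lA : linear (tens A (fun=> B) : spinor -> spinor) := @tens_linear R n r m A _.
rewrite (lin_op_sum lA); apply: eq_bigr => a _.
rewrite !act_factorE !tensM mul1mx mulmx1; apply: tens_eq => b; rewrite /only_at.
by case: ifP => _; rewrite ?mul1mx ?mulmx1.
Qed.

Lemma hermR_tens (A : 'M[C]_Nn) (B : 'M[C]_Nr) (psi chi : spinor) :
  ctr A *m A = 1%:M -> ctr B *m B = 1%:M ->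
  hermR (tens A (fun=> B) psi) (tens A (fun=> B) chi) = hermR psi chi.
Proof.
by move=> AA BB; rewrite /hermR herm_tens tensM AA (tens_eq _ _ (fun=> BB)) tens1.
Qed.

Lemma mulmx_frame_change d (L E E' : 'M[R]_d) (v : 'rV[R]_d) :
  E \in unitmx -> E' \in unitmx -> E' = L *m E -> v *m invmx E' *m L = v *m invmx E.
Proof.
move=> uE uE' EE'; apply: (can_inj (mulmxK uE)).
by rewrite -(mulmxA _ L) -EE' !mulmxKV.
Qed.

Context {M : manifold R n} (kn : spin_rep R n) (kn_rep : is_spin_rep kn).
Context (kr : spin_rep R r) (kr_rep : is_spin_rep kr).
Context {Q : spin_bundle M r} {phi : Q -> spinor} (phi_section : spinor_section kn kr phi).
Context {grp : spin_group} {g : M -> 'M[R]_n} {oM oF : M -> bool} {F : vbundle M r}.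
Context {gF : M -> 'M[R]_r} (Q_spin : is_spin_bundle grp g oM F gF oF Q).


Lemma orthonormal_unit d (G : M -> 'M[R]_d) p A : Defs.orthonormal G p A -> A \in unitmx.
Proof. by rewrite /Defs.orthonormal -mulmxA => /mulmx1_unit[]. Qed.

Lemma spin_fibre (q q' : Q) : pbase q = pbase q' ->
  norm2 phi q = norm2 phi q' /\
  forall fk fl, eta_form kn kr g phi q fk fl = eta_form kn kr g phi q' fk fl.
Proof.
move=> qq'; have [[_ _ _ fibre] orth equi _] := Q_spin.
have [a [b [Sa Sb q'E]]] := (fibre q q').1 qq'.
have [oT _ oFr _] := orth q; have [oT' _ oFr' _] := orth q'.
have [eT eF] := equi q a b Sa Sb; rewrite -q'E in eT eF.
have phiE : phi q = tens (kappa kn a) (fun=> kappa kr b) (phi q').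
  by rewrite q'E; have [/(_ q a b Sa Sb) <- _] := phi_section.
have [uA uB] := (kappa_spin_unitary kn_rep Sa, kappa_spin_unitary kr_rep Sb).
split; first by rewrite /norm2 -!/(hermR _ _) phiE hermR_tens.
move=> fk fl; apply/matrixP => i j; rewrite !mxE -!/(hermR _ _) -qq'.
have cT v : cliffT kn q v *m kappa kn a = kappa kn a *m cliffT kn q' v.
  rewrite /cliffT (kappa_spin_conj kn_rep _ Sa).
  by rewrite (mulmx_frame_change _ (orthonormal_unit oT) (orthonormal_unit oT') eT).
have cF v : kappa_vec kr (v *m invmx (pfrF q)) *m kappa kr b =
    kappa kr b *m kappa_vec kr (v *m invmx (pfrF q')).
  rewrite (kappa_spin_conj kr_rep _ Sb).
  by rewrite (mulmx_frame_change _ (orthonormal_unit oFr) (orthonormal_unit oFr') eF).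
rewrite phiE /star_F /kappa_star -!/(dop _ _).
rewrite (dop_tens _ _ (Y' := kappa_vec kr (fk *m invmx (pfrF q')) *m kappa_vec kr (fl *m invmx (pfrF q')))); last first.
  by rewrite -mulmxA cF !mulmxA cF.
rewrite (act_left_tens _ _ (X' := cliffT kn q' 'e_i *m cliffT kn q' 'e_j + ((ip g (pbase q) 'e_i 'e_j)%:C)%:M)); last first.
  by rewrite mulmxDl mulmxDr -mulmxA cT !mulmxA cT scalar_mxC.
exact: hermR_tens.
Qed.

End SpinInvariance.

Section NormSquare.
Context {R : realType} {n r m : nat}.
Local Notation spinor := (spinor R n r m).
Local Notation ctr A := ((map_mx conjc A)^T).

Lemma hermRE (psi chi : spinor) : hermR psi chi =
  \sum_x (complex.Re (psi x) * complex.Re (chi x) + complex.Im (psi x) * complex.Im (chi x)).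
Proof.
rewrite /hermR /herm cRe_sum; apply: eq_bigr => x _.
by case: (psi x) (chi x) => [a b] [a' b'] /=; rewrite mulrN opprK.
Qed.

Lemma hermR_eq0 (psi : spinor) : hermR psi psi = 0 -> psi = 0.
Proof.
rewrite hermRE => H; apply/ffunP => x; rewrite ffunE.
have sq (y : spinor_index) : 0 <= complex.Re (psi y) * complex.Re (psi y) +
    complex.Im (psi y) * complex.Im (psi y).
  by rewrite addr_ge0 // -expr2 sqr_ge0.
have := psumr_eq0P (fun y _ => sq y) H (i := x) isT.
case: (psi x) => a b /=; rewrite -!expr2 => /eqP.
by rewrite paddr_eq0 ?sqr_ge0 // !sqrf_eq0 => /andP[/eqP -> /eqP ->].
Qed.

Lemma hermR_act_left_skew A (psi : spinor) : ctr A = - A -> hermR (act_left A psi) psi = 0.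
Proof.
move=> AA; apply: (@skew_Re_herm _ _ _ _ (act_left A)).
by rewrite herm_act_left AA act_leftNl hermNr.
Qed.

End NormSquare.

(** * The Killing equation along a local section of the spin bundle *)

Section KillingInFrame.
Context {R : realType} {n r m : nat} {M : manifold R n}.
Local Notation C := R[i].
Local Notation spinor := (spinor R n r m).
Context (g : M -> 'M[R]_n) (g_metric : is_metric (TM M) g).
Context (nablaM : connection M n) (nablaM_LC : is_levi_civita g nablaM).
Context (F : vbundle M r) (F_vbundle : is_vbundle F).
Context (gF : M -> 'M[R]_r) (gF_metric : is_metric F gF).
Context (nablaF : connection M r) (nablaF_metric : is_metric_connection F gF nablaF).
Context (grp : spin_group) (oM oF : M -> bool) (Q : spin_bundle M r).
Context (Q_spin : is_spin_bundle grp g oM F gF oF Q).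
Context (kn : spin_rep R n) (kn_rep : is_spin_rep kn).
Context (kr : spin_rep R r) (kr_rep : is_spin_rep kr).
Context (phi : Q -> spinor) (phi_section : spinor_section kn kr phi).
Context (mu : R) (phi_killing : is_killing kn kr g nablaM gF nablaF mu phi).
Context (Us : set M * (M -> Q)) (Q_Us : patlas Q Us) (c : chart M).

Local Notation U := (Us.1 `&` cdom c).
Local Notation e := (fun q => pfrT (Us.2 q)).
Local Notation f := (fun q => pfrF (Us.2 q)).
Local Notation Psi := (fun q => phi (Us.2 q)).
Local Notation W := (conn_form nablaM c g e).
Local Notation V := (conn_form nablaF c gF f).
Local Notation B i q := (\row_a coframe g c e i a q).

Lemma open_vbundle Vb : F Vb -> open Vb.1.
Proof. by have [_ H _ _] := F_vbundle; apply: H. Qed.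

Lemma open_atlas_chart : open U.
Proof.
have [_ _ _ [_ /(_ _ Q_Us)[oU _] _ _]] := Q_spin.
by apply: openI => //; apply: cdom_open.
Qed.
Local Notation oU := open_atlas_chart.

Lemma atlas_chart_sub : U `<=` cdom c.
Proof. by move=> q []. Qed.
Local Notation Uc := atlas_chart_sub.

Lemma smooth_pfrT : smooth_frame (TM M) U e.
Proof.
have [_ _ _ [_ _ /(_ _ Q_Us)[H _] _]] := Q_spin.
by move=> i; apply: smooth_section_sub (H i) => q [].
Qed.

Lemma smooth_pfrF : smooth_frame F U f.
Proof.
have [_ _ _ [_ _ /(_ _ Q_Us)[_ H] _]] := Q_spin.
by move=> i; apply: smooth_section_sub (H i) => q [].
Qed.

Lemma pbase_atlas q : U q -> pbase (Us.2 q) = q.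
Proof. by have [_ _ _ [_ /(_ _ Q_Us)[_ H] _ _]] := Q_spin; move=> [/H]. Qed.

Lemma orthonormal_pfrT q : U q -> Defs.orthonormal g q (e q).
Proof. by move=> Uq; have [_ /(_ (Us.2 q))[H _ _ _] _ _] := Q_spin; rewrite pbase_atlas in H. Qed.

Lemma orthonormal_pfrF q : U q -> Defs.orthonormal gF q (f q).
Proof. by move=> Uq; have [_ /(_ (Us.2 q))[_ _ H _] _ _] := Q_spin; rewrite pbase_atlas in H. Qed.

Lemma smooth_atlas_spinor : smooth_spinor U Psi.
Proof.
move=> x; have [_ /(_ _ Q_Us x)[sR sI]] := phi_section.
by split; [apply: smooth_on_sub sR|apply: smooth_on_sub sI] => q [].
Qed.

Local Notation one := orthonormal_pfrT.
Local Notation onf := orthonormal_pfrF.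
Local Notation se := smooth_pfrT.
Local Notation sf := smooth_pfrF.

Lemma conn_formT_antisym i q : U q -> (W i q)^T = - W i q.
Proof.
move=> Uq; apply/matrixP => a b; rewrite [LHS]mxE [RHS]mxE.
exact: (conn_form_antisym oU Uc g_metric (proj1 nablaM_LC) se one).
Qed.

Lemma conn_formF_antisym i q : U q -> (V i q)^T = - V i q.
Proof.
move=> Uq; apply/matrixP => a b; rewrite [LHS]mxE [RHS]mxE.
exact: (conn_form_antisym oU Uc gF_metric nablaF_metric sf onf).
Qed.

Lemma row_frame_inv d (A : 'M[R]_d) k : A \in unitmx -> row k A *m invmx A = 'e_k.
Proof. by move=> uA; rewrite -row_mul mulmxV // row1. Qed.

Lemma kappa_vec_delta d (k : spin_rep R d) i : kappa_vec k 'e_i = k i.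
Proof.
rewrite /kappa_vec (bigD1 i) //= mxE !eqxx rmorph1 scale1r big1 ?addr0 // => j /negPf ji.
by rewrite mxE ji andbF rmorph0 scale0r.
Qed.

Lemma cliffT_del i q : U q ->
  cliffT kn (Us.2 q) (coord_field c 'e_i q) = kappa_vec kn (B i q).
Proof.
move=> Uq; rewrite /cliffT coeffE; congr (kappa_vec kn (_ *m _)).
have uE := frame_unit one Uq.
by apply: (can_inj (mulmxK uE)); rewrite (frame_inv one Uq) mulVmx.
Qed.

Lemma killing_spd i q : U q ->
  spd c i Psi q = act_left (mu%:C *: kappa_vec kn (B i q) - spin_lie kn (W i q)) (Psi q)
    + dop (- spin_lie kr (V i q)) (Psi q).
Proof.
move=> Uq; have [Usq cq] := Uq.
have := phi_killing Q_Us Usq (coord_field c 'e_i q).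
rewrite cliffT_del //; rewrite /spinor_nabla.
have -> : [ffun x => dderiv q (coord_field c 'e_i q) (fun q => complex.Re (phi (Us.2 q) x)) +i*
    dderiv q (coord_field c 'e_i q) (fun q => complex.Im (phi (Us.2 q) x))] = spd c i Psi q.
  apply/ffunP => x; rewrite !ffunE; have [sR sI] := smooth_atlas_spinor x.
  by rewrite (dderiv_coord_field i oU Uq cq sR) (dderiv_coord_field i oU Uq cq sI).
set S1 := _ *: _; set S2 := _ *: _.
have h2 : (2^-1 : R)%:C = (2^-1 : C) by rewrite fmorphV rmorph_nat.
have -> : S1 = act_left (spin_lie kn (W i q)) (Psi q).
  rewrite -(spin_lie_lt kn_rep (conn_formT_antisym i Uq)) act_leftZl act_left_suml /S1 h2.
  congr (_ *: _); apply: eq_bigr => a _; rewrite act_left_suml; apply: eq_bigr => b _.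
  by rewrite act_leftZl conn_formE.
have -> : S2 = dop (spin_lie kr (V i q)) (Psi q).
  rewrite -(spin_lie_lt kr_rep (conn_formF_antisym i Uq)) dopZl dop_suml /S2 h2.
  congr (_ *: _); apply: eq_bigr => a _; rewrite dop_suml; apply: eq_bigr => b _.
  rewrite dopZl conn_formE /star_F /kappa_star.
  have uf := frame_unit onf Uq.
  rewrite (row_frame_inv a uf) (row_frame_inv b uf).
  by rewrite (kappa_vec_delta kr a) (kappa_vec_delta kr b).
rewrite act_leftDl act_leftNl act_leftZl dopNl.
move: (act_left _ _) (act_left _ _) (dop _ _) (spd _ _ _ _) => x y z t <-.
by rewrite addrAC addrK addrK.
Qed.

Lemma smooth_norm2 : smooth_on U (fun q => norm2 phi (Us.2 q)).
Proof.
pose G q := \sum_x (complex.Re (Psi q x) * complex.Re (Psi q x) + complex.Im (Psi q x) * complex.Im (Psi q x)).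
apply: (@smooth_on_congr _ _ _ _ G _ oU) => [q _|]; first by rewrite /norm2 -/(hermR _ _) hermRE.
apply: smooth_on_sum => [|x _]; first exact: oU.
have [sR sI] := smooth_atlas_spinor x.
exact: (smooth_on_add oU (smooth_on_mul oU sR sR) (smooth_on_mul oU sI sI)).
Qed.

Lemma pd_norm2 i q : U q ->
  pd c 'e_i (fun q => norm2 phi (Us.2 q)) q = 2 * hermR (spd c i Psi q) (Psi q).
Proof.
move=> Uq; have cq := Uc Uq.
pose G q := \sum_x (complex.Re (Psi q x) * complex.Re (Psi q x) + complex.Im (Psi q x) * complex.Im (Psi q x)).
rewrite (@pd_congr _ _ _ c _ _ G q U oU Uq cq) => [|p Up _]; last first.
  by rewrite /norm2 -/(hermR _ _) hermRE.
have sRR x : smooth_on U (fun p => complex.Re (Psi p x) * complex.Re (Psi p x)).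
  by have [sR sI] := smooth_atlas_spinor x; exact: (smooth_on_mul oU sR sR).
have sII x : smooth_on U (fun p => complex.Im (Psi p x) * complex.Im (Psi p x)).
  by have [sR sI] := smooth_atlas_spinor x; exact: (smooth_on_mul oU sI sI).
rewrite (pd_sum oU Uq cq); last by move=> x _; exact: (smooth_on_add oU (sRR x) (sII x)).
rewrite hermRE mulr_sumr; apply: eq_bigr => x _; have [sR sI] := smooth_atlas_spinor x.
rewrite (pd_add oU Uq cq _ (sRR x) (sII x)) (pd_mul oU Uq cq _ sR sR) (pd_mul oU Uq cq _ sI sI).
rewrite [spd _ _ _ _ _]ffunE /=.
move: (pd _ _ _ _) (pd _ _ _ _) (complex.Re _) (complex.Im _) => s t u v; ring.
Qed.

Lemma pd_norm2_eq0 i q : U q -> pd c 'e_i (fun q => norm2 phi (Us.2 q)) q = 0.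
Proof.
move=> Uq; rewrite pd_norm2 // killing_spd //.
rewrite hermRDl act_leftDl hermRDl act_leftNl hermRNl act_leftZl hermRZl dopNl hermRNl.
rewrite (hermR_act_left_skew _ (kappa_vec_skew kn_rep _)).
rewrite (hermR_act_left_skew _ (spin_lie_skew kn_rep (conn_formT_antisym i Uq))).
by rewrite (hermR_dop_lie kr_rep _ (conn_formF_antisym i Uq)) mulr0 !oppr0 !addr0 mulr0.
Qed.

End KillingInFrame.

(** * From coordinate components to an orthonormal frame *)

Section FrameChange.
Context {R : realType} {n : nat}.
Implicit Types E : 'M[R]_n.

(* T(E_x, E_y) for the rows E_x of E and a bilinear T with components T i j. *)
Definition in_frame {V : lmodType R} E (T : 'I_n -> 'I_n -> V) (x y : 'I_n) : V :=
  \sum_i \sum_j (E x i * E y j) *: T i j.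

Lemma in_frame_skew {V : lmodType R} E (T : 'I_n -> 'I_n -> V) x y :
  (forall i j, T j i = - T i j) -> in_frame E T y x = - in_frame E T x y.
Proof.
move=> TT; rewrite /in_frame exchange_big -sumrN; apply: eq_bigr => i _.
by rewrite -sumrN; apply: eq_bigr => j _; rewrite TT mulrC scalerN.
Qed.

Lemma in_frame_map {V W : lmodType R} (L : V -> W) E (T : 'I_n -> 'I_n -> V) x y :
  linear L -> L (in_frame E T x y) = in_frame E (fun i j => L (T i j)) x y.
Proof.
move=> linL; have LD u v : L (u + v) = L u + L v by rewrite -[u]scale1r linL !scale1r.
have L0 : L 0 = 0 by apply: (addrI (L 0)); rewrite -LD !addr0.
have LZ t u : L (t *: u) = t *: L u by rewrite -[t *: u]addr0 linL L0 addr0.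
rewrite /in_frame (big_morph L LD L0); apply: eq_bigr => i _.
by rewrite (big_morph L LD L0); apply: eq_bigr => j _; exact: LZ.
Qed.

Lemma in_frame_mx E (T : 'M[R]_n) x y : in_frame E (fun i j => T i j : R^o) x y = (E *m T *m E^T) x y.
Proof.
rewrite /in_frame mxE exchange_big; apply: eq_bigr => j _.
rewrite mxE [E^T _ _]mxE mulr_suml; apply: eq_bigr => i _.
by rewrite /GRing.scale /= mulrAC.
Qed.

(** The first two slots of Om are coordinate indices, while its rows already refer to the frame.
    Inserting E B = 1 gives the row index a coordinate expression too, and the three terms become
    rotations of one triple sum. *)
Lemma in_frame_bianchi E (B : 'M[R]_n) (Om : 'I_n -> 'I_n -> 'M[R]_n) x y z b :
  E *m B = 1%:M ->
  (forall i j k, row k B *m Om i j + row i B *m Om j k + row j B *m Om k i = 0) ->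
  in_frame E Om x y z b + in_frame E Om y z x b + in_frame E Om z x y b = 0.
Proof.
move=> EB bianchi; pose T i j k := (row k B *m Om i j) 0 b.
have TE u v w : in_frame E Om u v w b = \sum_i \sum_j \sum_k E u i * E v j * E w k * T i j k.
  rewrite /in_frame summxE; apply: eq_bigr => i _; rewrite summxE; apply: eq_bigr => j _.
  rewrite [LHS]mxE; under [RHS]eq_bigr do rewrite -mulrA; rewrite -mulr_sumr; congr (_ * _).
  have -> : Om i j = E *m B *m Om i j by rewrite EB mul1mx.
  rewrite -mulmxA [LHS]mxE; apply: eq_bigr => k _; congr (_ * _).
  by rewrite /T -row_mul [RHS]mxE.
rewrite !TE.
have -> : \sum_i \sum_j \sum_k E y i * E z j * E x k * T i j k =
    \sum_i \sum_j \sum_k E x i * E y j * E z k * T j k i.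
  rewrite [RHS]exchange_big; apply: eq_bigr => j _; rewrite [RHS]exchange_big.
  apply: eq_bigr => k _; apply: eq_bigr => i _; ring.
have -> : \sum_i \sum_j \sum_k E z i * E x j * E y k * T i j k =
    \sum_i \sum_j \sum_k E x i * E y j * E z k * T k i j.
  under [RHS]eq_bigr do rewrite exchange_big; rewrite [RHS]exchange_big.
  apply: eq_bigr => i _; apply: eq_bigr => j _; apply: eq_bigr => k _; ring.
rewrite -!big_split big1 // => i _ /=; rewrite -!big_split big1 // => j _ /=.
rewrite -!big_split big1 // => k _ /=; rewrite -!mulrDr /T.
have /rowP/(_ b) := bianchi i j k; rewrite !mxE => ->.
by rewrite mulr0.
Qed.

End FrameChange.
Section CurvatureInFrame.
Context {R : realType} {n : nat} {M : manifold R n}.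
Context (G : M -> 'M[R]_n) (GM : is_metric (TM M) G).
Context (nabla : connection M n) (LC : is_levi_civita G nabla).
Context (p : M) (U : set M) (oU : open U) (Up : U p) (Uc : U `<=` cdom (chart_at p)).
Context (e : M -> 'M[R]_n) (se : smooth_frame (TM M) U e)
  (one : forall q, U q -> Defs.orthonormal G q (e q)).
Local Notation c := (chart_at p).
Local Notation Om i j := (curv_form nabla c G e i j p).
Local Notation B := (\matrix_(i, a) coframe G c e i a p).
Local Notation OmE := (in_frame (e p) (fun i j => Om i j)).

(** At p itself the coordinate frame of [chart_at p] is the identity. *)
Lemma coframe_at : B = G p *m (e p)^T.
Proof.
rewrite coframeE; suff -> : coord_frame c p = 1%:M by rewrite mul1mx.
by apply/row_matrixP => i; rewrite rowK row1; exact: del_at.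
Qed.

Lemma frame_coframe : e p *m B = 1%:M.
Proof. by rewrite coframe_at mulmxA; exact: one. Qed.

Lemma row_coframe i : row i B = \row_a coframe G c e i a p.
Proof. by apply/rowP => a; rewrite !mxE. Qed.

Lemma frame_bianchi x y z b : OmE x y z b + OmE y z x b + OmE z x y b = 0.
Proof.
apply: (@in_frame_bianchi R n (e p) B (fun i j => Om i j) x y z b frame_coframe) => i j k.
rewrite !row_coframe.
exact: (curvature_bianchi GM LC oU Uc se one i j k Up).
Qed.

(** The trace defining Ric is taken in the coordinate basis; since the coframe matrix is inverse to
    e, it may be taken in the orthonormal frame instead. *)
Lemma ricci_in_frame b x :
  (e p *m ricci_form nabla p *m (e p)^T) b x = \sum_y OmE y b x y.
Proof.
have ricE i j : ricci_form nabla p i j = \sum_k (row j B *m Om k i *m e p) 0 k.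
  rewrite mxE; apply: eq_bigr => k _; rewrite row_coframe.
  by rewrite -(curvature_del GM LC oU Uc se one k i j Up).
have H i : \sum_j e p x j * ricci_form nabla p i j = \sum_k (Om k i *m e p) x k.
  under eq_bigr do rewrite ricE mulr_sumr; rewrite exchange_big; apply: eq_bigr => k _.
  transitivity ((e p *m (B *m (Om k i *m e p))) x k).
    by rewrite mxE; apply: eq_bigr => j _; rewrite -mulmxA -row_mul [X in _ * X]mxE.
  by rewrite mulmxA frame_coframe mul1mx.
rewrite mxE; transitivity (\sum_i e p b i * \sum_j e p x j * ricci_form nabla p i j).
  under eq_bigr do rewrite [X in X * _]mxE mulr_suml.
  rewrite exchange_big; apply: eq_bigr => i _; rewrite mulr_sumr.
  by apply: eq_bigr => j _; rewrite [X in _ * X]mxE; ring.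
under eq_bigr do rewrite H mulr_sumr.
rewrite exchange_big; under [RHS]eq_bigr do rewrite summxE.
transitivity (\sum_k \sum_i \sum_y e p y k * e p b i * Om k i x y).
  apply: eq_bigr => k _; apply: eq_bigr => i _; rewrite [X in _ * X]mxE mulr_sumr.
  by apply: eq_bigr => y _; ring.
under [LHS]eq_bigr do rewrite exchange_big.
rewrite [LHS]exchange_big.
apply: eq_bigr => y _; apply: eq_bigr => k _; rewrite summxE.
by apply: eq_bigr => i _; rewrite [RHS]mxE.
Qed.

End CurvatureInFrame.

Section ThetaInFrame.
Context {R : realType} {n d : nat} {M : manifold R n} {F : vbundle M d}.
Context (oF : forall Vb, F Vb -> open Vb.1).
Context (G : M -> 'M[R]_d) (GF : is_metric F G).
Context (nabla : connection M d) (nablaG : is_metric_connection F G nabla).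
Context (p : M) (U : set M) (oU : open U) (Up : U p) (Uc : U `<=` cdom (chart_at p)).
Context (f : M -> 'M[R]_d) (sf : smooth_frame F U f)
  (onf : forall q, U q -> Defs.orthonormal G q (f q)).
Local Notation c := (chart_at p).
Local Notation Om i j := (curv_form nabla c G f i j p).

Lemma in_frame_curv_skew (E : 'M[R]_n) x y :
  in_frame E (fun i j => Om i j) y x = - in_frame E (fun i j => Om i j) x y.
Proof.
apply: in_frame_skew => i j; apply/matrixP => s t; rewrite [RHS]mxE.
exact: curv_form_skew.
Qed.

Lemma in_frame_curv_antisym (E : 'M[R]_n) x y :
  (in_frame E (fun i j => Om i j) x y)^T = - in_frame E (fun i j => Om i j) x y.
Proof.
rewrite /in_frame raddf_sum -sumrN; apply: eq_bigr => i _ /=.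
rewrite raddf_sum -sumrN; apply: eq_bigr => j _ /=; rewrite linearZ -scalerN; congr (_ *: _).
apply/matrixP => a b; rewrite mxE [RHS]mxE.
exact: (curv_form_antisym (proj1 nablaG) oU Uc GF nablaG sf onf).
Qed.

Lemma curvature_del_frame (V : set M) (s : M -> 'rV[R]_d) i j :
  open V -> V p -> smooth_section F V s ->
  curvature nabla (del p i) (del p j) s p = s p *m (G p *m (f p)^T) *m Om i j *m f p.
Proof.
move=> oV Vp ss; pose O := U `&` V.
have oO : open O by apply: openI.
have Oc : O `<=` cdom c by move=> q [/Uc].
have sO : smooth_section F O s by apply: smooth_section_sub ss => q [].
have sfO : smooth_frame F O f by move=> a; apply: smooth_section_sub (sf a) => q [].
have onO q : O q -> Defs.orthonormal G q (f q) by move=> [/onf].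
have Op : O p by [].
rewrite (curvature_coord_field (proj1 nablaG) oO Oc i j sO Op) -coeffE.
exact: (curvature_coeff oF (proj1 nablaG) oO Oc GF sfO onO i j sO Op).
Qed.

Context (V : set M) (h : M -> 'M[R]_d) (Vh : orthonormal_frame F G V h) (Vp : V p).
Local Notation H := (h p *m (G p *m (f p)^T)).

(** [H] holds the components, in the frame f below the atlas section, of the arbitrary orthonormal
    frame h. *)
Lemma frame_change_orthogonal : H *m H^T = 1%:M.
Proof.
have [_ _ /(_ p Vp) onh] := Vh; have [GT _ _] := GF.
rewrite !trmx_mul trmxK GT -!mulmxA (mulmxA _ (f p)) (mulmxA (G p)).
by rewrite (mulmxA (G p) (f p)^T) (frame_inv onf Up) mul1mx mulmxA; exact: onh.
Qed.

Lemma Theta_in_frame E k l y x :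
  (E *m Theta_form G nabla p (fun q => row k (h q)) (fun q => row l (h q)) *m E^T) y x =
  (row k H *m in_frame E (fun i j => Om i j) y x *m (row l H)^T) 0 0.
Proof.
have [oV sh _] := Vh; have [GT _ _] := GF.
pose L (A : 'M[R]_d) : R^o := (row k H *m A *m (row l H)^T) 0 0.
have linL : linear L.
  by move=> t A B; rewrite /L mulmxDr mulmxDl -scalemxAr -scalemxAl !mxE.
rewrite -[RHS]/(L _) (in_frame_map _ _ _ _ linL) -in_frame_mx; congr in_frame.
apply/funext => i; apply/funext => j; rewrite /L mxE /ip.
rewrite (curvature_del_frame i j oV Vp (sh k)) !(row_mul _ (h p)).
by move: (row l _) => u; rewrite !trmx_mul trmxK GT !mulmxA.
Qed.

End ThetaInFrame.

Section ComplexFrame.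
Context {R : realType}.
Local Notation C := R[i].

Lemma in_frame_mapC {n} {V : lmodType R} {W : lmodType C} (L : V -> W) (E : 'M[R]_n) T x y :
  (forall u v, L (u + v) = L u + L v) -> (forall (t : R) u, L (t *: u) = t%:C *: L u) ->
  L (in_frame E T x y) = \sum_i \sum_j (E x i * E y j)%:C *: L (T i j).
Proof.
move=> LD LZ; have L0 : L 0 = 0 by apply: (addrI (L 0)); rewrite -LD !addr0.
rewrite /in_frame (big_morph L LD L0); apply: eq_bigr => i _.
by rewrite (big_morph L LD L0); apply: eq_bigr => j _; exact: LZ.
Qed.

Lemma kappa_vec_frame {n} (k : spin_rep R n) (E A : 'M[R]_n) b : E *m A = 1%:M ->
  \sum_i (E b i)%:C *: kappa_vec k (row i A) = k b.
Proof.
move=> EA; rewrite -[RHS]kappa_vec_delta -row1 -EA row_mul mulmx_sum_row.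
have k0 : kappa_vec k 0 = 0 by apply: (addrI (kappa_vec k 0)); rewrite -kappa_vecD !addr0.
rewrite (big_morph _ (@kappa_vecD _ _ k) k0); apply: eq_bigr => i _.
by rewrite kappa_vecZ mxE.
Qed.

Lemma frame_sum_mulmx {n p} (E : 'M[R]_n) (X Y : 'I_n -> 'M[C]_p) x y :
  \sum_i \sum_j (E x i * E y j)%:C *: (X i *m Y j) =
  (\sum_i (E x i)%:C *: X i) *m (\sum_j (E y j)%:C *: Y j).
Proof.
rewrite mulmx_suml; apply: eq_bigr => i _; rewrite mulmx_sumr; apply: eq_bigr => j _.
by rewrite -scalemxAl -scalemxAr scalerA rmorphM.
Qed.

End ComplexFrame.

(** * Ricci curvature in the frame below a local section *)

Section KillingRicci.
Context {R : realType} {n r m : nat} {M : manifold R n}.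
Local Notation C := R[i].
Local Notation spinor := (spinor R n r m).
Context (g : M -> 'M[R]_n) (g_metric : is_metric (TM M) g).
Context (nablaM : connection M n) (nablaM_LC : is_levi_civita g nablaM).
Context (F : vbundle M r) (F_vbundle : is_vbundle F).
Context (gF : M -> 'M[R]_r) (gF_metric : is_metric F gF).
Context (nablaF : connection M r) (nablaF_metric : is_metric_connection F gF nablaF).
Context (grp : spin_group) (oM oF : M -> bool) (Q : spin_bundle M r).
Context (Q_spin : is_spin_bundle grp g oM F gF oF Q).
Context (kn : spin_rep R n) (kn_rep : is_spin_rep kn).
Context (kr : spin_rep R r) (kr_rep : is_spin_rep kr).
Context (phi : Q -> spinor) (phi_section : spinor_section kn kr phi).
Context (mu : R) (phi_killing : is_killing kn kr g nablaM gF nablaF mu phi).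

Lemma eta_in_frame (q : Q) u w b y :
  (pfrT q *m eta_form kn kr g phi q u w *m (pfrT q)^T) b y =
  eta_frame kn (phi q) b y
    (kappa_vec kr (u *m invmx (pfrF q)) *m kappa_vec kr (w *m invmx (pfrF q))).
Proof.
have [_ /(_ q)[onE _ _ _] _ _] := Q_spin.
have uE := orthonormal_unit onE; set E := pfrT q in onE uE *.
rewrite -in_frame_mx /eta_frame.
pose X i j := cliffT kn q 'e_i *m cliffT kn q 'e_j + ((ip g (pbase q) 'e_i 'e_j)%:C)%:M.
have -> : kn b *m kn y + ((b == y)%:R)%:M = \sum_i \sum_j (E b i * E y j)%:C *: X i j.
  under eq_bigr do under eq_bigr do rewrite scalerDr.
  under eq_bigr do rewrite big_split; rewrite big_split; congr (_ + _).
    rewrite (frame_sum_mulmx E (fun i => cliffT kn q 'e_i) (fun j => cliffT kn q 'e_j)).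
    have cE z : \sum_i (E z i)%:C *: cliffT kn q 'e_i = kn z.
      under eq_bigr do rewrite /cliffT -rowE.
      exact: kappa_vec_frame (mulmxV uE).
    by rewrite !cE.
  (* The scalar term: E g E^T = 1 turns the Gram matrix of the coordinate basis into the Kronecker
     delta. *)
  pose L (t : R^o) : 'M[C]_(2 ^ n./2) := (t%:C)%:M.
  transitivity (L (in_frame E (fun i j => g (pbase q) i j : R^o) b y)).
    rewrite in_frame_mx onE /L !mxE; congr (_%:M).
    by case: (b == y); rewrite ?rmorph1 ?rmorph0.
  rewrite (in_frame_mapC (L := L)).
  - apply: eq_bigr => i _; apply: eq_bigr => j _; congr (_ *: L _).
    by rewrite /ip -rowE trmx_delta -colE !mxE.
  - by move=> s t; rewrite /L rmorphD raddfD.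
  - by move=> s t; rewrite /L scale_scalar_mx -rmorphM.
rewrite act_left_suml hermR_suml /in_frame; apply: eq_bigr => i _.
rewrite act_left_suml hermR_suml; apply: eq_bigr => j _.
by rewrite act_leftZl hermRZl; congr (_ * _); rewrite mxE.
Qed.

Context (Us : set M * (M -> Q)) (Q_Us : patlas Q Us) (p : M) (Usp : Us.1 p).
Local Notation c := (chart_at p).
Local Notation U := (Us.1 `&` cdom c).
Local Notation e := (fun q => pfrT (Us.2 q)).
Local Notation f := (fun q => pfrF (Us.2 q)).
Local Notation E := (pfrT (Us.2 p)).
Local Notation OmE := (in_frame E (fun i j => curv_form nablaM c g e i j p)).
Local Notation OmFE := (in_frame E (fun i j => curv_form nablaF c gF f i j p)).
Local Notation psi := (phi (Us.2 p)).

Let oU : open U := open_atlas_chart Q_spin Q_Us c.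
Let Uc : U `<=` cdom c := @atlas_chart_sub R n r M Q Us c.
Let Up : U p := conj Usp (chart_atP p).
Let se : smooth_frame (TM M) U e := smooth_pfrT Q_spin Q_Us c.
Let sf : smooth_frame F U f := smooth_pfrF Q_spin Q_Us c.
Let one : forall q, U q -> Defs.orthonormal g q (e q) := @orthonormal_pfrT _ _ _ _ _ _ _ _ _ _ _ Q_spin _ Q_Us c.
Let onf : forall q, U q -> Defs.orthonormal gF q (f q) := @orthonormal_pfrF _ _ _ _ _ _ _ _ _ _ _ Q_spin _ Q_Us c.
Let nablaM_conn : is_connection (TM M) nablaM := proj1 (proj1 nablaM_LC).
Let nablaF_conn : is_connection F nablaF := proj1 nablaF_metric.

Lemma killing_curvature i j :
  act_left (spin_lie kn (curv_form nablaM c g e i j p)) psi +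
  dop (spin_lie kr (curv_form nablaF c gF f i j p)) psi =
  (mu ^+ 2)%:C *: act_left
    (kappa_vec kn (\row_a coframe g c e j a p) *m kappa_vec kn (\row_a coframe g c e i a p) -
     kappa_vec kn (\row_a coframe g c e i a p) *m kappa_vec kn (\row_a coframe g c e j a p)) psi.
Proof.
apply: (@killing_integrability _ _ _ _ _ kn kn_rep kr kr_rep c U oU Uc (fun q => phi (Us.2 q))
  (smooth_atlas_spinor phi_section Q_Us c) mu (fun i q => \row_a coframe g c e i a q)
  (conn_form nablaM c g e) (conn_form nablaF c gF f) _ _ _ _ _ _ _ i j p Up) => {i j}.
- move=> i a; apply: smooth_on_congr (smooth_coframe g_metric oU Uc se i a) => // q _.
  by rewrite mxE.
- by move=> i a b; exact: (smooth_conn_form nablaM_conn oU Uc g_metric se).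
- by move=> i a b; exact: (smooth_conn_form nablaF_conn oU Uc gF_metric sf).
- by move=> i q Uq; exact: (conn_formT_antisym g_metric nablaM_LC Q_spin Q_Us i Uq).
- by move=> i q Uq; exact: (conn_formF_antisym gF_metric nablaF_metric Q_spin Q_Us i Uq).
- move=> i j q Uq.
  have H k l : \row_a pd c 'e_l (fun p0 => (\row_a0 coframe g c e k a0 p0) 0 a) q +
      (\row_a coframe g c e k a q) *m conn_form nablaM c g e l q =
      \row_a (pd c 'e_l (coframe g c e k a) q +
        \sum_b coframe g c e k b q * conn_form nablaM c g e l q b a).
    apply/rowP => a; rewrite [LHS]mxE [RHS]mxE; congr (_ + _).
      by rewrite mxE; congr pd; apply/funext => t; rewrite mxE.
    by rewrite mxE; apply: eq_bigr => b _; rewrite mxE.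
  apply: (etrans (H i j)); apply: (etrans _ (esym (H j i))); apply: eq_mx => _ a.
  exact: (coframe_torsion g_metric nablaM_LC oU Uc se one i j a Uq).
- move=> i q Uq.
  exact: (killing_spd g_metric nablaM_LC gF_metric nablaF_metric Q_spin kn_rep kr_rep phi_section phi_killing Q_Us i Uq).
Qed.

Lemma killing_curvature_frame x y :
  act_left (spin_lie kn (OmE x y)) psi + dop (spin_lie kr (OmFE x y)) psi =
  (mu ^+ 2)%:C *: act_left (kn y *m kn x - kn x *m kn y) psi.
Proof.
rewrite (in_frame_mapC (L := fun W => act_left (spin_lie kn W) psi)) => [||t W]; last 2 first.
- by move=> W W'; rewrite spin_lieD act_leftDl.
- by rewrite spin_lieZ act_leftZl.
rewrite (in_frame_mapC (L := fun W => dop (spin_lie kr W) psi)) => [||t W]; last 2 first.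
- by move=> W W'; rewrite spin_lieD dopDl.
- by rewrite spin_lieZ dopZl.
pose b i := kappa_vec kn (\row_a coframe g c e i a p).
transitivity (\sum_i \sum_j (E x i * E y j)%:C *:
    ((mu ^+ 2)%:C *: act_left (b j *m b i - b i *m b j) psi)).
  rewrite -big_split; apply: eq_bigr => i _; rewrite -big_split; apply: eq_bigr => j _.
  by rewrite -killing_curvature scalerDr.
have bE z : \sum_i (E z i)%:C *: b i = kn z.
  rewrite -(kappa_vec_frame kn z (frame_coframe Up one)); apply: eq_bigr => i _.
  by rewrite row_coframe.
have <- : \sum_i \sum_j (E x i * E y j)%:C *: (b j *m b i - b i *m b j) = kn y *m kn x - kn x *m kn y.
  under eq_bigr do under eq_bigr do rewrite scalerBr.
  under eq_bigr do rewrite big_split; rewrite big_split; congr (_ + _).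
    rewrite exchange_big -!bE -frame_sum_mulmx.
    by apply: eq_bigr => i _; apply: eq_bigr => j _; rewrite mulrC.
  rewrite -!bE -frame_sum_mulmx -sumrN; apply: eq_bigr => i _; rewrite -sumrN.
  by apply: eq_bigr => j _.
rewrite act_left_suml scaler_sumr; apply: eq_bigr => i _.
rewrite act_left_suml scaler_sumr; apply: eq_bigr => j _.
by rewrite act_leftZl !scalerA mulrC.
Qed.

(** The contraction over y is the matrix product of eta and Theta in this order. For matrices acting
    on the right it represents the composite of eta followed by Theta. *)
Lemma killing_ricci_mx (V : set M) (h : M -> 'M[R]_r) :
  orthonormal_frame F gF V h -> V p ->
  norm2 phi (Us.2 p) *: (E *m ricci_form nablaM p *m E^T) =
  (4 * (n%:R - 1) * mu ^+ 2 * norm2 phi (Us.2 p))%:M +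
  \sum_(k < r) \sum_(l < r | (k < l)%N)
    (E *m eta_form kn kr g phi (Us.2 p) (row k (h p)) (row l (h p)) *m E^T) *m
    (E *m Theta_form gF nablaF p (fun q => row k (h q)) (fun q => row l (h q)) *m E^T).
Proof.
move=> Vh Vp; apply/matrixP => b x.
have oFV := open_vbundle F_vbundle.
have HH := frame_change_orthogonal gF_metric Up onf Vh Vp.
have iF : invmx (pfrF (Us.2 p)) = gF p *m (pfrF (Us.2 p))^T.
  apply: (can_inj (mulmxK (frame_unit onf Up))).
  by rewrite (frame_inv onf Up) mulVmx // (frame_unit onf Up).
rewrite mxE (ricci_in_frame g_metric nablaM_LC oU Up Uc se one).
have := @killing_ricci R n r m kn kn_rep kr kr_rep (fun x y => OmE x y) (fun x y => OmFE x y)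
   _ _ _ _ _ mu psi killing_curvature_frame b x _ HH.
rewrite -/(norm2 phi (Us.2 p)) => ->.
- rewrite [RHS]mxE; congr (_ + _); first by rewrite mxE mulr_natr.
  rewrite summxE; apply: eq_bigr => k _; rewrite summxE; apply: eq_bigr => l _.
  rewrite [RHS]mxE; apply: eq_bigr => y _; congr (_ * _).
    by rewrite (eta_in_frame (Us.2 p)) iF -!(row_mul _ (h p)).
  by rewrite (Theta_in_frame oFV gF_metric nablaF_metric oU Up Uc sf onf Vh Vp).
- by move=> x' y' s t; rewrite in_frame_curv_skew mxE.
- move=> x' y' s t.
  have /matrixP/(_ s t) := in_frame_curv_antisym g_metric (proj1 nablaM_LC) oU Up Uc se one E x' y'.
  by rewrite mxE [RHS]mxE.
- by move=> x' y' z' s; exact: (frame_bianchi g_metric nablaM_LC oU Up Uc se one).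
- by move=> x' y'; exact: in_frame_curv_skew.
- move=> x' y'.
  exact: (in_frame_curv_antisym gF_metric nablaF_metric oU Up Uc sf onf E x' y').
Qed.

End KillingRicci.

(** * Ricci curvature *)

Section Conclusion.
Context {R : realType} {n r m : nat} {M : manifold R n}.
Local Notation spinor := (spinor R n r m).
Context (M_connected : connected [set: M]).
Context (g : M -> 'M[R]_n) (g_metric : is_metric (TM M) g).
Context (nablaM : connection M n) (nablaM_LC : is_levi_civita g nablaM).
Context (F : vbundle M r) (F_vbundle : is_vbundle F).
Context (gF : M -> 'M[R]_r) (gF_metric : is_metric F gF).
Context (nablaF : connection M r) (nablaF_metric : is_metric_connection F gF nablaF).
Context (grp : spin_group) (oM oF : M -> bool) (Q : spin_bundle M r).
Context (Q_spin : is_spin_bundle grp g oM F gF oF Q).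
Context (kn : spin_rep R n) (kn_rep : is_spin_rep kn).
Context (kr : spin_rep R r) (kr_rep : is_spin_rep kr).
Context (phi : Q -> spinor) (phi_section : spinor_section kn kr phi).
Context (phi_neq0 : exists q, phi q != 0).
Context (mu : R) (phi_killing : is_killing kn kr g nablaM gF nablaF mu phi).

Lemma norm2_locally_constant (q : Q) :
  \forall p \near pbase q, forall q' : Q, pbase q' = p -> norm2 phi q' = norm2 phi q.
Proof.
have [_ _ _ [atlas baseP _ _]] := Q_spin.
have [Us QUs Usq] := atlas (pbase q).
have [_ base] := baseP _ QUs.
pose c := chart_at (pbase q); pose U := Us.1 `&` cdom c.
have oU : open U := open_atlas_chart Q_spin QUs c.
have Uq : U (pbase q) by split => //; exact: chart_atP.
have sN : smooth_on U (fun p => norm2 phi (Us.2 p)) := smooth_norm2 Q_spin phi_section QUs c.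
have pd0 p : U p -> cdom c p -> forall i, pd c 'e_i (fun p => norm2 phi (Us.2 p)) p = 0.
  move=> Up _ i.
  exact: (pd_norm2_eq0 g_metric nablaM_LC gF_metric nablaF_metric Q_spin kn_rep kr_rep phi_section phi_killing QUs i Up).
have fib q1 q2 : pbase q1 = pbase q2 -> norm2 phi q1 = norm2 phi q2.
  by move=> E; exact: (proj1 (spin_fibre kn_rep kr_rep phi_section Q_spin E)).
have := pd0_near_cst oU Uq Uq.2 sN pd0.
have := open_nbhs_nbhs (conj oU Uq).
move: (nbhs_filter (pbase q)) => Fp; apply: filterS2 => p [Usp _] E q' q'p.
by rewrite (fib q' (Us.2 p)) ?base // E; apply: fib; rewrite base.
Qed.

Lemma norm2_neq0 (q : Q) : norm2 phi q != 0.
Proof.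
have [_ _ _ [atlas baseP _ _]] := Q_spin.
have [q0 q0N] := phi_neq0.
(* The points where the norm has the same value as at q0. Quantifying over all lifts makes this a
   set of points of M; it is shown to be open and closed. *)
pose A := [set p : M | forall q' : Q, pbase q' = p -> norm2 phi q' = norm2 phi q0].
have fib q1 q2 : pbase q1 = pbase q2 -> norm2 phi q1 = norm2 phi q2.
  by move=> E; exact: (proj1 (spin_fibre kn_rep kr_rep phi_section Q_spin E)).
have ex p : exists q' : Q, pbase q' = p.
  have [Us QUs Usp] := atlas p; have [_ base] := baseP _ QUs.
  by exists (Us.2 p); exact: base.
have AT : A = [set: M].
  apply: M_connected.
  - by exists (pbase q0) => q' E; apply: fib.
  - exists A; last by rewrite setTI.
    rewrite openE => p Ap; have [q' q'p] := ex p; subst p.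
    apply: filterS (norm2_locally_constant q') => p H q1 q1p.
    by rewrite (H q1 q1p); apply: Ap.
  (* Closed: near a point outside A the norm keeps its value, which differs from the one at q0. *)
  - exists A; last by rewrite setTI.
    rewrite -[A]setCK closedC openE => p Ap; have [q' q'p] := ex p; subst p.
    apply: filterS (norm2_locally_constant q') => p H Ap'; apply: Ap => q1 q1p.
    have [q2 q2p] := ex p.
    by rewrite (fib q1 q' q1p) -(H q2 q2p); apply: Ap'.
have Aq : A (pbase q) by rewrite AT.
rewrite (Aq q erefl); apply: contra q0N => /eqP /hermR_eq0 ->; exact: eqxx.
Qed.

Lemma killing_Ric (q : Q) (U : set M) (f : M -> 'M[R]_r) :
  orthonormal_frame F gF U f -> U (pbase q) ->
  let p := pbase q in
  Ric g nablaM p =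
    (4 * (n%:R - 1) * mu ^+ 2)%:M +
    (norm2 phi q)^-1 *: \sum_(k < r) \sum_(l < r | (k < l)%N)
      endo_comp
        (sharp g p (Theta_form gF nablaF p (fun x => row k (f x)) (fun x => row l (f x))))
        (sharp g p (eta_form kn kr g phi q (row k (f p)) (row l (f p)))).
Proof.
move=> Uf Up p.
have [_ orth _ [atlas baseP _ _]] := Q_spin.
have [Us QUs Usp] := atlas p; have [_ base] := baseP _ QUs.
have bp : pbase q = pbase (Us.2 p) by rewrite base.
have [nE etaE] := spin_fibre kn_rep kr_rep phi_section Q_spin bp.
have N0 := norm2_neq0 q.
have := killing_ricci_mx g_metric nablaM_LC F_vbundle gF_metric nablaF_metric Q_spin
  kn_rep kr_rep phi_section phi_killing QUs Usp Uf Up.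
rewrite -nE; set E := pfrT (Us.2 p).
have onE : E *m g p *m E^T = 1%:M by have [+ _ _ _] := orth (Us.2 p); rewrite base.
have iE : E *m (g p *m E^T) = 1%:M by rewrite mulmxA.
have iE' : (g p *m E^T) *m E = 1%:M by apply: mulmx1C.
have ig : invmx (g p) = E^T *m E.
  have gE : g p *m (E^T *m E) = 1%:M by rewrite mulmxA.
  have [ug _] := mulmx1_unit gE.
  by rewrite -[RHS](mulKmx ug) gE mulmx1.
(* g E^T is inverse to E and E^T E is inverse to g, so this takes a form expressed in the
   orthonormal frame to the endomorphism that [sharp] assigns to it. *)
have conj A : (g p *m E^T) *m (E *m A *m E^T) *m E = A *m invmx (g p).
  by rewrite !mulmxA iE' mul1mx -mulmxA ig.
move=> /(congr1 (fun X => (norm2 phi q)^-1 *: ((g p *m E^T) *m X *m E))).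
rewrite -scalemxAr -scalemxAl scalerA mulVf // scale1r conj -/(sharp g p _) -/(Ric g nablaM p) => ->.
rewrite mulmxDr mulmxDl scalerDr; congr (_ + _).
  rewrite -scalemx1 -scalemxAr mulmx1 -scalemxAl iE' scalerA scalemx1; congr (_%:M).
  by rewrite mulrC mulfK.
congr (_ *: _); rewrite mulmx_sumr mulmx_suml; apply: eq_bigr => k _.
rewrite mulmx_sumr mulmx_suml; apply: eq_bigr => l _.
rewrite /endo_comp /sharp -etaE -(conj (eta_form _ _ _ _ _ _ _)) -(conj (Theta_form _ _ _ _ _)).
(* Between the two conjugated factors E g E^T = 1 appears and disappears. *)
by rewrite -!mulmxA (mulmxA E (g p)) (mulmxA (E *m g p)) onE mul1mx.
Qed.

End Conclusion.

Theorem theorem3p2 (R : realType) (n r m : nat) (r_ge2 : (2 <= r)%N)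
    (M : manifold R n) (M_connected : connected [set: M])
    (g : M -> 'M[R]_n) (g_metric : is_metric (TM M) g)
    (oM : M -> bool) (oM_orientation : is_orientation (TM M) oM)
    (F : vbundle M r) (F_vbundle : is_vbundle F)
    (gF : M -> 'M[R]_r) (gF_metric : is_metric F gF)
    (oF : M -> bool) (oF_orientation : is_orientation F oF)
    (nablaM : connection M n) (nablaM_LC : is_levi_civita g nablaM)
    (nablaF : connection M r) (nablaF_metric : is_metric_connection F gF nablaF)
    (P : spin_bundle M r) (P_spinr : is_spin_bundle SpinR g oM F gF oF P)
    (* the structure with which the spinor bundle S is associated *)
    (grp : spin_group) (Q : spin_bundle M r)
    (Q_spin : is_spin_bundle grp g oM F gF oF Q) (Q_P : grp = SpinR -> Q = P)
    (S_defined : globally_defined grp m)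
    (kn : spin_rep R n) (kn_rep : is_spin_rep kn)
    (kr : spin_rep R r) (kr_rep : is_spin_rep kr)
    (phi : Q -> spinor R n r m) (phi_section : spinor_section kn kr phi)
    (phi_neq0 : exists q, phi q != 0)
    (mu : R) (phi_killing : is_killing kn kr g nablaM gF nablaF mu phi) :
  [/\ forall (q : Q) (U : set M) (f : M -> 'M[R]_r),
        orthonormal_frame F gF U f -> U (pbase q) ->
        let p := pbase q in
        Ric g nablaM p =
          (4 * (n%:R - 1) * mu ^+ 2)%:M +
          (norm2 phi q)^-1 *: \sum_(k < r) \sum_(l < r | (k < l)%N)
            endo_comp
              (sharp g p (Theta_form gF nablaF p (fun x => row k (f x))
                                            (fun x => row l (f x))))
              (sharp g p (eta_form kn kr g phi q (row k (f p)) (row l (f p)))),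
      forall (q : Q) (U : set M) (f : M -> 'M[R]_r),
        orthonormal_frame F gF U f -> U (pbase q) ->
        let p := pbase q in
        scalar_curvature g nablaM p =
          4 * n%:R * (n%:R - 1) * mu ^+ 2 +
          (norm2 phi q)^-1 * \sum_(k < r) \sum_(l < r | (k < l)%N)
            \tr (endo_comp
              (sharp g p (Theta_form gF nablaF p (fun x => row k (f x))
                                            (fun x => row l (f x))))
              (sharp g p (eta_form kn kr g phi q (row k (f p)) (row l (f p))))),
      is_flat F nablaF -> is_einstein g nablaM &
      (forall (q : Q) (U : set M) (f : M -> 'M[R]_r),
         orthonormal_frame F gF U f -> U (pbase q) ->
         forall k l : 'I_r, (k < l)%N ->
         eta_form kn kr g phi q (row k (f (pbase q))) (row l (f (pbase q))) = 0) ->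
      is_einstein g nablaM].
Proof.
have RicE q U f := @killing_Ric R n r m M M_connected g g_metric nablaM nablaM_LC F F_vbundle
  gF gF_metric nablaF nablaF_metric grp oM oF Q Q_spin kn kn_rep kr kr_rep phi phi_section
  phi_neq0 mu phi_killing q U f.
have [_ _ _ [atlas baseP frames _]] := Q_spin.
have [_ orth _ _] := Q_spin.
(* Every point lies in the domain of an atlas section, whose frame of F lets the Ricci formula be
   evaluated there; parts 3 and 4 use this frame. *)
have frame Us : patlas Q Us -> orthonormal_frame F gF Us.1 (fun x => pfrF (Us.2 x)).
  move=> QUs; have [oU base] := baseP _ QUs; have [_ sF] := frames _ QUs.
  by split=> // x Ux; have [_ _ + _] := orth (Us.2 x); rewrite base.
split.
- exact: RicE.
- move=> q U f Uf Up p.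
  rewrite /scalar_curvature (RicE q U f Uf Up) mxtraceD mxtrace_scalar mxtraceZ.
  congr (_ + _ * _); first by rewrite -mulr_natr; ring.
  by rewrite raddf_sum; apply: eq_bigr => k _ /=; rewrite raddf_sum.
(* Only the scalar term of the Ricci formula survives, and its coefficient is the same at every
   point. *)
- move=> flat; exists (4 * (n%:R - 1) * mu ^+ 2) => p.
  have [Us QUs Usp] := atlas p; have [oU base] := baseP _ QUs; have [_ sF] := frames _ QUs.
  have Up : Us.1 (pbase (Us.2 p)) by rewrite base.
  have := RicE _ _ _ (frame _ QUs) Up; rewrite base //= => ->.
  rewrite big1 ?scaler0 ?addr0 // => k _; rewrite big1 // => l _.
  set T := Theta_form _ _ _ _ _; suff -> : T = 0 by rewrite /endo_comp /sharp mul0mx mulmx0.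
  apply/matrixP => i j; rewrite mxE [RHS]mxE.
  (* [is_flat] concerns fields smooth on a common open set: the frame lives on [Us.1], the
     coordinate fields on the domain of [chart_at p]. *)
  pose O := Us.1 `&` cdom (chart_at p).
  have oO : open O by apply: openI => //; exact: cdom_open.
  have Op : O p by split=> //; exact: chart_atP.
  have Oc : O `<=` cdom (chart_at p) by move=> x [].
  rewrite (flat O (del p i) (del p j) _ oO _ _ _ p Op) ?/ip ?mul0mx ?mxE //.
  + exact: smooth_coord_field.
  + exact: smooth_coord_field.
  + by apply: smooth_section_sub (sF k) => x [].
- move=> eta0; exists (4 * (n%:R - 1) * mu ^+ 2) => p.
  have [Us QUs Usp] := atlas p; have [oU base] := baseP _ QUs.
  have Up : Us.1 (pbase (Us.2 p)) by rewrite base.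
  have /= := RicE _ _ _ (frame _ QUs) Up; have := eta0 _ _ _ (frame _ QUs) Up.
  rewrite base // => eta0p ->.
  rewrite big1 ?scaler0 ?addr0 // => k _; rewrite big1 // => l kl.
  by rewrite (eta0p k l kl) /endo_comp /sharp !mul0mx.
Qed.
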